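(* Let $\mathscr{C}$ be a fiat $2$-category over a field $\Bbbk$, let $\mathcal{J}$ be a (non-zero) two-sided cell in $\mathscr{C}$ and let $\mathcal{L}$ be a left cell in $\mathcal{J}$. Let $\mathscr{I}$ be the unique $2$-ideal of $\mathscr{C}$ such that $\mathscr{A}:=\mathscr{C}/\mathscr{I}$ is $\mathcal{J}$-simple. Put $\mathtt{i}:=\mathtt{i}_{\mathcal{L}}$ and let $\mathscr{K}$ be the unique maximal left $2$-ideal of $\mathscr{A}$ contained in $\mathscr{I}^{\mathscr{A}}_{\mathtt{i}}$ which does not contain $\mathrm{id}_{\mathrm{F}}$ for any $\mathrm{F}\in\mathcal{L}$. View $\mathbb{P}^{\mathscr{A}}_{\mathtt{i}}/\mathscr{K}$ as a $2$-representation of $\mathscr{C}$ via the quotient $2$-functor $\mathscr{C}\to\mathscr{A}$, and let $\mathbf{D}_{\mathcal{L}}$ be the $2$-representation of $\mathscr{C}$ obtained by restricting it to the full additive subcategories $\mathbf{D}_{\mathcal{L}}(\mathtt{j})$ of $(\mathbb{P}^{\mathscr{A}}_{\mathtt{i}}/\mathscr{K})(\mathtt{j})$ generated by the $1$-morphisms of $\mathscr{A}(\mathtt{i},\mathtt{j})$ corresponding to elements of $\mathcal{L}$. Then the $2$-representations $\mathbf{D}_{\mathcal{L}}$ and $\mathbf{C}_{\mathcal{L}}$ of $\mathscr{C}$ are elementary equivalent, where $\mathbf{C}_{\mathcal{L}}$ is the additive cell $2$-representation associated to $\mathcal{L}$.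
   Context: **Fiat $2$-categories.** A $2$-category is a (strict) category enriched over small categories; $\circ$ is composition of $1$-morphisms, $\circ_0$ and $\circ_1$ are horizontal and vertical composition of $2$-morphisms; $\mathrm{F}(\alpha):=\mathrm{id}_{\mathrm{F}}\circ_0\alpha$ and $\alpha_{\mathrm{F}}:=\alpha\circ_0\mathrm{id}_{\mathrm{F}}$. ''Fully additive'' means additive with split idempotents. A $2$-category $\mathscr{C}$ is fiat over the field $\Bbbk$ if: it has finitely many objects; every $\mathscr{C}(\mathtt{i},\mathtt{j})$ is a fully additive $\Bbbk$-linear category with finitely many indecomposable objects up to isomorphism; horizontal compositions are additive and $\Bbbk$-linear; all spaces of $2$-morphisms are finite dimensional; all identity $1$-morphisms $\mathbb{1}_{\mathtt{i}}$ are indecomposable; $\mathscr{C}$ has a weak object-preserving involutive anti-autoequivalence $*$; and for every $1$-morphism $\mathrm{F}\in\mathscr{C}(\mathtt{i},\mathtt{j})$ there are $2$-morphisms $\alpha:\mathrm{F}\circ\mathrm{F}^*\to\mathbb{1}_{\mathtt{j}}$, $\beta:\mathbb{1}_{\mathtt{i}}\to\mathrm{F}^*\circ\mathrm{F}$ with $\alpha_{\mathrm{F}}\circ_1\mathrm{F}(\beta)=\mathrm{id}_{\mathrm{F}}$ and $\mathrm{F}^*(\alpha)\circ_1\beta_{\mathrm{F}^*}=\mathrm{id}_{\mathrm{F}^*}$. **Cells.** Indecomposable $1$-morphisms are identified with their isomorphism classes. For indecomposable $1$-morphisms write $\mathrm{F}\leq_L\mathrm{G}$ (resp. $\mathrm{F}\leq_R\mathrm{G}$,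 $\mathrm{F}\leq_J\mathrm{G}$) if $\mathrm{G}$ is isomorphic to a direct summand of $\mathrm{H}\circ\mathrm{F}$ (resp. $\mathrm{F}\circ\mathrm{H}$, $\mathrm{H}\circ\mathrm{F}\circ\mathrm{H}'$) for some $1$-morphisms $\mathrm{H},\mathrm{H}'$. These are preorders; the classes of the induced equivalence relations are the (non-zero) left, right and two-sided cells. **$2$-representations.** An additive (resp. finitary, abelian) $2$-representation of $\mathscr{C}$ is a $2$-functor from $\mathscr{C}$ to the $2$-category of small fully additive $\Bbbk$-linear categories (resp. such categories with finitely many indecomposables up to isomorphism, resp. such categories equivalent to module categories of finite dimensional $\Bbbk$-algebras), additive $\Bbbk$-linear functors and natural transformations. One writes $\mathrm{F}\,X$ for $\mathbf{M}(\mathrm{F})(X)$. Two $2$-representations $\mathbf{M},\mathbf{N}$ are elementary equivalent if there is a $2$-natural transformation $\Phi:\mathbf{M}\to\mathbf{N}$ or $\Phi:\mathbf{N}\to\mathbf{M}$ such that $\Phi_{\mathtt{j}}$ is an equivalence of categories for every object $\mathtt{j}$. *Abelianization.* For a finitary $\mathbf{M}$, $\overline{\mathbf{M}}(\mathtt{i})$ has objects the morphisms $X\xrightarrow{\alpha}Y$ of $\mathbf{M}(\mathtt{i})$; morphisms from $X\xrightarrow{\alpha}Y$ to $X'\xrightarrow{\alpha'}Y'$ are pairs $(\beta:X\to X',\gamma:Y\to Y')$ with $\gamma\alpha=\alpha'\beta$, modulo those for which there is $\xi:Y\to X'$ with $\gamma=\alpha'\xi$. $\mathscr{C}$ acts component-wise.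 *Cell $2$-representations.* $\mathbb{P}_{\mathtt{i}}:=\mathscr{C}(\mathtt{i},{}_-)$ is the principal additive $2$-representation and $\overline{\mathbb{P}}_{\mathtt{i}}$ its abelianization. For indecomposable $\mathrm{F}\in\mathscr{C}(\mathtt{i},\mathtt{j})$, $P_{\mathrm{F}}$ is the indecomposable projective object $0\to\mathrm{F}$ of $\overline{\mathbb{P}}_{\mathtt{i}}(\mathtt{j})$ and $L_{\mathrm{F}}$ is its simple top. For a left cell $\mathcal{L}$ there is an object $\mathtt{i}=\mathtt{i}_{\mathcal{L}}$ such that every $\mathrm{F}\in\mathcal{L}$ lies in $\mathscr{C}(\mathtt{i},\mathtt{j})$ for some $\mathtt{j}$. It is known (Mazorchuk–Miemietz) that there is a unique $\mathrm{G}_{\mathcal{L}}\in\mathcal{L}$ (the Duflo involution) such that $P_{\mathbb{1}_{\mathtt{i}}}$ has a unique quotient $N$ whose socle is simple and isomorphic to $L_{\mathrm{G}_{\mathcal{L}}}$ and with $\mathrm{F}\,(N/L_{\mathrm{G}_{\mathcal{L}}})=0$ for all $\mathrm{F}\in\mathcal{L}$. Put $Q:=\mathrm{G}_{\mathcal{L}}\,L_{\mathrm{G}_{\mathcal{L}}}\in\overline{\mathbb{P}}_{\mathtt{i}}(\mathtt{i})$. The additive cell $2$-representation $\mathbf{C}_{\mathcal{L}}$ assigns to $\mathtt{j}$ the additive closure in $\overline{\mathbb{P}}_{\mathtt{i}}(\mathtt{j})$ of all $\mathrm{F}\,Q$, $\mathrm{F}\in\mathscr{C}(\mathtt{i},\mathtt{j})$,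 with the action of $\mathscr{C}$ restricted from $\overline{\mathbb{P}}_{\mathtt{i}}$. **$2$-ideals.** A $2$-ideal $\mathscr{I}$ of $\mathscr{C}$ is a choice of $\Bbbk$-subspaces $\mathrm{Hom}_{\mathscr{I}}(\mathrm{F},\mathrm{G})\subset\mathrm{Hom}_{\mathscr{C}(\mathtt{i},\mathtt{j})}(\mathrm{F},\mathrm{G})$ for all $\mathrm{F},\mathrm{G}\in\mathscr{C}(\mathtt{i},\mathtt{j})$ and all $\mathtt{i},\mathtt{j}$, closed under horizontal and vertical composition on both sides with arbitrary $2$-morphisms of $\mathscr{C}$. The quotient $\mathscr{C}/\mathscr{I}$ has the same objects and $1$-morphisms and the quotient spaces as $2$-morphism spaces. The quotient $\mathscr{C}/\mathscr{I}$ is $\mathcal{J}$-simple if the image of $\mathcal{J}$ in it is non-zero and every non-zero $2$-ideal of $\mathscr{C}/\mathscr{I}$ contains $\mathrm{id}_{\mathrm{F}}$ for some $\mathrm{F}\in\mathcal{J}$. It is known that there is exactly one $2$-ideal $\mathscr{I}$ of $\mathscr{C}$ with $\mathscr{C}/\mathscr{I}$ $\mathcal{J}$-simple. **Left $2$-ideals.** A left $2$-ideal $\mathscr{K}$ of a $\Bbbk$-linear $2$-category $\mathscr{A}$ consists of the same objects and, for each $\mathtt{i},\mathtt{j}$, an ideal $\mathscr{K}(\mathtt{i},\mathtt{j})$ of the category $\mathscr{A}(\mathtt{i},\mathtt{j})$, stable under left horizontal multiplication with $1$- and $2$-morphisms of $\mathscr{A}$. $\mathscr{I}^{\mathscr{A}}_{\mathtt{k}}$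 is the left $2$-ideal with $\mathscr{I}^{\mathscr{A}}_{\mathtt{k}}(\mathtt{k},\mathtt{j})=\mathscr{A}(\mathtt{k},\mathtt{j})$ (all $2$-morphisms) and $\mathscr{I}^{\mathscr{A}}_{\mathtt{k}}(\mathtt{i},\mathtt{j})=0$ for $\mathtt{i}\neq\mathtt{k}$. $\mathbb{P}^{\mathscr{A}}_{\mathtt{i}}:=\mathscr{A}(\mathtt{i},{}_-)$, and for a left $2$-ideal $\mathscr{K}\subset\mathscr{I}^{\mathscr{A}}_{\mathtt{i}}$ the quotient $2$-representation $\mathbb{P}^{\mathscr{A}}_{\mathtt{i}}/\mathscr{K}$ sends $\mathtt{j}$ to the quotient category $\mathscr{A}(\mathtt{i},\mathtt{j})/\mathscr{K}(\mathtt{i},\mathtt{j})$, with the induced action. It is known that the maximal left $2$-ideal $\mathscr{K}$ in the claim exists and is unique. *)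

(* Defs.v *)
From HB Require Import structures.
From mathcomp Require Import all_boot all_order all_algebra.
From mathcomp Require Import generic_quotient ring_quotient.
From mathcomp Require Import boolp.
(* Built on MathComp, with the classical axioms of mathcomp.classical.boolp. *)

Set Implicit Arguments. Unset Strict Implicit. Unset Printing Implicit Defensive.
Import GRing.Theory.
Local Open Scope ring_scope.
Local Open Scope quotient_scope.

Section LinearMaps.
Variables (k : fieldType) (U V : lmodType k) (f : U -> V).
Hypothesis lf : linear f.

Lemma linD x y : f (x + y) = f x + f y.
Proof. by rewrite -{1}[x]scale1r lf scale1r. Qed.

Lemma lin0 : f 0 = 0.
Proof. by apply: (addIr (f 0)); rewrite -linD !add0r. Qed.

Lemma linB x y : f (x - y) = f x - f y.
Proof. by rewrite addrC -scaleN1r lf scaleN1r addrC. Qed.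
End LinearMaps.

(* Subspaces are Prop-valued and need not be decidable; submod and quotmod turn
   a subspace and the quotient by it into lmodTypes. *)
Record subspace (k : fieldType) (V : lmodType k) := Subspace {
  subspace_mem :> V -> Prop;
  subspace0 : subspace_mem 0;
  subspaceP : forall (a : k) x y,
    subspace_mem x -> subspace_mem y -> subspace_mem (a *: x + y) }.

Section SubspaceTheory.
Variables (k : fieldType) (V : lmodType k) (S : subspace V).

Lemma subspaceD x y : S x -> S y -> S (x + y).
Proof. by move=> Sx Sy; rewrite -[x]scale1r; apply: subspaceP. Qed.

Lemma subspaceZ a x : S x -> S (a *: x).
Proof. by move=> Sx; rewrite -[_ *: _]addr0; apply: subspaceP => //; apply: subspace0. Qed.

Lemma subspaceB x y : S x -> S y -> S (x - y).
Proof. by move=> Sx Sy; rewrite addrC -scaleN1r; apply: subspaceP. Qed.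

Definition subspace_pred : {pred V} := fun x => `[< S x >].

Lemma subspace_predP x : reflect (S x) (x \in subspace_pred).
Proof. exact: asboolP. Qed.

Lemma subspace_closed : subsemimod_closed subspace_pred.
Proof.
split; first split.
- exact/subspace_predP/subspace0.
- by move=> x y /subspace_predP Sx /subspace_predP Sy; exact/subspace_predP/subspaceD.
- by move=> a x /subspace_predP Sx; exact/subspace_predP/subspaceZ.
Qed.

Record subspace_sort := SubspaceSort {
  subspace_val :> V; _ : subspace_val \in subspace_pred }.
HB.instance Definition _ := [isSub for subspace_val].
HB.instance Definition _ := [Choice of subspace_sort by <:].
HB.instance Definition _ :=
  GRing.SubChoice_isSubLmodule.Build k V subspace_pred subspace_sort subspace_closed.
Definition submod : lmodType k := subspace_sort.

Definition subIn (x : V) (Sx : S x) : submod :=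
  SubspaceSort (introT (subspace_predP x) Sx).
Definition subOut : submod -> V := subspace_val.

Lemma subOutP (u : submod) : S (subOut u).
Proof. by apply/subspace_predP; case: u. Qed.
Lemma subOut_inj : injective subOut. Proof. exact: val_inj. Qed.
Lemma subOut_linear : linear subOut. Proof. by []. Qed.

Lemma subspace_zmod_closed : zmod_closed subspace_pred.
Proof.
split; first exact/subspace_predP/subspace0.
by move=> x y /subspace_predP Sx /subspace_predP Sy; exact/subspace_predP/subspaceB.
Qed.
HB.instance Definition _ := GRing.isZmodClosed.Build V subspace_pred subspace_zmod_closed.

Definition quotient_sort := Quotient.quot subspace_pred.
HB.instance Definition _ := GRing.Zmodule.on quotient_sort.

Definition qin (x : V) : quotient_sort := \pi_(quotient_sort) x.
Definition qrep (q : quotient_sort) : V := repr q.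
Lemma qrepK q : qin (qrep q) = q. Proof. exact: reprK. Qed.
Lemma qin_eq x y : qin x = qin y <-> S (x - y).
Proof.
split=> [/eqP|Sxy]; last apply/eqP.
  by rewrite /qin -Quotient.idealrBE => /subspace_predP.
by rewrite /qin -Quotient.idealrBE; apply/subspace_predP.
Qed.
Lemma qinD x y : qin (x + y) = qin x + qin y.
Proof. by rewrite /qin -pi_addr. Qed.
Definition qscale (a : k) (q : quotient_sort) := qin (a *: qrep q).
Lemma qinZ a x : qin (a *: x) = qscale a (qin x).
Proof. by apply/qin_eq; rewrite -scalerBr; apply/subspaceZ/qin_eq; rewrite qrepK. Qed.

Fact qscaleA a b v : qscale a (qscale b v) = qscale (a * b) v.
Proof. by rewrite -[v]qrepK -!qinZ scalerA. Qed.
Fact qscale1 : left_id 1 qscale.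
Proof. by move=> v; rewrite -[v]qrepK -!qinZ scale1r. Qed.
Fact qscaleDr : right_distributive qscale +%R.
Proof. by move=> a u v; rewrite -[u]qrepK -[v]qrepK -qinD -!qinZ -qinD scalerDr. Qed.
Fact qscaleDl v : {morph qscale^~ v : a b / a + b}.
Proof. by move=> a b; rewrite -[v]qrepK -!qinZ -qinD scalerDl. Qed.
HB.instance Definition _ :=
  GRing.Zmodule_isLmodule.Build k quotient_sort qscaleA qscale1 qscaleDr qscaleDl.
Definition quotmod : lmodType k := quotient_sort.

Lemma qin_linear : linear (qin : V -> quotmod).
Proof. by move=> a x y; rewrite qinD qinZ. Qed.
End SubspaceTheory.

(* A category enriched over k-vector spaces; additivity, splitting of idempotents
   and finiteness are separate predicates below. *)
Record lincat (k : fieldType) := Lincat {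
  ob :> Type;
  mor : ob -> ob -> lmodType k;
  idm : forall X, mor X X;
  cmp : forall X Y Z, mor Y Z -> mor X Y -> mor X Z;
  cmpA : forall X Y Z W (h : mor Z W) (g : mor Y Z) (f : mor X Y),
    cmp h (cmp g f) = cmp (cmp h g) f;
  cmp1m : forall X Y (f : mor X Y), cmp (idm Y) f = f;
  cmpm1 : forall X Y (f : mor X Y), cmp f (idm X) = f;
  cmp_linl : forall X Y Z (f : mor X Y), linear (fun g : mor Y Z => cmp g f);
  cmp_linr : forall X Y Z (g : mor Y Z), linear (fun f : mor X Y => cmp g f) }.
Arguments mor {k l} X Y.
Arguments idm {k l} X.
Arguments cmp {k l X Y Z} g f.

Notation "g \c f" := (cmp g f) (at level 40, left associativity).

Section LincatTheory.
Variables (k : fieldType) (D : lincat k).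
Implicit Types X Y Z : D.

Lemma cmpBl X Y Z (g g' : mor Y Z) (f : mor X Y) : (g - g') \c f = g \c f - g' \c f.
Proof. exact: (linB (cmp_linl f)). Qed.
Lemma cmpBr X Y Z (g : mor Y Z) (f f' : mor X Y) : g \c (f - f') = g \c f - g \c f'.
Proof. exact: (linB (cmp_linr g)). Qed.
Lemma cmp0l X Y Z (f : mor X Y) : (0 : mor Y Z) \c f = 0.
Proof. exact: (lin0 (cmp_linl f)). Qed.
Lemma cmp0r X Y Z (g : mor Y Z) : g \c (0 : mor X Y) = 0.
Proof. exact: (lin0 (cmp_linr g)). Qed.

(* The identity morphism along an equality of objects. Strict equations between
   morphisms whose end points are only propositionally equal are stated by
   composing with these. *)
Definition eqhom X Y (e : X = Y) : mor X Y :=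
  match e in _ = Z return mor X Z with erefl => idm X end.

Lemma eqhom_refl X (e : X = X) : eqhom e = idm X.
Proof. by rewrite (Prop_irrelevance e erefl). Qed.
Lemma eqhom_irr X Y (e e' : X = Y) : eqhom e = eqhom e'.
Proof. by rewrite (Prop_irrelevance e e'). Qed.
Lemma eqhom_trans X Y Z (e : X = Y) (e' : Y = Z) : eqhom e' \c eqhom e = eqhom (etrans e e').
Proof. by case: _ / e'; rewrite cmp1m; apply: eqhom_irr. Qed.
Lemma eqhom_swap X Y X' Y' (e : X = X') (e' : Y = Y') (f : mor X Y) (f' : mor X' Y') :
  eqhom e' \c f = f' \c eqhom e -> eqhom (esym e') \c f' = f \c eqhom (esym e).
Proof. by case: _ / e' f'; case: _ / e => f'; rewrite /= !cmp1m !cmpm1 => ->. Qed.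

Definition is_iso X Y (f : mor X Y) : Prop :=
  exists g : mor Y X, g \c f = idm X /\ f \c g = idm Y.
Definition isom X Y : Prop := exists f : mor X Y, is_iso f.

Definition is_zero X : Prop :=
  (forall Y (f g : mor X Y), f = g) /\ (forall Y (f g : mor Y X), f = g).

Definition is_biproduct A B X : Prop :=
  exists (iA : mor A X) (iB : mor B X) (pA : mor X A) (pB : mor X B),
    [/\ pA \c iA = idm A, pB \c iB = idm B, pA \c iB = 0, pB \c iA = 0 &
        iA \c pA + iB \c pB = idm X].

Definition summand A X : Prop := exists B, is_biproduct A B X.

Definition indecomposable X : Prop :=
  ~ is_zero X /\ forall A B, is_biproduct A B X -> is_zero A \/ is_zero B.

Definition additive_cat : Prop :=
  (exists Z, is_zero Z) /\ forall A B, exists X, is_biproduct A B X.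

Definition split_idempotents : Prop :=
  forall X (e : mor X X), e \c e = e ->
    exists Y (i : mor Y X) (p : mor X Y), p \c i = idm Y /\ i \c p = e.

Definition fully_additive : Prop := additive_cat /\ split_idempotents.

Definition finitely_many_indecomposables : Prop :=
  exists n (e : 'I_n -> D), forall X, indecomposable X -> exists i, isom X (e i).

Inductive direct_sum (S : D -> Prop) : D -> Prop :=
| DirectSum0 X : is_zero X -> direct_sum S X
| DirectSumS A B X : S A -> direct_sum S B -> is_biproduct A B X -> direct_sum S X.

(* Objects isomorphic to direct summands of finite direct sums of objects in S. *)
Definition add_closure (S : D -> Prop) X : Prop :=
  exists2 Y, direct_sum S Y & summand X Y.

Definition is_mono X Y (f : mor X Y) : Prop :=
  forall W (g h : mor W X), f \c g = f \c h -> g = h.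
Definition is_epi X Y (f : mor X Y) : Prop :=
  forall W (g h : mor Y W), g \c f = h \c f -> g = h.

Definition is_cokernel X Y T (s : mor X Y) (c : mor Y T) : Prop :=
  c \c s = 0 /\
  forall Z (f : mor Y Z), f \c s = 0 -> exists! g : mor T Z, g \c c = f.

Definition simple_object S : Prop :=
  ~ is_zero S /\ forall X (m : mor X S), is_mono m -> is_zero X \/ is_iso m.

(* The top P / rad P is T, and T is simple: p is the quotient by the intersection
   of all kernels of maps from P to simple objects. *)
Definition is_simple_top P T (p : mor P T) : Prop :=
  [/\ is_epi p, simple_object T &
      forall S (f : mor P S), simple_object S -> exists g : mor T S, f = g \c p].

(* T is simple and embeds as the sum of all simple subobjects of N. *)
Definition is_simple_socle T N (s : mor T N) : Prop :=
  [/\ is_mono s, simple_object T &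
      forall S (f : mor S N), simple_object S -> exists g : mor S T, f = s \c g].

End LincatTheory.

Definition finite_dim (k : fieldType) (V : lmodType k) : Prop :=
  exists n (e : 'I_n -> V), forall v, exists c : 'I_n -> k, v = \sum_(i < n) c i *: e i.

Record functor (k : fieldType) (D E : lincat k) := Functor {
  fob :> D -> E;
  fmor : forall X Y, mor X Y -> mor (fob X) (fob Y);
  fmor_lin : forall X Y, linear (@fmor X Y);
  fmor1 : forall X, fmor (idm X) = idm (fob X);
  fmorM : forall X Y Z (g : mor Y Z) (f : mor X Y), fmor (g \c f) = fmor g \c fmor f }.
Arguments fmor {k D E} F {X Y} f : rename.
Arguments fmor_lin {k D E} F {X Y} : rename.

Section Functors.
Variables (k : fieldType).
Implicit Types D E : lincat k.

Lemma fmor_eqhom D E (F : functor D E) X Y (e : X = Y) :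
  fmor F (eqhom e) = eqhom (congr1 F e).
Proof. by case: _ / e; rewrite /= fmor1. Qed.

Lemma functor_zero D E (F : functor D E) X : is_zero X -> is_zero (F X).
Proof.
case=> zX _; have e0 : idm (F X) = 0.
  by rewrite -fmor1 (zX _ (idm X) 0) (lin0 (fmor_lin F)).
by split=> Y f g; [rewrite -[f]cmpm1 -[g]cmpm1 | rewrite -[f]cmp1m -[g]cmp1m];
  rewrite e0 ?cmp0r ?cmp0l.
Qed.

Lemma functor_biproduct D E (F : functor D E) A B X :
  is_biproduct A B X -> is_biproduct (F A) (F B) (F X).
Proof.
case=> iA [iB [pA [pB [e1 e2 e3 e4 e5]]]].
exists (fmor F iA), (fmor F iB), (fmor F pA), (fmor F pB).
rewrite -!fmorM e1 e2 e3 e4 !fmor1 (lin0 (fmor_lin F)) (lin0 (fmor_lin F)).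
by rewrite -(linD (fmor_lin F)) e5 fmor1.
Qed.

Lemma functor_add_closure D E (F : functor D E) (S : D -> Prop) (T : E -> Prop) :
  (forall X, S X -> T (F X)) -> forall X, add_closure S X -> add_closure T (F X).
Proof.
move=> ST X [Y SY [B XBY]]; exists (F Y); last by exists (F B); apply: functor_biproduct.
elim: {B X XBY} SY => [X zX | A B X SA _ IH bX].
  exact/DirectSum0/functor_zero.
exact: DirectSumS (ST _ SA) IH (functor_biproduct F bX).
Qed.

Definition idfun_cat D : functor D D.
Proof. by refine (@Functor k D D (fun X => X) (fun X Y f => f) _ _ _). Defined.

Definition comp_functor D E H (G : functor E H) (F : functor D E) : functor D H.
Proof.
refine (@Functor k D H (fun X => G (F X)) (fun X Y f => fmor G (fmor F f)) _ _ _).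
- by move=> X Y a f g; rewrite !fmor_lin.
- by move=> X; rewrite !fmor1.
- by move=> X Y Z g f; rewrite !fmorM.
Defined.

Definition nat_isomorphic D E (F G : functor D E) : Prop :=
  exists t : forall X, mor (F X) (G X),
    (forall X, is_iso (t X)) /\
    (forall X Y (f : mor X Y), t Y \c fmor F f = fmor G f \c t X).

Definition is_equivalence D E (F : functor D E) : Prop :=
  exists G : functor E D,
    nat_isomorphic (comp_functor G F) (idfun_cat D) /\
    nat_isomorphic (comp_functor F G) (idfun_cat E).
End Functors.

Record cat_ideal (k : fieldType) (D : lincat k) := CatIdeal {
  cideal :> forall X Y : D, subspace (mor X Y);
  cideal_l : forall X Y Z (g : mor Y Z) (f : mor X Y),
    cideal X Y f -> cideal X Z (g \c f);
  cideal_r : forall X Y Z (g : mor Y Z) (f : mor X Y),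
    cideal Y Z g -> cideal X Z (g \c f) }.

Section QuotientCategory.
Variables (k : fieldType) (D : lincat k) (I : cat_ideal D).

Definition quot_hom (X Y : D) : lmodType k := quotmod (I X Y).
Definition quot_in X Y (f : mor X Y) : quot_hom X Y := qin (I X Y) f.
Definition quot_rep X Y (q : quot_hom X Y) : mor X Y := qrep q.
Definition quot_cmp X Y Z (g : quot_hom Y Z) (f : quot_hom X Y) : quot_hom X Z :=
  quot_in (quot_rep g \c quot_rep f).

Lemma quot_repK X Y (q : quot_hom X Y) : quot_in (quot_rep q) = q.
Proof. exact: qrepK. Qed.
Lemma quot_in_eq X Y (f g : mor X Y) : quot_in f = quot_in g <-> I X Y (f - g).
Proof. exact: qin_eq. Qed.
Lemma quot_in_lin X Y : linear (@quot_in X Y).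
Proof. exact: qin_linear. Qed.
Lemma quot_inM X Y Z (g : mor Y Z) (f : mor X Y) :
  quot_in (g \c f) = quot_cmp (quot_in g) (quot_in f).
Proof.
apply/quot_in_eq; set g' := quot_rep _; set f' := quot_rep _.
have -> : g \c f - g' \c f' = g \c (f - f') + (g - g') \c f'.
  by rewrite cmpBl cmpBr addrA subrK.
by apply: subspaceD; [apply: cideal_l | apply: cideal_r];
  apply/quot_in_eq; rewrite quot_repK.
Qed.

Definition quotcat : lincat k.
Proof.
refine (@Lincat k D quot_hom (fun X => quot_in (idm X)) quot_cmp _ _ _ _ _).
- move=> X Y Z W h g f; rewrite -[h]quot_repK -[g]quot_repK -[f]quot_repK.
  by rewrite -!quot_inM cmpA.
- by move=> X Y f; rewrite -[f]quot_repK -quot_inM cmp1m.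
- by move=> X Y f; rewrite -[f]quot_repK -quot_inM cmpm1.
- move=> X Y Z f a g g'; rewrite -[f]quot_repK -[g]quot_repK -[g']quot_repK.
  by rewrite -quot_in_lin -!quot_inM -quot_in_lin cmp_linl.
- move=> X Y Z g a f f'; rewrite -[g]quot_repK -[f]quot_repK -[f']quot_repK.
  by rewrite -quot_in_lin -!quot_inM -quot_in_lin cmp_linr.
Defined.

Lemma quot_cmpE (X Y Z : D) (g : mor Y Z) (f : mor X Y) :
  @cmp k quotcat X Y Z (quot_in g) (quot_in f) = quot_in (g \c f).
Proof. by rewrite quot_inM. Qed.
End QuotientCategory.

Section FullSubcategory.
Variables (k : fieldType) (D : lincat k) (P : D -> Prop).

Definition fullsub : lincat k.
Proof.
refine (@Lincat k {X : D | P X} (fun X Y => mor (sval X) (sval Y))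
  (fun X => idm (sval X)) (fun X Y Z g f => g \c f) _ _ _ _ _).
- by move=> *; exact: cmpA.
- by move=> *; exact: cmp1m.
- by move=> *; exact: cmpm1.
- by move=> *; exact: cmp_linl.
- by move=> *; exact: cmp_linr.
Defined.

Lemma fullsub_eq (X Y : fullsub) : sval X = sval Y -> X = Y.
Proof.
case: X Y => [X pX] [Y pY] /= e; case: _ / e pY => pY.
by rewrite (Prop_irrelevance pX pY).
Qed.

Lemma fullsub_eqhom (X Y : fullsub) (e : X = Y) (e' : sval X = sval Y) :
  eqhom e = eqhom e' :> @mor _ D (sval X) (sval Y).
Proof. by move: e'; case: _ / e => e'; rewrite [RHS]eqhom_refl. Qed.

Lemma fullsub_eqhomE (X Y : fullsub) (e : sval X = sval Y) :
  @eqhom k fullsub X Y (fullsub_eq e) = eqhom e.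
Proof. exact: fullsub_eqhom. Qed.
End FullSubcategory.

Definition pairmod (k : fieldType) (U V : lmodType k) : lmodType k := (U * V)%type.

Section Abelianization.
Variables (k : fieldType) (D : lincat k).

Record arrow := Arrow { asrc : D; atgt : D; amor : mor asrc atgt }.

Lemma arrow_eq (X X' Y Y' : D) (e : X = X') (e' : Y = Y') (f : mor X Y) (f' : mor X' Y') :
  eqhom e' \c f = f' \c eqhom e -> Arrow f = Arrow f'.
Proof. by case: _ / e' f'; case: _ / e => f'; rewrite /= cmp1m cmpm1 => ->. Qed.

Definition ab_square (A B : arrow) : subspace (pairmod (mor (asrc A) (asrc B)) (mor (atgt A) (atgt B))).
Proof.
refine (@Subspace k (pairmod (mor (asrc A) (asrc B)) (mor (atgt A) (atgt B)))
  (fun u => u.2 \c amor A = amor B \c u.1) _ _).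
- by rewrite /= cmp0l cmp0r.
- by move=> a x y /= ex ey; rewrite cmp_linl cmp_linr ex ey.
Defined.

(* The pairs that are zero in the abelianization. *)
Definition homotopic0 (A B : arrow) : subspace (submod (ab_square A B)).
Proof.
refine (@Subspace k (submod (ab_square A B))
  (fun u => exists xi : mor (atgt A) (asrc B), (subOut u).2 = amor B \c xi) _ _).
- by exists 0; rewrite cmp0r.
- by move=> a u v [xi ex] [yi ey]; exists (a *: xi + yi); rewrite /= cmp_linr -ex -ey.
Defined.

Definition ab_hom A B : lmodType k := quotmod (homotopic0 A B).
Definition ab_mk A B (b : mor (asrc A) (asrc B)) (c : mor (atgt A) (atgt B))
  (H : c \c amor A = amor B \c b) : ab_hom A B :=
  qin (homotopic0 A B) (@subIn _ _ (ab_square A B) (b, c) H).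

Lemma ab_hom_ind A B (P : ab_hom A B -> Prop) :
  (forall b c (H : c \c amor A = amor B \c b), P (ab_mk H)) -> forall q, P q.
Proof.
move=> IH q; rewrite -[q]qrepK; set u := qrep q.
have := subOutP u; case E: (subOut u) => [b c] /= H.
have -> : u = @subIn _ _ (ab_square A B) (b, c) H by apply: subOut_inj.
exact: IH.
Qed.

Lemma ab_mk_eq A B b c (H : c \c amor A = amor B \c b)
  b' c' (H' : c' \c amor A = amor B \c b') :
  ab_mk H = ab_mk H' <-> exists xi : mor (atgt A) (asrc B), c - c' = amor B \c xi.
Proof. exact: qin_eq. Qed.

Lemma ab_mk_eq_pair A B b c (H : c \c amor A = amor B \c b)
  b' c' (H' : c' \c amor A = amor B \c b') : c = c' -> ab_mk H = ab_mk H'.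
Proof. by move=> e; apply/ab_mk_eq; exists 0; rewrite cmp0r e subrr. Qed.

Lemma ab_mk_lin_subproof A B (a : k) b c (H : c \c amor A = amor B \c b)
  b' c' (H' : c' \c amor A = amor B \c b') :
  (a *: c + c') \c amor A = amor B \c (a *: b + b').
Proof. by rewrite cmp_linl cmp_linr H H'. Qed.

Lemma ab_mk_lin A B (a : k) b c (H : c \c amor A = amor B \c b)
  b' c' (H' : c' \c amor A = amor B \c b') :
  a *: ab_mk H + ab_mk H' = ab_mk (ab_mk_lin_subproof a H H').
Proof. by rewrite /ab_mk -qin_linear; congr qin; apply: subOut_inj. Qed.

Lemma ab_cmp_subproof A B C b c (H : c \c amor B = amor C \c b)
  b' c' (H' : c' \c amor A = amor B \c b') :
  (c \c c') \c amor A = amor C \c (b \c b').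
Proof. by rewrite -cmpA H' cmpA H cmpA. Qed.

Definition ab_cmp A B C (g : ab_hom B C) (f : ab_hom A B) : ab_hom A C :=
  ab_mk (ab_cmp_subproof (subOutP (qrep g)) (subOutP (qrep f))).

Lemma ab_cmpE A B C b c (H : c \c amor B = amor C \c b)
  b' c' (H' : c' \c amor A = amor B \c b') :
  ab_cmp (ab_mk H) (ab_mk H') = ab_mk (ab_cmp_subproof H H').
Proof.
rewrite /ab_cmp; set u := qrep _; set v := qrep _.
have [xi exi] : exists xi, (subOut u).2 - c = amor C \c xi.
  by apply: (iffLR (qin_eq (homotopic0 B C) u (@subIn _ _ (ab_square B C) (b, c) H))); rewrite qrepK.
have [yi eyi] : exists yi, (subOut v).2 - c' = amor B \c yi.
  by apply: (iffLR (qin_eq (homotopic0 A B) v (@subIn _ _ (ab_square A B) (b', c') H'))); rewrite qrepK.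
apply/ab_mk_eq; exists (xi \c (subOut v).2 + b \c yi).
rewrite (linD (cmp_linr _)) !cmpA -exi -H -cmpA -eyi cmpBl cmpBr.
by rewrite addrA subrK.
Qed.

Lemma ab_id_subproof (A : arrow) : idm (atgt A) \c amor A = amor A \c idm (asrc A).
Proof. by rewrite cmp1m cmpm1. Qed.

(* Arrow categories modulo homotopy: X -> Y stands for its cokernel. *)
Definition abcat : lincat k.
Proof.
refine (@Lincat k arrow ab_hom (fun A => ab_mk (ab_id_subproof A)) ab_cmp _ _ _ _ _).
- move=> X Y Z W h g f.
  elim/ab_hom_ind: h => b c H; elim/ab_hom_ind: g => b1 c1 H1; elim/ab_hom_ind: f => b2 c2 H2.
  by rewrite !ab_cmpE; apply: ab_mk_eq_pair; rewrite cmpA.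
- move=> X Y f; elim/ab_hom_ind: f => b c H.
  by rewrite ab_cmpE; apply: ab_mk_eq_pair; rewrite cmp1m.
- move=> X Y f; elim/ab_hom_ind: f => b c H.
  by rewrite ab_cmpE; apply: ab_mk_eq_pair; rewrite cmpm1.
- move=> X Y Z f a g h.
  elim/ab_hom_ind: h => b c H; elim/ab_hom_ind: g => b1 c1 H1; elim/ab_hom_ind: f => b2 c2 H2.
  by rewrite ab_mk_lin !ab_cmpE ab_mk_lin; apply: ab_mk_eq_pair; rewrite cmp_linl.
- move=> X Y Z h a g f.
  elim/ab_hom_ind: h => b c H; elim/ab_hom_ind: g => b1 c1 H1; elim/ab_hom_ind: f => b2 c2 H2.
  by rewrite ab_mk_lin !ab_cmpE ab_mk_lin; apply: ab_mk_eq_pair; rewrite cmp_linr.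
Defined.

Lemma ab_eqhom_subproof (A B : arrow) (e : asrc A = asrc B) (e' : atgt A = atgt B)
  (E : A = B) : eqhom e' \c amor A = amor B \c eqhom e.
Proof. by move: e e'; case: _ / E => e e'; rewrite !eqhom_refl cmp1m cmpm1. Qed.

Lemma ab_eqhom (A B : abcat) (e : asrc A = asrc B) (e' : atgt A = atgt B) (E : A = B) :
  eqhom E = ab_mk (ab_eqhom_subproof e e' E).
Proof.
move: (ab_eqhom_subproof _ _ _); move: e e'; case: _ / E => e e' H.
by apply: ab_mk_eq_pair; rewrite eqhom_refl.
Qed.
End Abelianization.

Section AbelianizedFunctor.
Variables (k : fieldType) (D E : lincat k) (F : functor D E).

Definition ab_fob (A : abcat D) : abcat E := Arrow (fmor F (amor A)).

Lemma ab_fmor_subproof (A B : abcat D) b c (H : c \c amor A = amor B \c b) :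
  fmor F c \c amor (ab_fob A) = amor (ab_fob B) \c fmor F b.
Proof. by rewrite /= -!fmorM H. Qed.

Definition ab_fmor (A B : abcat D) (f : mor A B) : mor (ab_fob A) (ab_fob B) :=
  @ab_mk k E (ab_fob A) (ab_fob B) _ _ (ab_fmor_subproof (subOutP (qrep f))).

Lemma ab_fmorE (A B : abcat D) b c (H : c \c amor A = amor B \c b) :
  ab_fmor (ab_mk H) = @ab_mk k E (ab_fob A) (ab_fob B) _ _ (ab_fmor_subproof H).
Proof.
rewrite /ab_fmor; set u := qrep _.
have [xi exi] : exists xi, (subOut u).2 - c = amor B \c xi.
  by apply: (iffLR (qin_eq (homotopic0 A B) u (@subIn _ _ (ab_square A B) (b, c) H))); rewrite qrepK.
by apply/ab_mk_eq; exists (fmor F xi); rewrite -(linB (fmor_lin F)) exi fmorM.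
Qed.

Definition abfun : functor (abcat D) (abcat E).
Proof.
refine (@Functor k (abcat D) (abcat E) ab_fob ab_fmor _ _ _).
- move=> A B a f g.
  elim/ab_hom_ind: f => b c H; elim/ab_hom_ind: g => b1 c1 H1.
  by rewrite !ab_fmorE !ab_mk_lin ab_fmorE; apply: ab_mk_eq_pair; rewrite fmor_lin.
- by move=> A; rewrite /= ab_fmorE; apply: (@ab_mk_eq_pair k E (ab_fob A) (ab_fob A)); rewrite fmor1.
- move=> X Y Z f g.
  elim/ab_hom_ind: f => b c H; elim/ab_hom_ind: g => b1 c1 H1.
  have -> : cmp (ab_mk H : @mor k (abcat D) Y Z) (ab_mk H1 : @mor k (abcat D) X Y) =
    ab_mk (ab_cmp_subproof H H1) by exact: ab_cmpE.
  rewrite !ab_fmorE; apply: etrans (esym (ab_cmpE _ _)).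
  by apply: (@ab_mk_eq_pair k E (ab_fob X) (ab_fob Z)); rewrite fmorM.
Defined.
End AbelianizedFunctor.

(* Strict k-linear 2-categories. The category of 1-morphisms from i to j is tcat i j;
   c1 composes 1-morphisms, \c is vertical and hc horizontal composition. *)
Record twocat (k : fieldType) := Twocat {
  tob :> Type;
  tcat :> tob -> tob -> lincat k;
  t1 : forall i, tcat i i;
  c1 : forall i j l, tcat j l -> tcat i j -> tcat i l;
  hc : forall i j l (G G' : tcat j l) (F F' : tcat i j),
    mor G G' -> mor F F' -> mor (c1 G F) (c1 G' F');
  hc_linl : forall i j l (G G' : tcat j l) (F F' : tcat i j) (a : mor F F'),
    linear (fun b : mor G G' => hc b a);
  hc_linr : forall i j l (G G' : tcat j l) (F F' : tcat i j) (b : mor G G'),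
    linear (fun a : mor F F' => hc b a);
  hc_id : forall i j l (G : tcat j l) (F : tcat i j),
    hc (idm G) (idm F) = idm (c1 G F);
  hc_cmp : forall i j l (G G' G'' : tcat j l) (F F' F'' : tcat i j)
    (b' : mor G' G'') (b : mor G G') (a' : mor F' F'') (a : mor F F'),
    hc (b' \c b) (a' \c a) = hc b' a' \c hc b a;
  c1A : forall i j l m (H : tcat l m) (G : tcat j l) (F : tcat i j),
    c1 H (c1 G F) = c1 (c1 H G) F;
  c11l : forall i j (F : tcat i j), c1 (t1 j) F = F;
  c11r : forall i j (F : tcat i j), c1 F (t1 i) = F;
  hcA : forall i j l m (H H' : tcat l m) (G G' : tcat j l) (F F' : tcat i j)
    (c : mor H H') (b : mor G G') (a : mor F F'),
    eqhom (c1A H' G' F') \c hc c (hc b a) = hc (hc c b) a \c eqhom (c1A H G F);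
  hc1l : forall i j (F F' : tcat i j) (a : mor F F'),
    eqhom (c11l F') \c hc (idm (t1 j)) a = a \c eqhom (c11l F);
  hc1r : forall i j (F F' : tcat i j) (a : mor F F'),
    eqhom (c11r F') \c hc a (idm (t1 i)) = a \c eqhom (c11r F) }.
Arguments t1 {k t} i.
Arguments c1 {k t i j l} G F : rename.
Arguments hc {k t i j l G G' F F'} b a : rename.
Arguments c1A {k t i j l m} H G F : rename.
Arguments c11l {k t i j} F : rename.
Arguments c11r {k t i j} F : rename.

Notation "G ** F" := (c1 G F) (at level 39, left associativity).
Notation "b \h a" := (hc b a) (at level 39, left associativity).

Section Fiat.
Variables (k : fieldType) (C : twocat k).
Implicit Types i j l m : C.

Definition lwhisker i j l (G : C j l) (F F' : C i j) (a : mor F F') : mor (G ** F) (G ** F') :=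
  idm G \h a.
Definition rwhisker i j l (G G' : C j l) (b : mor G G') (F : C i j) : mor (G ** F) (G' ** F) :=
  b \h idm F.

(* A pseudofunctor st, identity on objects, from C to C with 1- and 2-morphisms
   reversed, whose coherence isomorphisms are
     stc : (G F)^* ~ F^* G^*   and   stu : 1^* ~ 1,
   with an isomorphism of pseudofunctors sti from the identity to st o st. *)
Record anti_involution := AntiInvolution {
  st : forall i j, C i j -> C j i;
  st2 : forall i j (F G : C i j), mor F G -> mor (st G) (st F);
  st2_id : forall i j (F : C i j), st2 (idm F) = idm (st F);
  st2_cmp : forall i j (F G H : C i j) (b : mor G H) (a : mor F G),
    st2 (b \c a) = st2 a \c st2 b;
  stc : forall i j l (G : C j l) (F : C i j), mor (st (G ** F)) (st F ** st G);
  stcV : forall i j l (G : C j l) (F : C i j), mor (st F ** st G) (st (G ** F));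
  stcK : forall i j l (G : C j l) (F : C i j), stcV G F \c stc G F = idm _;
  stcVK : forall i j l (G : C j l) (F : C i j), stc G F \c stcV G F = idm _;
  stc_natural : forall i j l (G G' : C j l) (F F' : C i j) (b : mor G G') (a : mor F F'),
    stc G F \c st2 (b \h a) = (st2 a \h st2 b) \c stc G' F';
  stu : forall i, mor (st (t1 i)) (t1 i);
  stuV : forall i, mor (t1 i) (st (t1 i));
  stuK : forall i, stuV i \c stu i = idm _;
  stuVK : forall i, stu i \c stuV i = idm _;
  stc_assoc : forall i j l m (H : C l m) (G : C j l) (F : C i j),
    eqhom (c1A (st F) (st G) (st H)) \c
      (lwhisker (st F) (stc H G) \c stc (H ** G) F) \c
      eqhom (congr1 (@st i m) (c1A H G F)) =
    rwhisker (stc G F) (st H) \c stc H (G ** F);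
  stc_unitl : forall i j (F : C i j),
    eqhom (c11r (st F)) \c (lwhisker (st F) (stu j) \c stc (t1 j) F) =
    eqhom (congr1 (@st i j) (c11l F));
  stc_unitr : forall i j (F : C i j),
    eqhom (c11l (st F)) \c (rwhisker (stu i) (st F) \c stc F (t1 i)) =
    eqhom (congr1 (@st i j) (c11r F));
  sti : forall i j (F : C i j), mor F (st (st F));
  sti_iso : forall i j (F : C i j), is_iso (sti F);
  sti_natural : forall i j (F G : C i j) (a : mor F G),
    sti G \c a = st2 (st2 a) \c sti F;
  sti_comp : forall i j l (G : C j l) (F : C i j),
    stc (st F) (st G) \c (st2 (stcV G F) \c sti (G ** F)) = sti G \h sti F;
  sti_unit : forall i, stu i \c (st2 (stuV i) \c sti (t1 i)) = idm (t1 i) }.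

Definition adjunction i j (F : C i j) (F' : C j i)
    (alpha : mor (F ** F') (t1 j)) (beta : mor (t1 i) (F' ** F)) : Prop :=
  eqhom (c11l F) \c rwhisker alpha F \c eqhom (c1A F F' F) \c
    lwhisker F beta \c eqhom (esym (c11r F)) = idm F /\
  eqhom (c11r F') \c lwhisker F' alpha \c eqhom (esym (c1A F' F F')) \c
    rwhisker beta F' \c eqhom (esym (c11l F')) = idm F'.

(* c1 and hc are already bilinear in any twocat. *)
Record fiat : Prop := Fiat {
  fiat_objects : exists n (e : 'I_n -> C), forall i, exists x, e x = i;
  fiat_additive : forall i j, fully_additive (C i j);
  fiat_indec : forall i j, finitely_many_indecomposables (C i j);
  fiat_finite_dim : forall i j (F G : C i j), finite_dim (mor F G);
  fiat_one : forall i, indecomposable (t1 i);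
  fiat_involution : exists S : anti_involution,
    forall i j (F : C i j), exists alpha beta, @adjunction i j F (st S F) alpha beta }.

(* 1-morphisms with their end points; cells are predicates on these, closed under
   isomorphism. *)
Record mor1 := Mor1 { msrc : C; mtgt : C; m1 :> C msrc mtgt }.

Inductive leL : mor1 -> mor1 -> Prop :=
| LeL i j l (F : C i j) (G : C i l) (H : C j l) :
    summand G (H ** F) -> leL (Mor1 F) (Mor1 G).

Inductive leJ : mor1 -> mor1 -> Prop :=
| LeJ h i j l (F : C i j) (G : C h l) (H : C j l) (H' : C h i) :
    summand G (H ** F ** H') -> leJ (Mor1 F) (Mor1 G).

Definition is_cell (le : mor1 -> mor1 -> Prop) (X : mor1 -> Prop) : Prop :=
  exists2 F : mor1, indecomposable F &
    forall G : mor1, X G <-> [/\ indecomposable G, le F G & le G F].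

Definition left_cell := is_cell leL.
Definition two_sided_cell := is_cell leJ.
End Fiat.

Record two_ideal (k : fieldType) (C : twocat k) := TwoIdeal {
  tideal :> forall i j : C, cat_ideal (C i j);
  tideal_hl : forall i j l (G G' : C j l) (F F' : C i j) (b : mor G G') (a : mor F F'),
    tideal i j F F' a -> tideal i l _ _ (b \h a);
  tideal_hr : forall i j l (G G' : C j l) (F F' : C i j) (b : mor G G') (a : mor F F'),
    tideal j l G G' b -> tideal i l _ _ (b \h a) }.

Section QuotientTwocat.
Variables (k : fieldType) (C : twocat k) (I : two_ideal C).

Definition qcat (i j : C) : lincat k := quotcat (I i j).

Lemma qcmpE i j (F G H : C i j) (g : mor G H) (f : mor F G) :
  @cmp k (qcat i j) F G H (quot_in (I i j) g) (quot_in (I i j) f) = quot_in (I i j) (g \c f).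
Proof. exact: quot_cmpE. Qed.

Definition qhc i j l (G G' : qcat j l) (F F' : qcat i j)
    (b : mor G G') (a : mor F F') : @mor k (qcat i l) (c1 G F) (c1 G' F') :=
  quot_in (I i l) (quot_rep b \h quot_rep a).

Lemma qhcE i j l (G G' : C j l) (F F' : C i j) (b : mor G G') (a : mor F F') :
  quot_in (I i l) (b \h a) = qhc (quot_in (I j l) b) (quot_in (I i j) a).
Proof.
apply/quot_in_eq; set b' := quot_rep _; set a' := quot_rep _.
have -> : b \h a - b' \h a' = b \h (a - a') + (b - b') \h a'.
  by rewrite (linB (hc_linl a')) (linB (hc_linr b)) addrA subrK.
by apply: subspaceD; [apply: tideal_hl | apply: tideal_hr];
  apply/quot_in_eq; rewrite quot_repK.
Qed.

Lemma quot_eqhom i j (F G : C i j) (e : F = G) (e' : F = G :> qcat i j) :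
  @eqhom k (qcat i j) F G e' = quot_in (I i j) (eqhom e).
Proof. by move: e'; case: _ / e => e'; rewrite eqhom_refl. Qed.

(* C/I: same objects and 1-morphisms as C. *)
Definition quot2 : twocat k.
Proof.
refine (@Twocat k C qcat (fun i => t1 i) (fun i j l G F => c1 G F) qhc
  _ _ _ _ (fun i j l m => c1A) (fun i j => c11l) (fun i j => c11r) _ _ _).
- move=> i j l G G' F F' a x b b'.
  rewrite -[a]quot_repK -[b]quot_repK -[b']quot_repK.
  by rewrite -quot_in_lin -!qhcE -quot_in_lin hc_linl.
- move=> i j l G G' F F' b x a a'.
  rewrite -[b]quot_repK -[a]quot_repK -[a']quot_repK.
  by rewrite -quot_in_lin -!qhcE -quot_in_lin hc_linr.
- by move=> i j l G F; rewrite -qhcE hc_id.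
- move=> i j l G G' G'' F F' F'' b' b a' a.
  rewrite -[b']quot_repK -[b]quot_repK -[a']quot_repK -[a]quot_repK.
  rewrite (qcmpE (quot_rep b') (quot_rep b)) (qcmpE (quot_rep a') (quot_rep a)) -!qhcE.
  by rewrite !qcmpE hc_cmp.
- move=> i j l m H H' G G' F F' c b a.
  rewrite -[c]quot_repK -[b]quot_repK -[a]quot_repK -!qhcE.
  by rewrite !(quot_eqhom (c1A _ _ _)) !qcmpE hcA.
- move=> i j F F' a; rewrite -[a]quot_repK -!qhcE.
  by rewrite !(quot_eqhom (c11l _)) !qcmpE hc1l.
- move=> i j F F' a; rewrite -[a]quot_repK -!qhcE.
  by rewrite !(quot_eqhom (c11r _)) !qcmpE hc1r.
Defined.
End QuotientTwocat.

(* Strict 2-functors from C to k-linear categories. *)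
Record tworep (k : fieldType) (C : twocat k) := Tworep {
  rcat :> C -> lincat k;
  ract : forall i j : C, C i j -> functor (rcat i) (rcat j);
  rnat : forall (i j : C) (F G : C i j), mor F G ->
    forall X : rcat i, mor (ract F X) (ract G X);
  rnat_natural : forall (i j : C) (F G : C i j) (a : mor F G) (X Y : rcat i) (f : mor X Y),
    rnat a Y \c fmor (ract F) f = fmor (ract G) f \c rnat a X;
  rnat_lin : forall (i j : C) (F G : C i j) (X : rcat i),
    linear (fun a : mor F G => rnat a X);
  rnat_id : forall (i j : C) (F : C i j) (X : rcat i), rnat (idm F) X = idm (ract F X);
  rnat_cmp : forall (i j : C) (F G H : C i j) (b : mor G H) (a : mor F G) (X : rcat i),
    rnat (b \c a) X = rnat b X \c rnat a X;
  ract1 : forall (i : C) (X : rcat i), ract (t1 i) X = X;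
  ract1_mor : forall (i : C) (X Y : rcat i) (f : mor X Y),
    eqhom (ract1 Y) \c fmor (ract (t1 i)) f = f \c eqhom (ract1 X);
  ractM : forall (i j l : C) (G : C j l) (F : C i j) (X : rcat i),
    ract G (ract F X) = ract (G ** F) X;
  ractM_mor : forall (i j l : C) (G : C j l) (F : C i j) (X Y : rcat i) (f : mor X Y),
    eqhom (ractM G F Y) \c fmor (ract G) (fmor (ract F) f) =
    fmor (ract (G ** F)) f \c eqhom (ractM G F X);
  rnat_hc : forall (i j l : C) (G G' : C j l) (F F' : C i j) (b : mor G G') (a : mor F F')
      (X : rcat i),
    eqhom (ractM G' F' X) \c (rnat b (ract F' X) \c fmor (ract G) (rnat a X)) =
    rnat (b \h a) X \c eqhom (ractM G F X) }.
Arguments ract {k C} M {i j} F : rename.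
Arguments rnat {k C} M {i j F G} a X : rename.
Arguments ract1 {k C} M {i} X : rename.
Arguments ractM {k C} M {i j l} G F X : rename.

Definition additive_tworep (k : fieldType) (C : twocat k) (M : tworep C) : Prop :=
  forall i : C, fully_additive (M i).

(* Strict 2-natural transformations: compatibility with the action is an equality,
   of objects in tact and of morphisms in tact_mor. *)
Record two_transformation (k : fieldType) (C : twocat k) (M N : tworep C) :=
  TwoTransformation {
  tfun :> forall i : C, functor (M i) (N i);
  tact : forall (i j : C) (F : C i j) (X : M i),
    tfun j (ract M F X) = ract N F (tfun i X);
  tact_mor : forall (i j : C) (F : C i j) (X Y : M i) (f : mor X Y),
    eqhom (tact F Y) \c fmor (tfun j) (fmor (ract M F) f) =
    fmor (ract N F) (fmor (tfun i) f) \c eqhom (tact F X);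
  tact_nat : forall (i j : C) (F G : C i j) (a : mor F G) (X : M i),
    eqhom (tact G X) \c fmor (tfun j) (rnat M a X) =
    rnat N a (tfun i X) \c eqhom (tact F X) }.

Definition elementary_equivalent (k : fieldType) (C : twocat k) (M N : tworep C) : Prop :=
  (exists Phi : two_transformation M N, forall i, is_equivalence (Phi i)) \/
  (exists Phi : two_transformation N M, forall i, is_equivalence (Phi i)).

Section Principal.
Variables (k : fieldType) (C : twocat k) (i : C).

Definition post_functor j l (F : C j l) : functor (C i j) (C i l).
Proof.
refine (@Functor k (C i j) (C i l) (fun X => F ** X)
  (fun X Y f => lwhisker F f) _ _ _).
- by move=> X Y; exact: hc_linr.
- by move=> X; exact: hc_id.
- by move=> X Y Z g f; rewrite /lwhisker -hc_cmp cmp1m.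
Defined.

Definition principal : tworep C.
Proof.
refine (@Tworep k C (fun j => C i j) post_functor
  (fun j l F G a X => rwhisker a X) _ _ _ _
  (fun j X => c11l X) _ (fun j l m G F X => c1A G F X) _ _).
- by move=> j l F G a X Y f; rewrite /= /lwhisker /rwhisker -!hc_cmp !cmp1m !cmpm1.
- by move=> j l F G X; exact: hc_linl.
- by move=> j l F X; exact: hc_id.
- by move=> j l F G H b a X; rewrite /rwhisker -hc_cmp cmp1m.
- by move=> j X Y f; exact: hc1l.
- by move=> j l m G F X Y f; rewrite /= /lwhisker hcA hc_id.
- move=> j l m G G' F F' b a X; rewrite /= /lwhisker /rwhisker -hc_cmp cmpm1 cmp1m.
  exact: hcA.
Defined.
End Principal.

Record rep_ideal (k : fieldType) (C : twocat k) (M : tworep C) := RepIdeal {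
  rideal :> forall i : C, cat_ideal (M i);
  rideal_act : forall (i j : C) (F : C i j) (X Y : M i) (f : mor X Y),
    rideal i X Y f -> rideal j _ _ (fmor (ract M F) f) }.

Section QuotientRep.
Variables (k : fieldType) (C : twocat k) (M : tworep C) (K : rep_ideal M).

Definition qrcat (i : C) : lincat k := quotcat (K i).

Lemma qrcmpE i (X Y Z : M i) (g : mor Y Z) (f : mor X Y) :
  @cmp k (qrcat i) X Y Z (quot_in (K i) g) (quot_in (K i) f) = quot_in (K i) (g \c f).
Proof. exact: quot_cmpE. Qed.

Definition qfmor i j (F : C i j) (X Y : qrcat i) (f : mor X Y) :
  @mor k (qrcat j) (ract M F X) (ract M F Y) :=
  quot_in (K j) (fmor (ract M F) (quot_rep f)).

Lemma qfmorE i j (F : C i j) (X Y : M i) (f : mor X Y) :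
  qfmor F (quot_in (K i) f) = quot_in (K j) (fmor (ract M F) f).
Proof.
apply/quot_in_eq; rewrite -(linB (fmor_lin _)); apply: rideal_act.
by apply/quot_in_eq; rewrite quot_repK.
Qed.

Definition qract i j (F : C i j) : functor (qrcat i) (qrcat j).
Proof.
refine (@Functor k (qrcat i) (qrcat j) (fun X => ract M F X) (@qfmor i j F) _ _ _).
- move=> X Y a f g; rewrite -[f]quot_repK -[g]quot_repK.
  by rewrite -quot_in_lin !qfmorE -quot_in_lin fmor_lin.
- by move=> X; rewrite qfmorE fmor1.
- move=> X Y Z g f; rewrite -[f]quot_repK -[g]quot_repK.
  by rewrite (qrcmpE (quot_rep g) (quot_rep f)) !qfmorE qrcmpE fmorM.
Defined.

Lemma qractE i j (F : C i j) (X Y : M i) (f : mor X Y) :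
  @fmor k (qrcat i) (qrcat j) (qract F) X Y (quot_in (K i) f) =
  quot_in (K j) (fmor (ract M F) f).
Proof. exact: qfmorE. Qed.

Lemma qr_eqhom i (X Y : M i) (e : X = Y) (e' : X = Y :> qrcat i) :
  @eqhom k (qrcat i) X Y e' = quot_in (K i) (eqhom e).
Proof. by move: e'; case: _ / e => e'; rewrite eqhom_refl. Qed.

Definition quotrep : tworep C.
Proof.
refine (@Tworep k C qrcat qract (fun i j F G a X => quot_in (K j) (rnat M a X))
  _ _ _ _ (fun i X => ract1 M X) _ (fun i j l G F X => ractM M G F X) _ _).
- move=> i j F G a X Y f; rewrite -[f]quot_repK !qractE.
  by rewrite !qrcmpE rnat_natural.
- by move=> i j F G X a b c; rewrite rnat_lin quot_in_lin.
- by move=> i j F X; rewrite rnat_id.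
- by move=> i j F G H b a X; rewrite qrcmpE rnat_cmp.
- move=> i X Y f; rewrite -[f]quot_repK !qractE.
  by rewrite !(qr_eqhom (ract1 M _)) !qrcmpE ract1_mor.
- move=> i j l G F X Y f; rewrite -[f]quot_repK !qractE.
  by rewrite !(qr_eqhom (ractM M _ _ _)) !qrcmpE ractM_mor.
- move=> i j l G G' F F' b a X; rewrite !qractE.
  rewrite (qrcmpE (rnat M b (ract M F' X)) (fmor (ract M G) (rnat M a X))).
  by rewrite !(qr_eqhom (ractM M _ _ _)) !qrcmpE rnat_hc.
Defined.
End QuotientRep.

Section SubRep.
Variables (k : fieldType) (C : twocat k) (M : tworep C) (P : forall i : C, M i -> Prop).

Definition rep_stable : Prop :=
  forall (i j : C) (F : C i j) (X : M i), P X -> P (ract M F X).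

Hypothesis PS : rep_stable.

Definition sub_act i j (F : C i j) : functor (fullsub (@P i)) (fullsub (@P j)).
Proof.
refine (@Functor k (fullsub (@P i)) (fullsub (@P j))
  (fun X => exist _ (ract M F (sval X)) (PS F (svalP X)))
  (fun X Y f => fmor (ract M F) f) _ _ _).
- by move=> X Y a f g; exact: (fmor_lin (ract M F)).
- by move=> X; exact: (fmor1 (ract M F)).
- by move=> X Y Z g f; exact: (fmorM (ract M F)).
Defined.

Definition subrep : tworep C.
Proof.
refine (@Tworep k C (fun i => fullsub (@P i)) sub_act (fun i j F G a X => rnat M a (sval X))
  _ _ _ _ (fun i X => fullsub_eq (ract1 M (sval X) : sval (sub_act (t1 i) X) = sval X)) _
  (fun i j l G F X => fullsub_eq (ractM M G F (sval X) :
     sval (sub_act G (sub_act F X)) = sval (sub_act (G ** F) X))) _ _).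
- by move=> i j F G a X Y f; exact: rnat_natural.
- by move=> i j F G X; exact: rnat_lin.
- by move=> i j F X; exact: rnat_id.
- by move=> i j F G H b a X; exact: rnat_cmp.
- move=> i X Y f; rewrite !fullsub_eqhomE.
  exact: ract1_mor.
- move=> i j l G F X Y f; rewrite !fullsub_eqhomE.
  exact: ractM_mor.
- move=> i j l G G' F F' b a X; rewrite !fullsub_eqhomE.
  exact: rnat_hc.
Defined.
End SubRep.

Section AbelianizedRep.
Variables (k : fieldType) (C : twocat k) (M : tworep C).

Lemma ab_rnat_subproof i j (F G : C i j) (a : mor F G) (X : abcat (M i)) :
  rnat M a (atgt X) \c fmor (ract M F) (amor X) =
  fmor (ract M G) (amor X) \c rnat M a (asrc X).
Proof. exact: rnat_natural. Qed.

Definition ab_rnat i j (F G : C i j) (a : mor F G) (X : abcat (M i)) :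
  mor (abfun (ract M F) X) (abfun (ract M G) X) :=
  @ab_mk k (M j) (ab_fob (ract M F) X) (ab_fob (ract M G) X) _ _ (ab_rnat_subproof a X).

Definition ab_ract1 (i : C) (X : abcat (M i)) : abfun (ract M (t1 i)) X = X.
Proof. by case: X => X Y f; exact: arrow_eq (ract1_mor f). Defined.

Definition ab_ractM (i j l : C) (G : C j l) (F : C i j) (X : abcat (M i)) :
  abfun (ract M G) (abfun (ract M F) X) = abfun (ract M (G ** F)) X.
Proof. by case: X => X Y f; exact: arrow_eq (ractM_mor G F f). Defined.


Lemma ab_ract1E i (X : abcat (M i)) :
  eqhom (ab_ract1 X) = ab_mk (@ab_eqhom_subproof k (M i) (abfun (ract M (t1 i)) X) X
    (ract1 M (asrc X)) (ract1 M (atgt X)) (ab_ract1 X)).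
Proof. exact: ab_eqhom. Qed.

Lemma ab_ractME i j l (G : C j l) (F : C i j) (X : abcat (M i)) :
  eqhom (ab_ractM G F X) =
  ab_mk (@ab_eqhom_subproof k (M l) (abfun (ract M G) (abfun (ract M F) X)) (abfun (ract M (G ** F)) X)
    (ractM M G F (asrc X)) (ractM M G F (atgt X)) (ab_ractM G F X)).
Proof. exact: ab_eqhom. Qed.

Definition abrep : tworep C.
Proof.
refine (@Tworep k C (fun i => abcat (M i)) (fun i j F => abfun (ract M F)) ab_rnat
  _ _ _ _ ab_ract1 _ ab_ractM _ _).
- move=> i j F G a X Y f; elim/ab_hom_ind: f => b c H.
  rewrite [fmor (abfun (ract M F)) _]ab_fmorE [fmor (abfun (ract M G)) _]ab_fmorE.
  apply: etrans (ab_cmpE _ _) (etrans _ (esym (ab_cmpE _ _))).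
  by apply: ab_mk_eq_pair; apply: rnat_natural.
- move=> i j F G X x a b; apply: etrans (esym (ab_mk_lin _ _ _)).
  by apply: ab_mk_eq_pair; apply: rnat_lin.
- by move=> i j F X; apply: ab_mk_eq_pair; apply: rnat_id.
- move=> i j F G H b a X; apply: etrans (esym (ab_cmpE _ _)).
  by apply: ab_mk_eq_pair; apply: rnat_cmp.
- move=> i X Y f; elim/ab_hom_ind: f => b c H.
  rewrite [fmor (abfun _) _]ab_fmorE !ab_ract1E.
  apply: etrans (ab_cmpE _ _) (etrans _ (esym (ab_cmpE _ _))).
  by apply: ab_mk_eq_pair; apply: ract1_mor.
- move=> i j l G F X Y f; elim/ab_hom_ind: f => b c H.
  rewrite [fmor (abfun (ract M F)) _]ab_fmorE [fmor (abfun (ract M G)) _]ab_fmorE.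
  rewrite [fmor (abfun (ract M (G ** F))) _]ab_fmorE !ab_ractME.
  apply: etrans (ab_cmpE _ _) (etrans _ (esym (ab_cmpE _ _))).
  by apply: ab_mk_eq_pair; apply: ractM_mor.
- move=> i j l G G' F F' b a X; rewrite [fmor (abfun (ract M G)) _]ab_fmorE !ab_ractME.
  apply: etrans (congr1 (@cmp k (abcat (M l)) _ _ _ _) (ab_cmpE _ _)) _.
  apply: etrans (ab_cmpE _ _) (etrans _ (esym (ab_cmpE _ _))).
  by apply: ab_mk_eq_pair; apply: rnat_hc.
Defined.
End AbelianizedRep.

Section QuotientIdeals.
Variables (k : fieldType) (C : twocat k) (I : two_ideal C).

(* A representation of C/I, viewed as one of C along the quotient 2-functor. *)
Definition pullrep (M : tworep (quot2 I)) : tworep C.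
Proof.
refine (@Tworep k C (fun i => M i) (fun i j F => @ract k (quot2 I) M i j F)
  (fun i j F G a X => @rnat k (quot2 I) M i j F G (quot_in (I i j) a) X)
  _ _ _ _ (fun i X => ract1 M X) _
  (fun i j l G F X => @ractM k (quot2 I) M i j l G F X) _ _).
- by move=> *; exact: rnat_natural.
- by move=> i j F G X a b c; rewrite quot_in_lin; exact: (@rnat_lin k (quot2 I) M).
- by move=> i j F X; exact: (@rnat_id k (quot2 I) M).
- move=> i j F G H b a X; rewrite -qcmpE; exact: (@rnat_cmp k (quot2 I) M).
- by move=> *; exact: (@ract1_mor k (quot2 I) M).
- by move=> *; exact: (@ractM_mor k (quot2 I) M).
- by move=> i j l G G' F F' b a X; rewrite qhcE; exact: (@rnat_hc k (quot2 I) M).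
Defined.

Definition J_simple (J : mor1 C -> Prop) : Prop :=
  (exists2 F : mor1 C, J F & ~ @is_zero k (quot2 I (msrc F) (mtgt F)) F) /\
  forall R : two_ideal (quot2 I),
    (exists (i j : quot2 I) (F G : quot2 I i j) (a : mor F G), R i j F G a /\ a <> 0) ->
    exists2 F : mor1 C, J F & R (msrc F) (mtgt F) F F (idm _).
End QuotientIdeals.

Record left_ideal (k : fieldType) (A : twocat k) := LeftIdeal {
  lideal :> forall i j : A, cat_ideal (A i j);
  lideal_h : forall (i j l : A) (G G' : A j l) (F F' : A i j) (b : mor G G') (a : mor F F'),
    lideal i j F F' a -> lideal i l _ _ (b \h a) }.

Definition left_sub (k : fieldType) (A : twocat k) (K K' : left_ideal A) : Prop :=
  forall (i j : A) (F G : A i j) (a : mor F G), K i j F G a -> K' i j F G a.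

Section LeftIdeals.
Variables (k : fieldType) (A : twocat k).

Definition source_subspace (i0 i j : A) (F G : A i j) : subspace (mor F G).
Proof.
refine (@Subspace k (mor F G) (fun a => i = i0 \/ a = 0) _ _); first by right.
move=> x a b [e | ->] [e' | ->]; try by left.
by right; rewrite scaler0 addr0.
Defined.

Definition source_cat_ideal (i0 i j : A) : cat_ideal (A i j).
Proof.
refine (@CatIdeal k (A i j) (fun F G => source_subspace i0 F G) _ _).
- by move=> F G H b a [e | ->]; [left | right; rewrite cmp0r].
- by move=> F G H b a [e | ->]; [left | right; rewrite cmp0l].
Defined.

(* All 2-morphisms between 1-morphisms with source i0, and 0 elsewhere. *)
Definition source_ideal (i0 : A) : left_ideal A.
Proof.
refine (@LeftIdeal k A (source_cat_ideal i0) _).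
move=> i j l G G' F F' b a [e | ->]; [by left | right].
exact: (lin0 (hc_linr b)).
Defined.

Definition row_ideal (i : A) (K : left_ideal A) : rep_ideal (principal i).
Proof.
refine (@RepIdeal k A (principal i) (fun j => K i j) _).
by move=> j l F X Y f; exact: lideal_h.
Defined.
End LeftIdeals.

Section CellRepresentations.
Variables (k : fieldType) (C : twocat k).
Variable L : mor1 C -> Prop.

Section ViaQuotient.
Variables (I : two_ideal C) (i : C).
Implicit Types K : left_ideal (quot2 I).

Definition avoids_identities K : Prop :=
  forall F : mor1 C, L F -> ~ K (msrc F) (mtgt F) F F (idm _).

Definition maximal_left_ideal K : Prop :=
  [/\ left_sub K (@source_ideal k (quot2 I) i), avoids_identities K &
      forall K', left_sub K' (@source_ideal k (quot2 I) i) -> avoids_identities K' ->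
        left_sub K K' -> left_sub K' K].

(* The quotient of the principal representation of C/I by K, as one of C. *)
Definition principal_quotient K : tworep C :=
  pullrep (quotrep (@row_ideal k (quot2 I) i K)).

Definition D_object K (j : C) (X : principal_quotient K j) : Prop :=
  add_closure (fun F : principal_quotient K j => L (@Mor1 k C i j F)) X.
End ViaQuotient.

Section ViaDuflo.
Variable i : C.

Definition Pbar : tworep C := abrep (principal i).

Definition proj_object (j : C) (Z F : C i j) : Pbar j := @Arrow k (C i j) Z F 0.

(* S is a choice of the simple top of the projective object 0 -> F. *)
Definition simple_top_of (j : C) (F : C i j) (S : Pbar j) : Prop :=
  exists2 Z : C i j, is_zero Z & exists p : mor (proj_object Z F) S, is_simple_top p.

(* q exhibits N as a quotient of P with simple socle s : S -> N, where S is the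
   simple top attached to G, and every F in L annihilates T = N / S. *)
Definition duflo_quotient (G : C i i) (P N : Pbar i) (q : mor P N) : Prop :=
  is_epi q /\
  exists (S : Pbar i) (s : mor S N),
    [/\ simple_top_of G S, is_simple_socle s &
      exists (T : Pbar i) (c : mor N T), is_cokernel s c /\
        forall (j : C) (F : C i j), L (Mor1 F) -> is_zero (ract Pbar F T)].

Definition duflo_involution (G : C i i) : Prop :=
  L (Mor1 G) /\
  exists2 Z : C i i, is_zero Z &
    exists (N : Pbar i) (q : mor (proj_object Z (t1 i)) N), duflo_quotient G q /\
      forall (N' : Pbar i) (q' : mor (proj_object Z (t1 i)) N'), duflo_quotient G q' ->
        exists2 u : mor N N', is_iso u & u \c q = q'.

Definition cell_object (Q : Pbar i) (j : C) (X : Pbar j) : Prop :=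
  add_closure (fun Y : Pbar j => exists F : C i j, Y = ract Pbar F Q) X.

Lemma cell_object_stable (Q : Pbar i) : rep_stable (@cell_object Q).
Proof.
move=> j l F X; apply: functor_add_closure => Y [H ->].
by exists (F ** H); rewrite ractM.
Qed.

(* S is a choice of the simple object attached to G; cell_object is closed under
   isomorphism, so this choice is immaterial. *)
Definition cell_tworep (G : C i i) (S : Pbar i) : tworep C :=
  subrep (@cell_object_stable (ract Pbar G S)).
End ViaDuflo.
End CellRepresentations.

(* Main.v *)
Require Import Defs.
From HB Require Import structures.
From mathcomp Require Import all_boot all_order all_algebra.
From mathcomp Require Import boolp.

Set Implicit Arguments.
Unset Strict Implicit.
Unset Printing Implicit Defensive.
Import GRing.Theory.
Local Open Scope ring_scope.

(** Let S be the simple top of P_G and N the quotient of P_1 with socle S, and let T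
    be the cokernel of S -> N, which every F in L annihilates. Evaluation at S, the
    assignment X |-> X S, commutes strictly with the action of C, and it induces an
    equivalence from D_L to C_L.

    An object of the abelianization is an arrow r : A -> B, standing for its cokernel.
    Its elements at M are the maps M -> B, and they vanish when they factor through r;
    so all computations take place in C. Composition with X has a left adjoint X',
    whence the elements of X S at M are those of S at X' M, and as S is the simple top
    of P_G, a nonzero element at M makes G a summand of M ([simple_support]).

    If X annihilates T then X S = X N, because X is exact, and this is a quotient of
    X P_1 = P_X ([socle_generator]). Two consequences follow.
    - Every map X S -> Y S is f S for some f : X -> Y ([socle_full]): lift the image of
      the generator of X S.
    - If f : X -> Y lies in a left ideal and f S is not zero, the left ideal contains
      id_G ([ideal_vanishes]). Indeed the generator of X S goes to a nonzero element of
      Y S, that is, of S at Y' X. So there is a map G -> Y' X whose composite g with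
      the transpose Y' X -> 1 of f hits the socle of N. The image of G g in G N = G S is
      everything, and P_G is local, so that G g : G G -> G is a split epimorphism, and
      it lies in the ideal ([duflo_in_ideal]).
    As K does not contain id_G, it vanishes on S between 1-morphisms annihilating T.
    Conversely the 2-morphisms that vanish on S form a left ideal without any id_F, F in
    L, so that K contains them by maximality ([vanishing_pulled]). Hence evaluation at S
    is full and faithful on the part of D_L made of sums of elements of L.

    An object of D_L is such a sum only up to 1-morphisms X that become zero in the
    quotient by K, and for these X S = 0 is needed. This holds because G is a summand of
    some H X as soon as X S is not zero ([not_kills_le]), a fact that reduces by duality
    to the case X = G', where it follows from G being a summand of G' G
    ([duflo_retract_dual]). By Krull-Schmidt decompositions the objects of D_L are then,
    already in C, sums of elements of L and of 1-morphisms annihilating S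
    ([D_object_direct_sum]). Evaluation is essentially surjective because C_L is
    generated by the objects H Q = H (G S) = (H G) S, and H G is an object of D_L. *)

(** * Finite-dimensional linear algebra *)

Section LinearAlgebra.
Variables (k : fieldType) (V : lmodType k).

Definition dependent n (v : 'I_n -> V) : Prop :=
  exists2 c : 'I_n -> k, exists i, c i != 0 & \sum_(i < n) c i *: v i = 0.

Lemma subspace_sum (S : subspace V) n (c : 'I_n -> k) (v : 'I_n -> V) :
  (forall i, S (v i)) -> S (\sum_(i < n) c i *: v i).
Proof.
move=> Sv; elim/big_rec: _ => [|i x _ Sx]; first exact: subspace0.
by apply: subspaceP.
Qed.

Lemma sum_scale_matrix m n (u : 'I_m -> k) (A : 'M[k]_(m, n)) (e : 'I_n -> V) :
  \sum_(i < m) u i *: (\sum_(j < n) A i j *: e j) =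
  \sum_(j < n) ((\row_i u i) *m A) 0 j *: e j.
Proof.
under eq_bigr do rewrite scaler_sumr.
rewrite exchange_big /=; apply: eq_bigr => j _.
rewrite mxE scaler_suml; apply: eq_bigr => i _.
by rewrite mxE scalerA.
Qed.

Lemma finite_dim_dependent : finite_dim V ->
  exists n, forall v : 'I_n.+1 -> V, dependent v.
Proof.
case=> n [e spanV]; exists n => v.
have [c vE] := choice (fun i => spanV (v i)).
pose A : 'M[k]_(n.+1, n) := \matrix_(i, j) c i j.
have : kermx A != 0 by rewrite kermx_eq0 /row_free neq_ltn ltnS rank_leq_col.
case/rowV0Pn=> u /sub_kermxP uA u0.
have [i ui] : exists i, u 0 i != 0.
  apply/existsP; apply: contraNT u0 => /existsPn u0; apply/eqP/rowP => i.
  by rewrite mxE; apply/eqP; have := u0 i; rewrite negbK.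
exists (fun i => u 0 i); first by exists i.
have vA l : v l = \sum_(j < n) A l j *: e j.
  by rewrite vE; apply: eq_bigr => j _; rewrite mxE.
under eq_bigr do rewrite vA.
rewrite sum_scale_matrix big1 // => j _.
have -> : \row_i0 u 0 i0 = u by apply/rowP => l; rewrite mxE.
by rewrite uA mxE scale0r.
Qed.

(** The rows of a matrix of maximal rank among those whose rows, read as
    coordinates, lie in the subspace give generators. *)
Lemma subspace_finitely_generated (S : subspace V) : finite_dim V ->
  exists m (f : 'I_m -> V), (forall i, S (f i)) /\
    forall v, S v -> exists c : 'I_m -> k, v = \sum_(i < m) c i *: f i.
Proof.
case=> n [e spanV].
pose rows_in (A : 'M[k]_n) := forall i, S (\sum_(j < n) A i j *: e j).
pose P r := `[< exists2 A, rows_in A & \rank A = r >].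
have exP : exists r, P r.
  exists 0; apply/asboolP; exists 0; last exact: mxrank0.
  by move=> i; rewrite big1 => [|j _]; [exact: subspace0 | rewrite mxE scale0r].
have ubP r : P r -> (r <= n)%N by case/asboolP=> A _ <-; exact: rank_leq_row.
case: (ex_maxnP exP ubP) => r /asboolP[A SA rA] rmax.
exists n, (fun i => \sum_(j < n) A i j *: e j); split=> // v Sv.
have [c vE] := spanV v; pose cv : 'rV[k]_n := \row_j c j.
have comb (m : nat) (B : 'M[k]_(m, n)) (u : 'rV[k]_m) :
    (forall i, S (\sum_(j < n) B i j *: e j)) ->
    S (\sum_(j < n) (u *m B) 0 j *: e j).
  move=> SB; have -> : u = \row_i (fun i => u 0 i) i by apply/rowP => l; rewrite mxE.
  by rewrite -sum_scale_matrix; apply: subspace_sum.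
have cvA : (cv <= A)%MS.
  have SAc : rows_in (A + cv)%MS.
    move=> i; have /sub_addsmxP[[u w] /= rE] := row_sub i (A + cv)%MS.
    have -> : \sum_(j < n) (A + cv)%MS i j *: e j =
        \sum_(j < n) (u *m A) 0 j *: e j + \sum_(j < n) (w *m cv) 0 j *: e j.
      rewrite -big_split /=; apply: eq_bigr => j _; rewrite -scalerDl.
      by congr (_ *: _); have /rowP/(_ j) := rE; rewrite !mxE.
    apply: subspaceD; apply: comb => // l.
    by rewrite (_ : \sum_(j < n) _ = v) // vE; apply: eq_bigr => j _; rewrite mxE.
  have : (\rank (A + cv) <= r)%N by apply: rmax; apply/asboolP; exists (A + cv)%MS.
  rewrite -rA => le_rank; apply: submx_trans (addsmxSr A cv) _.
  have := mxrank_leqif_sup (addsmxSl A cv) => -[_ <-].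
  by rewrite eqn_leq le_rank mxrankS // addsmxSl.
have [u cE] := submxP cvA; exists (fun i => u 0 i).
rewrite sum_scale_matrix vE; apply: eq_bigr => j _; congr (_ *: _).
have -> : \row_i u 0 i = u by apply/rowP => l; rewrite mxE.
by rewrite -cE mxE.
Qed.

End LinearAlgebra.

(** * Endomorphisms, idempotents and indecomposable objects *)

Section Endomorphisms.
Variables (k : fieldType) (D : lincat k).
Implicit Types X Y Z : D.

Lemma cmpDl X Y Z (g g' : mor Y Z) (f : mor X Y) : (g + g') \c f = g \c f + g' \c f.
Proof. exact: (linD (cmp_linl f)). Qed.
Lemma cmpDr X Y Z (g : mor Y Z) (f f' : mor X Y) : g \c (f + f') = g \c f + g \c f'.
Proof. exact: (linD (cmp_linr g)). Qed.
Lemma cmpZl X Y Z a (g : mor Y Z) (f : mor X Y) : (a *: g) \c f = a *: (g \c f).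
Proof. by rewrite -[a *: g]addr0 (cmp_linl f) cmp0l addr0. Qed.
Lemma cmpZr X Y Z a (g : mor Y Z) (f : mor X Y) : g \c (a *: f) = a *: (g \c f).
Proof. by rewrite -[a *: f]addr0 (cmp_linr g) cmp0r addr0. Qed.
Lemma cmp_suml X Y Z n (g : 'I_n -> mor Y Z) (f : mor X Y) :
  (\sum_(i < n) g i) \c f = \sum_(i < n) g i \c f.
Proof.
elim/big_rec2: _ => [|i x y _ <-]; [exact: cmp0l | exact: cmpDl].
Qed.
Lemma cmp_sumr X Y Z n (g : mor Y Z) (f : 'I_n -> mor X Y) :
  g \c (\sum_(i < n) f i) = \sum_(i < n) g \c f i.
Proof.
elim/big_rec2: _ => [|i x y _ <-]; [exact: cmp0r | exact: cmpDr].
Qed.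

(** An alias that carries the ring structure given by composition. *)
Definition endo X : Type := mor X X.
HB.instance Definition _ X := GRing.Lmodule.on (endo X).
HB.instance Definition _ X := @GRing.Zmodule_isPzRing.Build (endo X) (idm X)
  (fun f g => f \c g) (fun f g h => cmpA f g h) (@cmp1m k D X X) (@cmpm1 k D X X)
  (fun f g h => cmpDl f g h) (fun f g h => cmpDr f g h).

(** Finite dimension enters through this bound n, which is strictly smaller for proper
    summands: see [biproduct_endo_dim]. *)
Definition endo_finite X : Prop := exists n, forall v : 'I_n.+1 -> mor X X, dependent v.

(** The lowest power of x occurring in a linear relation between the powers of x
    is a multiple of the next one; e is the idempotent that projects onto the part
    of X where x is invertible, along the part where x is nilpotent. *)
Lemma fitting_idempotent X (x : endo X) : endo_finite X ->
  exists (e z : endo X) n,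
    [/\ e * e = e, x * z = e, z * x = e & x ^+ n.+1 * (1 - e) = 0].
Proof.
case=> m /(_ (fun i => x ^+ i)) [c [i0 ci0] sum0].
pose P j := (if insub j is Some i then c i != 0 else false).
have exP : exists j, P j by exists i0; rewrite /P valK.
case: (ex_minnP exP) => n; rewrite /P; case: insubP => // i _ vi ci nmin.
have low (j : 'I_m.+1) : (j < n)%N -> c j = 0.
  by move=> lt_jn; apply: contraTeq lt_jn => cj; rewrite -leqNgt nmin // /P valK.
pose y : endo X := - (c i)^-1 *: \sum_(j < m.+1 | (n < j)%N) c j *: (x ^+ (j - n.+1) : endo X).
have comm_xy : GRing.comm x y.
  rewrite /y /GRing.comm [LHS]cmpZr [RHS]cmpZl; congr (_ *: _).
  apply: (@commr_sum (endo X)) => j _; rewrite /GRing.comm [LHS]cmpZr [RHS]cmpZl.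
  by congr (_ *: _); rewrite -[LHS]exprS -[RHS]exprSr.
have xn : x ^+ n = x ^+ n.+1 * y.
  rewrite [RHS]cmpZr.
  have -> : cmp (x ^+ n.+1 : endo X) (\sum_(j < m.+1 | (n < j)%N) c j *: (x ^+ (j - n.+1) : endo X)) =
      \sum_(j < m.+1 | (n < j)%N) c j *: (x ^+ j : endo X).
    elim/big_rec2: _ => [|j a b lt_nj <-]; first exact: cmp0r.
    rewrite cmpDr cmpZr; congr (_ *: _ + _).
    by have := exprD x n.+1 (j - n.+1); rewrite subnKC // => ->.
  move: sum0; rewrite (bigID (fun j : 'I_m.+1 => (n < j)%N) xpredT) /= addrC.
  rewrite (bigD1 i) /=; last by rewrite vi ltnn.
  rewrite big1 ?addr0 => [|j]; last first.
    rewrite -leqNgt => /andP[le_jn ne_ji]; rewrite low ?scale0r //.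
    by rewrite ltn_neqAle le_jn -vi andbT; apply: contra ne_ji => /eqP/val_inj->.
  move/(congr1 ( *:%R (c i)^-1)); rewrite scaler0 scalerDr scalerA mulVf // scale1r vi.
  by move/eqP; rewrite addr_eq0 => /eqP ->; rewrite scaleNr.
(* Hence x^(n+1) = x^(2n+2) y^(n+1), and x^(n+1) y^(n+1) is idempotent. *)
have xnr r : x ^+ n = x ^+ (n + r) * y ^+ r.
  elim: r => [|r IH]; first by rewrite addn0 mulr1.
  by rewrite {1}IH [y ^+ r.+1]exprS mulrA addnS addnC exprD xn mulrA -exprD addnS.
have xN : x ^+ n.+1 = x ^+ n.+1 * x ^+ n.+1 * y ^+ n.+1.
  by rewrite {1}exprS (xnr n.+1) mulrA -exprS -exprD addSn.
have comm r s : GRing.comm (x ^+ r) (y ^+ s).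
  exact/GRing.commrX/GRing.commr_sym/GRing.commrX/GRing.commr_sym.
exists (x ^+ n.+1 * y ^+ n.+1), (x ^+ n * y ^+ n.+1), n; split.
- by rewrite -mulrA (mulrA (y ^+ _)) -comm !mulrA -xN.
- by rewrite mulrA -exprS.
- by rewrite -mulrA -[in y ^+ _ * x](expr1 x) -comm mulrA -exprSr.
- by rewrite mulrBr mulr1 mulrA -xN subrr.
Qed.

End Endomorphisms.

Section Retracts.
Variables (k : fieldType) (D : lincat k).
Implicit Types A B X Y Z : D.

Definition retract A X : Prop := exists (i : mor A X) (p : mor X A), p \c i = idm A.

Lemma retract_trans A X Y : retract A X -> retract X Y -> retract A Y.
Proof.
case=> i [p pi] [j [q qj]]; exists (j \c i), (p \c q).
by rewrite cmpA -(cmpA p) qj cmpm1.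
Qed.

Lemma isom_retract A X : isom A X -> retract A X.
Proof. by case=> f [g [gf _]]; exists f, g. Qed.

Lemma isom_refl X : isom X X.
Proof. by exists (idm X), (idm X); rewrite cmp1m. Qed.

Lemma isom_sym X Y : isom X Y -> isom Y X.
Proof. by case=> f [g [gf fg]]; exists g, f. Qed.

Lemma eqhom_isom X Y (e : X = Y) : isom X Y.
Proof. by case: _ / e; exact: isom_refl. Qed.

Lemma summand_retract A X : summand A X -> retract A X.
Proof. by case=> B [i [_ [p [_ [pi _ _ _ _]]]]]; exists i, p. Qed.

Lemma is_zeroP X : is_zero X <-> idm X = 0.
Proof.
split=> [[zX _] | e0]; first exact: zX.
by split=> Y f g; [rewrite -[f]cmpm1 -[g]cmpm1 | rewrite -[f]cmp1m -[g]cmp1m];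
  rewrite e0 ?cmp0r ?cmp0l.
Qed.

Lemma retract_zero A X : retract A X -> is_zero X -> is_zero A.
Proof.
case=> i [p pi] [_ zX]; apply/is_zeroP.
by rewrite -pi (zX _ i 0) cmp0r.
Qed.

Lemma idempotent_biproduct X (e : mor X X) : split_idempotents D -> e \c e = e ->
  exists A B (i : mor A X) (p : mor X A),
    [/\ is_biproduct A B X, p \c i = idm A, i \c p = e &
        is_zero B -> e = idm X].
Proof.
move=> splitD ee.
have ff : (idm X - e) \c (idm X - e) = idm X - e.
  by rewrite cmpBl cmp1m cmpBr cmpm1 ee subrr subr0.
have [A [i [p [pi ip]]]] := splitD _ _ ee.
have [B [j [q [qj jq]]]] := splitD _ _ ff.
exists A, B, i, p; split=> //; last first.
  move=> [zB _]; apply/eqP; rewrite eq_sym -subr_eq0 -jq; apply/eqP.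
  by rewrite (zB _ j 0) cmp0l.
exists i, j, p, q; split=> //; last by rewrite ip jq addrC subrK.
- rewrite -[p]cmp1m -[j]cmpm1 -pi -qj (cmpA j) jq -(cmpA p) ip.
  by rewrite (cmpA (p \c e)) -(cmpA p e) cmpBr cmpm1 ee subrr cmp0r cmp0l.
- rewrite -[q]cmp1m -[i]cmpm1 -pi -qj (cmpA i) ip -(cmpA q) jq.
  by rewrite (cmpA (q \c _)) -(cmpA q) cmpBl cmp1m ee subrr cmp0r cmp0l.
Qed.

Lemma retract_summand A X : split_idempotents D -> retract A X -> summand A X.
Proof.
move=> splitD [i [p pi]].
have ee : (i \c p) \c (i \c p) = i \c p by rewrite cmpA -(cmpA i) pi cmpm1.
have [A' [B [i' [p' [bX pi' ip' _]]]]] := idempotent_biproduct splitD ee.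
exists B; case: bX => iA [iB [pA [pB [e1 e2 e3 e4 e5]]]].
have uv : (p' \c i) \c (p \c i') = idm A'.
  by rewrite cmpA -(cmpA p') -ip' (cmpA p') pi' cmp1m pi'.
have vu : (p \c i') \c (p' \c i) = idm A.
  by rewrite cmpA -(cmpA p) ip' cmpA pi cmp1m pi.
exists (iA \c (p' \c i)), iB, ((p \c i') \c pA), pB; split=> //.
- by rewrite cmpA -(cmpA (p \c i')) e1 cmpm1.
- by rewrite -cmpA e3 cmp0r.
- by rewrite cmpA e4 cmp0l.
- by rewrite cmpA -(cmpA iA) uv cmpm1.
Qed.

Lemma indecomposable_idempotent X (e : mor X X) : split_idempotents D ->
  indecomposable X -> e \c e = e -> e = 0 \/ e = idm X.
Proof.
move=> splitD [_ indX] ee.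
have [A [B [i [p [bX pi ip zB]]]]] := idempotent_biproduct splitD ee.
case: (indX _ _ bX) => [zA | /zB]; last by right.
by left; case: zA => zA _; rewrite -ip (zA _ i 0) cmp0l.
Qed.

(** The Fitting idempotent of x is 0 or 1, so that x is nilpotent or invertible. *)
Lemma indecomposable_local X (x : mor X X) : split_idempotents D ->
  indecomposable X -> endo_finite X -> is_iso x \/ is_iso (idm X - x).
Proof.
move=> splitD indX finX.
have [e [z [n [ee xz zx nil]]]] := fitting_idempotent (x : endo X) finX.
case: (indecomposable_idempotent splitD indX ee) => e01.
(* If e = 0 then x is nilpotent, and 1 - x is inverted by a geometric sum. *)
- right; move: nil; rewrite e01 subr0 mulr1 => xn0.
  exists (\sum_(i < n.+1) (x : endo X) ^+ i : endo X).
  have := subrX1 (x : endo X) n.+1; rewrite xn0 sub0r => /(congr1 -%R).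
  rewrite opprK -mulNr opprB => inv.
  split; last exact: esym inv.
  apply: etrans (esym inv).
  apply/esym/(@commr_sum (endo X)) => i _; apply/GRing.commrX.
  by rewrite /GRing.comm mulrBl mulrBr mul1r mulr1.
- by left; exists z; split; [apply: etrans zx _ | apply: etrans xz _].
Qed.

End Retracts.

(** * Direct sums and additive closures *)

Section DirectSums.
Variables (k : fieldType) (D : lincat k).
Implicit Types A B X Y Z : D.
Implicit Types S : D -> Prop.

Let cmp_eqr (W1 W2 W3 W4 : D) (f : mor W3 W4) (g : mor W2 W3) (h : mor W1 W2) (u : mor W1 W3) :
  g \c h = u -> f \c g \c h = f \c u.
Proof. by move=> <-; rewrite cmpA. Qed.
Arguments cmp_eqr {W1 W2 W3 W4 f g h u}.

Lemma is_biproduct_sym A B X : is_biproduct A B X -> is_biproduct B A X.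
Proof.
by case=> iA [iB [pA [pB [e1 e2 e3 e4 e5]]]]; exists iB, iA, pB, pA; rewrite addrC.
Qed.

Lemma is_biproduct_isom A B X Y : is_biproduct A B X -> isom X Y -> is_biproduct A B Y.
Proof.
case=> iA [iB [pA [pB [e1 e2 e3 e4 e5]]]] [f [g [gf fg]]].
exists (f \c iA), (f \c iB), (pA \c g), (pB \c g).
split.
- by rewrite cmpA -(cmpA pA) gf cmpm1.
- by rewrite cmpA -(cmpA pB) gf cmpm1.
- by rewrite cmpA -(cmpA pA) gf cmpm1.
- by rewrite cmpA -(cmpA pB) gf cmpm1.
- by rewrite !cmpA -cmpDl -!(cmpA f) -cmpDr e5 cmpm1.
Qed.

Lemma is_biproduct_isom2 A B A' B' X : isom A A' -> isom B B' ->
  is_biproduct A B X -> is_biproduct A' B' X.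
Proof.
case=> a [a' [a'a aa']] [b [b' [b'b bb']]] [iA [iB [pA [pB [e1 e2 e3 e4 e5]]]]].
exists (iA \c a'), (iB \c b'), (a \c pA), (b \c pB).
split.
- by rewrite cmpA -(cmpA a) e1 cmpm1.
- by rewrite cmpA -(cmpA b) e2 cmpm1.
- by rewrite cmpA -(cmpA a) e3 cmp0r cmp0l.
- by rewrite cmpA -(cmpA b) e4 cmp0r cmp0l.
- by rewrite cmpA -(cmpA iA) a'a cmpm1 cmpA -(cmpA iB) b'b cmpm1.
Qed.

Lemma is_biproduct_unique A B X Y : is_biproduct A B X -> is_biproduct A B Y -> isom X Y.
Proof.
case=> iA [iB [pA [pB [e1 e2 e3 e4 e5]]]] [jA [jB [qA [qB [d1 d2 d3 d4 d5]]]]].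
exists (jA \c pA + jB \c pB), (iA \c qA + iB \c qB); split.
- rewrite cmpDl !cmpDr !cmpA (cmp_eqr d1) (cmp_eqr d2) (cmp_eqr d3) (cmp_eqr d4).
  by rewrite !cmp0r !cmp0l addr0 add0r !cmpm1.
- rewrite cmpDl !cmpDr !cmpA (cmp_eqr e1) (cmp_eqr e2) (cmp_eqr e3) (cmp_eqr e4).
  by rewrite !cmp0r !cmp0l addr0 add0r !cmpm1.
Qed.

Lemma is_biproduct_zero A B X : is_zero A -> is_biproduct A B X -> isom B X.
Proof.
case=> zA _ [iA [iB [pA [pB [e1 e2 e3 e4 e5]]]]]; exists iB, pB; split=> //.
by rewrite -e5 (zA _ iA 0) cmp0l add0r.
Qed.

Lemma zero_is_biproduct Z X : is_zero Z -> is_biproduct X Z X.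
Proof.
move=> zZ; exists (idm X), 0, (idm X), 0; rewrite !cmp1m !cmp0l addr0; split=> //.
by rewrite (iffLR (is_zeroP Z)).
Qed.

Lemma is_biproduct_assoc A B C Y Z X : is_biproduct A B Y -> is_biproduct Y C X ->
  is_biproduct B C Z -> is_biproduct A Z X.
Proof.
case=> iA [iB [pA [pB [e1 e2 e3 e4 e5]]]] [iY [iC [pY [pC [d1 d2 d3 d4 d5]]]]].
case=> jB [jC [qB [qC [c1 c2 c3 c4 c5]]]].
exists (iY \c iA), (iY \c iB \c qB + iC \c qC).
exists (pA \c pY), (jB \c pB \c pY + jC \c pC).
split.
- by rewrite cmpA (cmp_eqr d1) cmpm1.
- rewrite cmpDl !cmpDr !cmpA !(cmp_eqr d1) !(cmp_eqr d2).
  rewrite !(cmp_eqr d3) !(cmp_eqr d4) !cmpm1 !cmp0r !cmp0l addr0 add0r.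
  by rewrite (cmp_eqr e2) cmpm1.
- rewrite cmpDr !cmpA !(cmp_eqr d1) !(cmp_eqr d3) !cmpm1 e3.
  by rewrite !cmp0r !cmp0l addr0.
- rewrite cmpDl !cmpA !(cmp_eqr d1) !(cmp_eqr d4) !cmpm1.
  by rewrite (cmp_eqr e4) !cmp0r !cmp0l addr0.
- rewrite cmpDl !cmpDr !cmpA !(cmp_eqr c1) !(cmp_eqr c2).
  rewrite !(cmp_eqr c3) !(cmp_eqr c4) !cmpm1 !cmp0r !cmp0l addr0 add0r.
  rewrite addrA -cmpDl -!(cmpA iY) -cmpDr e5 cmpm1.
  exact: d5.
Qed.

Lemma direct_sum_isom S X Y : direct_sum S X -> isom X Y -> direct_sum S Y.
Proof.
case=> [{}X zX | A B {}X SA SB bX] isoXY; last exact: DirectSumS SA SB (is_biproduct_isom bX isoXY).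
exact/DirectSum0/(retract_zero (isom_retract (isom_sym isoXY))).
Qed.

Lemma direct_sum_biproduct S A B X : additive_cat D ->
  direct_sum S A -> direct_sum S B -> is_biproduct A B X -> direct_sum S X.
Proof.
move=> addD SA SB; elim: SA X => [{}A zA X bX | A1 A2 {}A SA1 _ IH bA X bX].
  exact: direct_sum_isom SB (is_biproduct_zero zA bX).
have [Y bY] := addD.2 A2 B.
exact: DirectSumS SA1 (IH _ bY) (is_biproduct_assoc bA bX bY).
Qed.

Lemma direct_sum_mem S X : additive_cat D -> S X -> direct_sum S X.
Proof.
case=> -[Z zZ] _ SX; exact: DirectSumS SX (DirectSum0 S zZ) (zero_is_biproduct X zZ).
Qed.

Lemma direct_sum_add_closure S X : additive_cat D -> direct_sum S X -> add_closure S X.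
Proof.
by case=> -[Z zZ] _ SX; exists X => //; exists Z; exact: zero_is_biproduct.
Qed.

Lemma add_closure_mem S X : additive_cat D -> S X -> add_closure S X.
Proof. by move=> addD /direct_sum_mem-/(_ addD); exact: direct_sum_add_closure. Qed.

Lemma add_closure_retract S A X : fully_additive D ->
  retract A X -> add_closure S X -> add_closure S A.
Proof.
move=> [_ splitD] rAX [Y SY sXY]; exists Y => //; apply: retract_summand => //.
exact: retract_trans rAX (summand_retract sXY).
Qed.

Lemma add_closure_biproduct S A B X : fully_additive D ->
  add_closure S A -> add_closure S B -> is_biproduct A B X -> add_closure S X.
Proof.
move=> [addD splitD] [A' SA' /summand_retract[a [a' a'a]]].
move=> [B' SB' /summand_retract[b [b' b'b]]] bX.
have [Y bY] := addD.2 A' B'; exists Y; first exact: direct_sum_biproduct bY.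
apply: retract_summand => //.
case: bX bY => iA [iB [pA [pB [e1 e2 e3 e4 e5]]]] [jA [jB [qA [qB [d1 d2 d3 d4 d5]]]]].
exists (jA \c a \c pA + jB \c b \c pB), (iA \c a' \c qA + iB \c b' \c qB).
rewrite cmpDl !cmpDr !cmpA !(cmp_eqr d1) !(cmp_eqr d2).
rewrite !(cmp_eqr d3) !(cmp_eqr d4) !cmpm1 !cmp0r !cmp0l addr0 add0r.
by rewrite (cmp_eqr a'a) (cmp_eqr b'b) !cmpm1.
Qed.

Lemma fullsub_additive S : fully_additive D -> fully_additive (fullsub (@add_closure k D S)).
Proof.
move=> fD; have [addD splitD] := fD; split; first split.
- have [[Z zZ] _] := addD.
  exists (exist _ Z (direct_sum_add_closure addD (DirectSum0 S zZ))).
  by case: zZ => z1 z2; split=> Y f g; [exact: z1 | exact: z2].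
- move=> [A SA] [B SB]; have [X bX] := addD.2 A B.
  by exists (exist _ X (add_closure_biproduct fD SA SB bX)).
- move=> [X SX] e ee; have [Y [i [p [pi ip]]]] := splitD X e ee.
  have rYX : retract Y X by exists i, p.
  by exists (exist _ Y (add_closure_retract fD rYX SX)), i, p.
Qed.

(** An independent family of endomorphisms of A, extended by zero to X, stays
    independent when the projection onto B is added to it. *)
Lemma biproduct_endo_dim A B X n : is_biproduct A B X -> ~ is_zero B ->
  (forall v : 'I_n.+2 -> mor X X, dependent v) ->
  forall v : 'I_n.+1 -> mor A A, dependent v.
Proof.
case=> iA [iB [pA [pB [e1 e2 e3 e4 e5]]]] nzB depX v.
pose w (l : 'I_n.+2) := if unlift ord0 l is Some j then iA \c v j \c pA else iB \c pB.
have [c [l cl]] := depX w; rewrite big_ord_recl => sum0.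
have w0 : w ord0 = iB \c pB by rewrite /w unlift_none.
have wl j : w (lift ord0 j) = iA \c v j \c pA by rewrite /w liftK.
have c0 : c ord0 = 0.
  have := congr1 (fun f => pB \c f \c iB) sum0.
  rewrite cmp0r cmp0l cmpDr cmpDl cmpZr cmpZl w0 (cmpA pB) e2 cmp1m e2.
  rewrite cmp_sumr cmp_suml big1 ?addr0 => [/eqP|j _].
    rewrite scaler_eq0 => /orP[/eqP // | /eqP idB0].
    by case: nzB; apply/is_zeroP.
  by rewrite cmpZr cmpZl wl !cmpA e4 !cmp0l scaler0.
have := congr1 (fun f => pA \c f \c iA) sum0.
rewrite c0 scale0r add0r cmp0r cmp0l cmp_sumr cmp_suml => sumA.
exists (fun j => c (lift ord0 j)).
  case: (unliftP ord0 l) cl => [j -> cj | ->]; first by exists j.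
  by rewrite c0 eqxx.
apply: etrans sumA; apply: eq_bigr => j _.
by rewrite cmpZr cmpZl wl !cmpA e1 cmp1m -cmpA e1 cmpm1.
Qed.

Lemma indecomposable_decomposition X : additive_cat D -> endo_finite X ->
  direct_sum (@indecomposable k D) X.
Proof.
move=> addD [n]; elim: n X => [|n IH] X depX.
  have [c [l cl]] := depX (fun=> idm X); rewrite big_ord1 => /eqP.
  rewrite scaler_eq0 => /orP[/eqP c0|/eqP]; last by move/is_zeroP; exact: DirectSum0.
  by rewrite ord1 c0 eqxx in cl.
have [/DirectSum0 // | nzX] := EM (is_zero X).
have [indX | ] := EM (indecomposable X); first exact: direct_sum_mem.
move=> /not_andP[/(_ nzX) // | /existsNP[A /existsNP[B /not_implyP[bX /not_orP[nzA nzB]]]]].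
have dA := IH _ (biproduct_endo_dim bX nzB depX).
have dB := IH _ (biproduct_endo_dim (is_biproduct_sym bX) nzA depX).
exact: direct_sum_biproduct bX.
Qed.

End DirectSums.

Section Factoring.
Variables (k : fieldType) (D : lincat k) (R M : D) (r : mor R M).

(** The vanishing of f as an element at W of the cokernel of r. *)
Definition through (W : D) (f : mor W M) : Prop := exists h, f = r \c h.

Lemma through_self W (h : mor W R) : through (r \c h).
Proof. by exists h. Qed.
Lemma through_cmp W W' (f : mor W M) (g : mor W' W) : through f -> through (f \c g).
Proof. by case=> h ->; exists (h \c g); rewrite cmpA. Qed.
Lemma through0 W : through (0 : mor W M).
Proof. by exists 0; rewrite cmp0r. Qed.
Lemma through_lin W a (f g : mor W M) : through f -> through g -> through (a *: f + g).
Proof. by case=> h -> [l ->]; exists (a *: h + l); rewrite cmp_linr. Qed.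
Definition through_subspace W : subspace (mor W M) :=
  Subspace (through0 W) (@through_lin W).
Lemma throughD W (f g : mor W M) : through f -> through g -> through (f + g).
Proof. exact: (@subspaceD _ _ (through_subspace W)). Qed.
Lemma throughB W (f g : mor W M) : through f -> through g -> through (f - g).
Proof. exact: (@subspaceB _ _ (through_subspace W)). Qed.
Lemma throughBC W (f g : mor W M) : through (f - g) -> through (g - f).
Proof. by move=> fg; rewrite -opprB -[- _]add0r; apply: throughB => //; exact: through0. Qed.
Lemma through_congr W (f g : mor W M) : through (f - g) -> through f <-> through g.
Proof.
move=> fg; split=> [tf | tg]; last by rewrite -[f](subrK g); exact: throughD.
by rewrite -[g](subKr f); exact: throughB.
Qed.
Lemma through_eq_trans W (f g h : mor W M) :
  through (f - g) -> through (g - h) -> through (f - h).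
Proof. by move=> fg gh; rewrite -[f - h](subrKA g); exact: throughD. Qed.
End Factoring.

Lemma through_trans (k : fieldType) (D : lincat k) (M R R' W : D)
    (r : mor R M) (r' : mor R' M) (f : mor W M) :
  through r' r -> through r f -> through r' f.
Proof. by case=> h -> [l ->]; exists (h \c l); rewrite cmpA. Qed.

Section Approximation.
Variables (k : fieldType) (D : lincat k).
Hypotheses (fD : fully_additive D) (finD : finitely_many_indecomposables D).
Hypothesis homD : forall X Y : D, finite_dim (mor X Y).

Lemma finite_dim_endo (X : D) : endo_finite X.
Proof. exact/finite_dim_dependent/homD. Qed.

Variables (M : D) (V : forall W : D, subspace (mor W M)).
Hypothesis V_cmp : forall (W W' : D) (f : mor W M) (g : mor W' W), V W f -> V W' (f \c g).

Lemma finite_join n (P : 'I_n -> forall R, mor R M -> Prop) :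
  (forall i R (r : mor R M) R' (r' : mor R' M), through r' r -> P i R r -> P i R' r') ->
  (forall i, exists R (r : mor R M), V R r /\ P i R r) ->
  exists R (r : mor R M), V R r /\ forall i, P i R r.
Proof.
move=> Pmono Pex.
suff join m : exists R (r : mor R M), V R r /\ forall i : 'I_n, (i < m)%N -> P i R r.
  by have [R [r [Vr Pr]]] := join n; exists R, r; split=> // i; exact: Pr.
elim: m => [|m [R [r [Vr Pr]]]].
  by have [[[Z _] _] _] := fD; exists Z, 0; split=> //; exact: subspace0.
have [lt_mn | le_nm] := ltnP m n; last first.
  by exists R, r; split=> // i lt_im; apply: Pr; exact: leq_trans (ltn_ord i) le_nm.
have [R' [r' [Vr' Pr']]] := Pex (Ordinal lt_mn).
have [[_ bip] _] := fD; have [X [iA [iB [pA [pB [e1 e2 e3 e4 e5]]]]]] := bip R R'.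
exists X, (r \c pA + r' \c pB); split; first by apply: subspaceD; exact: V_cmp.
have thr : through (r \c pA + r' \c pB) r.
  by exists iA; rewrite cmpDl -!cmpA e1 e4 cmpm1 cmp0r addr0.
have thr' : through (r \c pA + r' \c pB) r'.
  by exists iB; rewrite cmpDl -!cmpA e2 e3 cmpm1 cmp0r add0r.
move=> i; rewrite ltnS leq_eqVlt => /orP[/eqP im | lt_im].
  have -> : i = Ordinal lt_mn by exact: val_inj.
  exact: Pmono Pr'.
exact: Pmono (Pr _ lt_im).
Qed.

(** R is a sum of indecomposable objects, one for every generator of the values of V at
    the finitely many isomorphism classes of these. *)
Lemma subfunctor_generated :
  exists R (r : mor R M), V R r /\ forall W (f : mor W M), V W f -> through r f.
Proof.
have [n [e eP]] := finD.
have [R [r [Vr genr]]] : exists R (r : mor R M), V R r /\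
    forall i, forall f : mor (e i) M, V (e i) f -> through r f.
  apply: finite_join => [i R r R' r' thr gr f /gr | i]; first exact: through_trans thr.
  have [m [f [Vf genf]]] := subspace_finitely_generated (V (e i)) (homD (e i) M).
  have [R [r [Vr thr]]] : exists R (r : mor R M), V R r /\ forall j, through r (f j).
    apply: finite_join => [j R r R' r' | j]; first exact: through_trans.
    by exists (e i), (f j); split=> //; exists (idm _); rewrite cmpm1.
  exists R, r; split=> // g /genf[c ->].
  have [h fh] := choice thr; exists (\sum_(j < m) c j *: h j).
  by rewrite cmp_sumr; apply: eq_bigr => j _; rewrite cmpZr -fh.
exists R, r; split=> // W f.
have [addD splitD] := fD.
elim: (indecomposable_decomposition addD (finite_dim_endo W)) f
  => [X [zX _] f _ | A B X indA _ IH [iA [iB [pA [pB [e1 e2 e3 e4 e5]]]]] f Vf].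
  by exists 0; rewrite cmp0r; exact: zX.
have [i [u [v [vu uv]]]] := eP _ indA.
have [g gE] : through r (f \c iA \c v) by apply: genr; do 2 apply: V_cmp.
have [h hE] := IH _ (V_cmp iB Vf).
exists (g \c u \c pA + h \c pB); rewrite cmpDr !cmpA -gE -hE.
by rewrite -(cmpA _ v u) vu cmpm1 -!cmpA -cmpDr e5 cmpm1.
Qed.

End Approximation.

(** * The abelianization in terms of its arrows *)

Section Abelianized.
Variables (k : fieldType) (D : lincat k).
Implicit Types A B T : abcat D.

(** A morphism of the abelianization is determined by its component between the
    targets: it vanishes exactly when that component factors through the arrow of
    its codomain. *)
Definition abm A B (b : mor (asrc A) (asrc B)) (c : mor (atgt A) (atgt B))
  (H : c \c amor A = amor B \c b) : mor A B := ab_mk H.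

Lemma abm_ind A B (P : mor A B -> Prop) :
  (forall b c (H : c \c amor A = amor B \c b), P (abm H)) -> forall f, P f.
Proof. exact: ab_hom_ind. Qed.

Lemma abm_cmp A B T b c (H : c \c amor B = amor T \c b)
  b' c' (H' : c' \c amor A = amor B \c b') :
  abm H \c abm H' = abm (ab_cmp_subproof H H').
Proof. exact: ab_cmpE. Qed.

Lemma abm_eq A B b c (H : c \c amor A = amor B \c b)
  b' c' (H' : c' \c amor A = amor B \c b') :
  abm H = abm H' <-> through (amor B) (c - c').
Proof. exact: ab_mk_eq. Qed.

Lemma abm_id A : idm A = abm (ab_id_subproof A).
Proof. by []. Qed.

Lemma abm0_subproof A B : (0 : mor (atgt A) (atgt B)) \c amor A = amor B \c 0.
Proof. by rewrite cmp0l cmp0r. Qed.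

Lemma abm0 A B : 0 = abm (abm0_subproof A B).
Proof.
have := ab_mk_lin (-1) (abm0_subproof A B) (abm0_subproof A B).
rewrite scaleN1r addNr => e0; apply: etrans e0 _.
by apply: ab_mk_eq_pair; rewrite scaler0 addr0.
Qed.

Lemma abm_eq0 A B b c (H : c \c amor A = amor B \c b) : abm H = 0 <-> through (amor B) c.
Proof. by rewrite abm0 abm_eq subr0. Qed.

Lemma abm_add A B b c (H : c \c amor A = amor B \c b)
  b' c' (H' : c' \c amor A = amor B \c b') d f (H2 : f \c amor A = amor B \c d) :
  f = c + c' -> abm H + abm H' = abm H2.
Proof.
move=> fE; have := ab_mk_lin 1 H H'; rewrite scale1r => ->.
by apply: ab_mk_eq_pair; rewrite scale1r.
Qed.

Lemma ab_is_zeroP A : is_zero A <-> through (amor A) (idm (atgt A)).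
Proof. by rewrite is_zeroP abm_id abm_eq0. Qed.

End Abelianized.

Lemma abm_fmor (k : fieldType) (D E : lincat k) (F : functor D E) (A B : abcat D)
    b c (H : c \c amor A = amor B \c b) :
  fmor (abfun F) (abm H) = @abm k E (abfun F A) (abfun F B) _ _ (ab_fmor_subproof F H).
Proof. exact: ab_fmorE. Qed.

Section Cokernels.
Variables (k : fieldType) (D : lincat k).
Implicit Types A B T : abcat D.

(** The cokernel of A -> B is the arrow to the target of B from the direct sum of
    the source of B and the target of A. *)
Lemma ab_cokernel A B b c (H : c \c amor A = amor B \c b) : additive_cat D ->
  exists (X : D) (r : mor X (atgt B)) (u : mor B (Arrow r : abcat D)),
    [/\ exists pB pA, r = amor B \c pB + c \c pA,
        u \c abm H = 0, is_epi u,
        forall W (g : mor B W), g \c abm H = 0 -> exists h, g = h \c u &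
        forall (E : lincat k) (F : functor D E), fmor (abfun F) u = 0 ->
          through (fmor F r) (idm (F (atgt B)))].
Proof.
case=> _ bip; have [X [iB [iA [pB [pA [e1 e2 e3 e4 e5]]]]]] := bip (asrc B) (atgt A).
pose r := amor B \c pB + c \c pA; pose T : abcat D := Arrow r.
have Hu : idm (atgt B) \c amor B = amor T \c iB.
  by rewrite cmp1m /= cmpDl -!cmpA e1 e4 cmpm1 cmp0r addr0.
exists X, r, (@abm k D B T _ _ Hu); split.
- by exists pB, pA.
- rewrite abm_cmp abm_eq0; exists iA.
  by rewrite cmp1m /= cmpDl -!cmpA e2 e3 cmpm1 cmp0r add0r.
- move=> W g h; elim/abm_ind: g => bg cg Hg; elim/abm_ind: h => bh ch Hh.
  by rewrite !abm_cmp !abm_eq !cmpm1.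
- move=> W g; elim/abm_ind: g => bg cg Hg; rewrite abm_cmp abm_eq0 => -[xi xiE].
  have Hh : cg \c amor T = amor W \c (bg \c pB + xi \c pA).
    by rewrite /= cmpDr cmpDr !cmpA Hg xiE.
  exists (@abm k D T W _ _ Hh); rewrite abm_cmp abm_eq; exists 0.
  by rewrite cmpm1 subrr cmp0r.
- move=> E F; rewrite (@abm_fmor k D E F B T _ _ Hu) => /abm_eq0.
  by rewrite /= fmor1.
Qed.

Lemma ab_epi_target A B b c (H : c \c amor A = amor B \c b) : additive_cat D ->
  is_epi (abm H) -> exists u v, idm (atgt B) = amor B \c u + c \c v.
Proof.
move=> addD epiH; have [X [r [u [[pB [pA rE]] uH _ _ uF]]]] := ab_cokernel H addD.
have u0 : u = 0 by apply: epiH; rewrite uH cmp0l.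
have [|h hE] := uF D (idfun_cat D); first by rewrite u0 (lin0 (fmor_lin _)).
by exists (pB \c h), (pA \c h); rewrite hE /= rE cmpDl !cmpA.
Qed.

Lemma ab_cokernel_target A B T b c (H : c \c amor A = amor B \c b) (u : mor B T) :
  additive_cat D -> is_cokernel (abm H) u ->
  exists (X : D) (r : mor X (atgt B)),
    (exists pB pA, r = amor B \c pB + c \c pA) /\
    forall (E : lincat k) (F : functor D E), is_zero (abfun F T) ->
      through (fmor F r) (idm (F (atgt B))).
Proof.
move=> addD [_ univ]; have [X [r [u' [rE u'H _ _ u'F]]]] := ab_cokernel H addD.
exists X, r; split=> // E F [_ zT]; apply: u'F.
have [g [<- _]] := univ _ _ u'H.
by rewrite fmorM (zT _ (fmor (abfun F) u) 0) cmp0r.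
Qed.

Lemma ab_point_subproof A (M : D) (y : mor M (atgt A)) :
  y \c (amor (Arrow (0 : mor M M)) : mor M M) = amor A \c 0.
Proof. by rewrite !cmp0r. Qed.

Lemma ab_mono_target A B b c (H : c \c amor A = amor B \c b) (M : D) (y : mor M (atgt A)) :
  is_mono (abm H) -> through (amor B) (c \c y) -> through (amor A) y.
Proof.
move=> monoH cy; pose P : abcat D := Arrow (0 : mor M M).
have := monoH P (@abm k D P A _ _ (ab_point_subproof y)) 0.
rewrite cmp0r abm_cmp !abm_eq0; exact.
Qed.

Lemma ab_fully_additive : additive_cat D -> fully_additive (abcat D).
Proof.
move=> addD; have [[Z zZ] bip] := addD; split; first split.
- exists (Arrow (0 : mor Z Z) : abcat D); apply/ab_is_zeroP => /=.
  by rewrite (iffLR (is_zeroP Z)) //; exact: through0.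
- move=> A B; have [X [iA [iB [pA [pB [e1 e2 e3 e4 e5]]]]]] := bip (asrc A) (asrc B).
  have [Y [jA [jB [qA [qB [d1 d2 d3 d4 d5]]]]]] := bip (atgt A) (atgt B).
  pose T : abcat D := Arrow (jA \c amor A \c pA + jB \c amor B \c pB).
  have HiA : jA \c amor A = amor T \c iA.
    by rewrite /= cmpDl -!cmpA e1 e4 !cmp0r cmpm1 addr0.
  have HiB : jB \c amor B = amor T \c iB.
    by rewrite /= cmpDl -!cmpA e2 e3 !cmp0r cmpm1 add0r.
  have HpA : qA \c amor T = amor A \c pA.
    by rewrite /= cmpDr !cmpA d1 d3 !cmp0l cmp1m addr0.
  have HpB : qB \c amor T = amor B \c pB.
    by rewrite /= cmpDr !cmpA d2 d4 !cmp0l cmp1m add0r.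
  exists T, (@abm k D A T _ _ HiA), (@abm k D B T _ _ HiB), (@abm k D T A _ _ HpA), (@abm k D T B _ _ HpB).
  rewrite !abm_cmp !abm_id; split.
  + by apply/abm_eq; rewrite d1 subrr; exact: through0.
  + by apply/abm_eq; rewrite d2 subrr; exact: through0.
  + by apply/abm_eq0; rewrite d3; exact: through0.
  + by apply/abm_eq0; rewrite d4; exact: through0.
  + by apply: abm_add; rewrite d5.
(* e splits through the cokernel of 1 - e. *)
- move=> A e ee.
  have ee0 : e \c (idm A - e) = 0 by rewrite cmpBr cmpm1 ee subrr.
  have [b [c [H dE]]] : exists b c (H : c \c amor A = amor A \c b), idm A - e = abm H.
    by elim/abm_ind: (idm A - e) => b c H; exists b, c, H.
  have [X [r [u [_ uf epiu univ _]]]] := ab_cokernel H addD.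
  move: ee0; rewrite dE => /univ[i eE]; exists (Arrow r), i, u; split=> //.
  apply: epiu; rewrite cmp1m -cmpA -eE.
  by apply/esym/eqP; rewrite -subr_eq0 -[X in X - _]cmpm1 -cmpBr dE uf.
Qed.

Definition killed_subspace (S : abcat D) (M : D) (y : mor M (atgt S)) (W : D) :
  subspace (mor W M).
Proof.
refine (@Subspace k (mor W M) (fun m => through (amor S) (y \c m)) _ _).
- by rewrite cmp0r; exact: through0.
- by move=> a f g yf yg; rewrite cmp_linr; exact: through_lin.
Defined.

(** The image of y is the cokernel of an approximation of the elements that y kills. It
    is a subobject of S, hence zero or S. *)
Lemma simple_generator (S : abcat D) (M : D) (y : mor M (atgt S)) :
    fully_additive D -> finitely_many_indecomposables D ->
    (forall X Y : D, finite_dim (mor X Y)) ->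
  simple_object S -> ~ through (amor S) y ->
  exists h : mor (atgt S) M, through (amor S) (y \c h - idm (atgt S)).
Proof.
move=> fD finD homD [_ simS] y0.
pose V := killed_subspace y.
have [R [r [[b bE] genr]]] : exists R (r : mor R M), V R r /\
    forall W (f : mor W M), V W f -> through r f.
  apply: subfunctor_generated => // W W' f g; rewrite /V /= cmpA; exact: through_cmp.
pose A : abcat D := Arrow r.
have H : y \c amor A = amor S \c b by [].
have monoH : is_mono (@abm k D A S _ _ H).
  move=> W g h; elim/abm_ind: g => bg cg Hg; elim/abm_ind: h => bh ch Hh.
  by rewrite !abm_cmp !abm_eq -cmpBr => /genr.
case: (simS A _ monoH) => [/ab_is_zeroP /= [h hE] | [g [_]]].
  case: y0; rewrite -[y]cmpm1 hE cmpA [y \c r]bE -cmpA; exact: through_self.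
elim/abm_ind: g => bg cg Hg; rewrite abm_cmp abm_id abm_eq => yc.
by exists cg.
Qed.

End Cokernels.

(** * Adjoint 1-morphisms *)

(** Equality of the bundled arrows compares morphisms whose end points are only
    propositionally equal: the coherence morphisms [eqhom] can be inserted and
    removed, and composites are compared factor by factor. *)
Section ArrowEquality.
Variables (k : fieldType) (D : lincat k).
Implicit Types X Y Z : D.

Lemma arrow_ends X Y X' Y' (f : mor X Y) (f' : mor X' Y') : Arrow f = Arrow f' ->
  exists (e : X = X') (e' : Y = Y'), eqhom e' \c f = f' \c eqhom e.
Proof.
move=> E; exists (congr1 (@asrc k D) E), (congr1 (@atgt k D) E).
exact: (@ab_eqhom_subproof k D (Arrow f) (Arrow f')).
Qed.

Lemma arrow_inj X Y (f g : mor X Y) : Arrow f = Arrow g -> f = g.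
Proof. by case/arrow_ends=> e [e']; rewrite !eqhom_refl cmp1m cmpm1. Qed.

Lemma arrow_cmp X Y Z X' Y' Z' (f : mor X Y) (f' : mor X' Y') (g : mor Y Z) (g' : mor Y' Z') :
  Arrow g = Arrow g' -> Arrow f = Arrow f' -> Arrow (g \c f) = Arrow (g' \c f').
Proof.
move=> /arrow_ends[eY [eZ]] Eg /arrow_ends[eX [eY']].
rewrite (eqhom_irr eY' eY) => Ef; apply: (arrow_eq (e := eX) (e' := eZ)).
by rewrite cmpA Eg -cmpA Ef cmpA.
Qed.

Lemma arrow_eqhoml X Y Z (f : mor X Y) (e : Y = Z) : Arrow (eqhom e \c f) = Arrow f.
Proof. by case: _ / e; rewrite /= cmp1m. Qed.

Lemma arrow_eqhomr X Y Z (f : mor Y Z) (e : X = Y) : Arrow (f \c eqhom e) = Arrow f.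
Proof. by case: _ / e f => f; rewrite /= cmpm1. Qed.

Lemma arrow_eqhom X Y X' Y' (e : X = Y) (e' : X' = Y') :
  X = X' -> Arrow (eqhom e) = Arrow (eqhom e').
Proof. by move=> E; case: _ / E e'; case: _ / e => e'; rewrite -[eqhom e']cmpm1 arrow_eqhoml. Qed.

End ArrowEquality.

Section Whiskering.
Variables (k : fieldType) (C : twocat k).
Implicit Types i j l m : C.

Lemma arrow_hcA i j l m (H H' : C l m) (G G' : C j l) (F F' : C i j)
    (c : mor H H') (b : mor G G') (a : mor F F') :
  Arrow (c \h (b \h a)) = Arrow ((c \h b) \h a).
Proof. exact: arrow_eq (hcA c b a). Qed.

Lemma arrow_hc1l i j (F F' : C i j) (a : mor F F') : Arrow (idm (t1 j) \h a) = Arrow a.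
Proof. exact: arrow_eq (hc1l a). Qed.

Lemma arrow_hc1r i j (F F' : C i j) (a : mor F F') : Arrow (a \h idm (t1 i)) = Arrow a.
Proof. exact: arrow_eq (hc1r a). Qed.

Lemma arrow_whisker_lr i j l m (H : C l m) (G G' : C j l) (F : C i j) (b : mor G G') :
  Arrow (lwhisker H (rwhisker b F)) = Arrow (rwhisker (lwhisker H b) F).
Proof. exact: arrow_hcA. Qed.

Lemma arrow_whisker_rr i j l m (H H' : C l m) (G : C j l) (F : C i j) (c : mor H H') :
  Arrow (rwhisker (rwhisker c G) F) = Arrow (rwhisker c (G ** F)).
Proof. by rewrite /rwhisker -hc_id; apply: esym; exact: arrow_hcA. Qed.

Lemma arrow_whisker_ll i j l m (H : C l m) (G : C j l) (F F' : C i j) (a : mor F F') :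
  Arrow (lwhisker H (lwhisker G a)) = Arrow (lwhisker (H ** G) a).
Proof. by rewrite /lwhisker -hc_id; exact: arrow_hcA. Qed.

Lemma lwhisker_id i j l (G : C j l) (F : C i j) : lwhisker G (idm F) = idm (G ** F).
Proof. exact: hc_id. Qed.
Lemma rwhisker_id i j l (G : C j l) (F : C i j) : rwhisker (idm G) F = idm (G ** F).
Proof. exact: hc_id. Qed.
Lemma lwhisker_cmp i j l (G : C j l) (F F' F'' : C i j) (b : mor F' F'') (a : mor F F') :
  lwhisker G (b \c a) = lwhisker G b \c lwhisker G a.
Proof. by rewrite /lwhisker -hc_cmp cmp1m. Qed.
Lemma rwhisker_cmp i j l (G G' G'' : C j l) (F : C i j) (b : mor G' G'') (a : mor G G') :
  rwhisker (b \c a) F = rwhisker b F \c rwhisker a F.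
Proof. by rewrite /rwhisker -hc_cmp cmp1m. Qed.
Lemma lwhisker_lin i j l (G : C j l) (F F' : C i j) : linear (@lwhisker k C i j l G F F').
Proof. exact: hc_linr. Qed.
Lemma rwhisker_lin i j l (G G' : C j l) (F : C i j) :
  linear (fun a : mor G G' => rwhisker a F).
Proof. exact: hc_linl. Qed.
Lemma lwhiskerD i j l (G : C j l) (F F' : C i j) (a b : mor F F') :
  lwhisker G (a + b) = lwhisker G a + lwhisker G b.
Proof. exact: (linD (@lwhisker_lin _ _ _ G F F')). Qed.
Lemma lwhiskerB i j l (G : C j l) (F F' : C i j) (a b : mor F F') :
  lwhisker G (a - b) = lwhisker G a - lwhisker G b.
Proof. exact: (linB (@lwhisker_lin _ _ _ G F F')). Qed.
Lemma whisker_exchange i j l (G G' : C j l) (F F' : C i j) (b : mor G G') (a : mor F F') :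
  rwhisker b F' \c lwhisker G a = lwhisker G' a \c rwhisker b F.
Proof. by rewrite /lwhisker /rwhisker -!hc_cmp !cmp1m !cmpm1. Qed.
Lemma lwhisker_eqhom i j l (G : C j l) (F F' : C i j) (e : F = F') :
  lwhisker G (eqhom e) = eqhom (congr1 (c1 G) e).
Proof. by case: _ / e; exact: lwhisker_id. Qed.
Lemma rwhisker_eqhom i j l (G G' : C j l) (F : C i j) (e : G = G') :
  rwhisker (eqhom e) F = eqhom (congr1 (fun H => H ** F) e).
Proof. by case: _ / e; exact: rwhisker_id. Qed.

(** X' is left adjoint to X. This is stated for the functors of composition with X' and
    with X, which confines the coherence morphisms to the construction of the unit and
    the counit. *)
Record adjoint_pair j l (X' : C l j) (X : C j l) := AdjointPair {
  unit2 : forall i (M : C i l), mor M (X ** (X' ** M));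
  counit2 : forall i (A : C i j), mor (X' ** (X ** A)) A;
  unit2_natural : forall i (M M' : C i l) (m : mor M M'),
    unit2 M' \c m = lwhisker X (lwhisker X' m) \c unit2 M;
  counit2_natural : forall i (A A' : C i j) (a : mor A A'),
    counit2 A' \c lwhisker X' (lwhisker X a) = a \c counit2 A;
  unit2K : forall i (A : C i j), lwhisker X (counit2 A) \c unit2 (X ** A) = idm (X ** A);
  counit2K : forall i (M : C i l), counit2 (X' ** M) \c lwhisker X' (unit2 M) = idm (X' ** M) }.

(** The triangle identities of the functors are those of the 1-morphisms, whiskered
    with A and with M, up to coherence morphisms. *)
Lemma adjunction_adjoint_pair i j (F : C i j) (F' : C j i) alpha beta :
  @adjunction k C i j F F' alpha beta -> adjoint_pair F F'.
Proof.
case=> tri1 tri2.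
apply: (@AdjointPair _ _ F F'
  (fun h M => eqhom (esym (c1A F' F M)) \c rwhisker beta M \c eqhom (esym (c11l M)))
  (fun h A => eqhom (c11l A) \c rwhisker alpha A \c eqhom (c1A F F' A))).
- move=> h M M' m; apply: arrow_inj.
  have -> : Arrow ((eqhom (esym (c1A F' F M')) \c rwhisker beta M' \c
      eqhom (esym (c11l M'))) \c m) = Arrow (rwhisker beta M' \c lwhisker (t1 _) m).
    apply: arrow_cmp; first by rewrite arrow_eqhomr arrow_eqhoml.
    by rewrite /lwhisker arrow_hc1l.
  rewrite whisker_exchange; apply: arrow_cmp.
    exact/esym/arrow_whisker_ll.
  by rewrite arrow_eqhomr arrow_eqhoml.
- move=> h A A' a; apply: arrow_inj.
  have -> : Arrow (a \c (eqhom (c11l A) \c rwhisker alpha A \c eqhom (c1A F F' A))) =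
     Arrow (lwhisker (t1 _) a \c rwhisker alpha A).
    apply: arrow_cmp; last by rewrite arrow_eqhomr arrow_eqhoml.
    by rewrite /lwhisker arrow_hc1l.
  rewrite -whisker_exchange; apply: arrow_cmp.
    by rewrite arrow_eqhomr arrow_eqhoml.
  exact: arrow_whisker_ll.
- move=> h A; apply: arrow_inj.
  rewrite -[in RHS]rwhisker_id -[in RHS]tri2 !lwhisker_cmp !rwhisker_cmp !cmpA.
  rewrite !lwhisker_eqhom !rwhisker_eqhom !arrow_eqhomr.
  apply: arrow_cmp; last exact/esym/arrow_whisker_rr.
  rewrite -!cmpA eqhom_trans !cmpA.
  apply: arrow_cmp; last by apply: arrow_eqhom; rewrite c1A.
  by rewrite !arrow_eqhoml; exact: arrow_whisker_lr.
- move=> h M; apply: arrow_inj.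
  rewrite -[in RHS]rwhisker_id -[in RHS]tri1 !lwhisker_cmp !rwhisker_cmp !cmpA.
  rewrite !lwhisker_eqhom !rwhisker_eqhom !arrow_eqhomr.
  apply: arrow_cmp; last exact: arrow_whisker_lr.
  rewrite -!cmpA eqhom_trans !cmpA.
  apply: arrow_cmp; last by apply: arrow_eqhom; rewrite !c1A.
  by rewrite !arrow_eqhoml; exact/esym/arrow_whisker_rr.
Qed.

Lemma adjoint_pair_isom j l (X' : C l j) (X Y : C j l) (u : mor X Y) (v : mor Y X) :
  v \c u = idm X -> u \c v = idm Y -> adjoint_pair X' X -> adjoint_pair X' Y.
Proof.
move=> vu uv [eta eps eta_nat eps_nat etaK epsK].
apply: (@AdjointPair _ _ X' Y (fun h M => rwhisker u (X' ** M) \c eta h M)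
  (fun h A => eps h A \c lwhisker X' (rwhisker v A))).
- by move=> h M M' m; rewrite -cmpA eta_nat cmpA whisker_exchange cmpA.
- move=> h A A' a; rewrite -cmpA -lwhisker_cmp whisker_exchange lwhisker_cmp.
  by rewrite !cmpA eps_nat.
- move=> h A; rewrite cmpA -whisker_exchange lwhisker_cmp -!cmpA -eta_nat.
  by rewrite (cmpA (lwhisker X _)) etaK cmp1m -rwhisker_cmp uv rwhisker_id.
- move=> h M; rewrite lwhisker_cmp -cmpA (cmpA (lwhisker X' (rwhisker v _))).
  by rewrite -lwhisker_cmp -rwhisker_cmp vu rwhisker_id lwhisker_id cmp1m epsK.
Qed.

Section Mates.
Variables (j l : C) (X' : C l j) (X : C j l) (adj : adjoint_pair X' X).
Variables (i : C).

(** The transposes of y and z under the adjunction. *)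
Definition flat (M : C i l) (A : C i j) (y : mor M (X ** A)) : mor (X' ** M) A :=
  counit2 adj A \c lwhisker X' y.
Definition sharp (M : C i l) (A : C i j) (z : mor (X' ** M) A) : mor M (X ** A) :=
  lwhisker X z \c unit2 adj M.

Lemma flatK M A : cancel (@flat M A) (@sharp M A).
Proof.
by move=> y; rewrite /sharp /flat lwhisker_cmp -cmpA -unit2_natural cmpA unit2K cmp1m.
Qed.
Lemma sharpK M A : cancel (@sharp M A) (@flat M A).
Proof.
by move=> z; rewrite /sharp /flat lwhisker_cmp cmpA counit2_natural -cmpA counit2K cmpm1.
Qed.
Lemma flat_cmpl M A A' (a : mor A A') (y : mor M (X ** A)) :
  flat (lwhisker X a \c y) = a \c flat y.
Proof. by rewrite /flat lwhisker_cmp !cmpA counit2_natural. Qed.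
Lemma sharp_cmpl M A A' (a : mor A A') (z : mor (X' ** M) A) :
  sharp (a \c z) = lwhisker X a \c sharp z.
Proof. by rewrite /sharp lwhisker_cmp cmpA. Qed.
Lemma flatB M A (y y' : mor M (X ** A)) : flat (y - y') = flat y - flat y'.
Proof. by rewrite /flat lwhiskerB cmpBr. Qed.

(** The adjunction identifies the elements of X A at M with those of A at X' M, where A
    is any object of the abelianization. *)
Lemma through_flat (A A' : C i j) (a : mor A A') (M : C i l) (y : mor M (X ** A')) :
  through (lwhisker X a) y <-> through a (flat y).
Proof.
split=> [[h ->] | [h yE]]; first by exists (flat h); rewrite flat_cmpl.
by exists (sharp h); rewrite -sharp_cmpl -yE flatK.
Qed.

End Mates.

End Whiskering.

(** * 1-morphisms annihilating an object of the abelianization *)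

Section Kills.
Variables (k : fieldType) (C : twocat k).
Implicit Types h i j l : C.

Lemma through_arrow (D : lincat k) (X Y Z X' Y' Z' : D)
    (r : mor X Y) (f : mor Z Y) (r' : mor X' Y') (f' : mor Z' Y') :
  Arrow r = Arrow r' -> Arrow f = Arrow f' -> through r f -> through r' f'.
Proof.
move=> /arrow_ends[eX [eY Er]] /arrow_ends[eZ [eY' Ef]] [h fE].
exists (eqhom eX \c h \c eqhom (esym eZ)).
rewrite !cmpA -Er -(cmpA (eqhom eY)) -fE (eqhom_irr eY eY') Ef.
by rewrite -cmpA eqhom_trans eqhom_refl cmpm1.
Qed.

(** The object X A of the abelianization, where A is the cokernel of r, is zero. *)
Definition kills i j h (X : C i j) (A B : C h i) (r : mor A B) : Prop :=
  through (lwhisker X r) (idm (X ** B)).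

Lemma kills_through i j h (X : C i j) (A B : C h i) (r : mor A B) M (y : mor M (X ** B)) :
  kills X r -> through (lwhisker X r) y.
Proof. by rewrite -[y]cmp1m; exact: through_cmp. Qed.

Lemma kills_comp i j l h (Y : C j l) (X : C i j) (A B : C h i) (r : mor A B) :
  kills X r -> kills (Y ** X) r.
Proof.
case=> u uE; apply: (@through_arrow _ _ _ _ _ _ _ (lwhisker Y (lwhisker X r))
  (lwhisker Y (idm (X ** B)))).
- exact: arrow_whisker_ll.
- by rewrite lwhisker_id -c1A.
- by exists (lwhisker Y u); rewrite uE lwhisker_cmp.
Qed.

Lemma kills_retract i j h (X Y : C i j) (A B : C h i) (r : mor A B) :
  retract X Y -> kills Y r -> kills X r.
Proof.
case=> a [b ba] [u uE]; exists (rwhisker b A \c u \c rwhisker a B).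
rewrite !cmpA -whisker_exchange -[_ \c u]cmpA -uE cmpm1 -rwhisker_cmp ba.
by rewrite rwhisker_id.
Qed.

Lemma lwhisker_through i j h (X : C i j) (A B M : C h i) (r : mor A B) (y : mor M B) :
  through r y -> through (lwhisker X r) (lwhisker X y).
Proof. by case=> u ->; exists (lwhisker X u); rewrite lwhisker_cmp. Qed.

Lemma retract_lwhisker i j l (Y : C j l) (A X : C i j) : retract A X -> retract (Y ** A) (Y ** X).
Proof.
by case=> a [b ba]; exists (lwhisker Y a), (lwhisker Y b); rewrite -lwhisker_cmp ba lwhisker_id.
Qed.

End Kills.

(** * The Duflo involution and the simple object attached to it *)

(** The data defining the Duflo involution G, in terms of the arrows S and N of
    1-morphisms that present the simple top of P_G and the quotient of P_1 of which
    it is the socle. [dufloT] presents the cokernel of S -> N. *)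
Record duflo_data (k : fieldType) (C : twocat k) (L : mor1 C -> Prop) (i : C) (G : C i i)
    (S N : arrow (C i i)) := DufloData {
  dufloP : mor G (atgt S);
  dufloQ : mor (t1 i) (atgt N);
  dufloS : mor (atgt S) (atgt N);
  dufloW : C i i;
  dufloT : mor dufloW (atgt N);
  duflo_square : through (amor N) (dufloS \c amor S);
  duflo_epiP : exists u v, idm (atgt S) = amor S \c u + dufloP \c v;
  duflo_epiQ : exists u v, idm (atgt N) = amor N \c u + dufloQ \c v;
  duflo_monoS : forall (M : C i i) (y : mor M (atgt S)),
    through (amor N) (dufloS \c y) -> through (amor S) y;
  duflo_coker : exists a b, dufloT = amor N \c a + dufloS \c b;
  duflo_killT : forall (j : C) (F : C i j), L (Mor1 F) -> kills F dufloT;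
  duflo_simple : forall (M : C i i) (y : mor M (atgt S)), ~ through (amor S) y ->
    exists t : mor G M, through (amor S) (y \c t - dufloP);
  duflo_nonzero : ~ through (amor S) dufloP }.

Arguments duflo_nonzero {k C L i G S N} d _.
Arguments duflo_monoS {k C L i G S N} d {M y} _.
Arguments duflo_simple {k C L i G S N} d {M y} _.
Arguments duflo_killT {k C L i G S N} d {j F} _.

Section Duflo.
Variables (k : fieldType) (C : twocat k) (L : mor1 C -> Prop) (i : C) (G : C i i).
Variables (S N : arrow (C i i)) (duflo : duflo_data L G S N).
Hypotheses (splitC : forall j l : C, split_idempotents (C j l)).
Hypotheses (endoC : forall (j l : C) (F : C j l), endo_finite F).
Variable dual : anti_involution C.
Hypothesis dual_adj : forall (j l : C) (X : C j l), inhabited (adjoint_pair (st dual X) X).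
Hypothesis indG : indecomposable G.

Let p := dufloP duflo.
Let q := dufloQ duflo.
Let s := dufloS duflo.
Let tau := dufloT duflo.

Lemma simple_support (M : C i i) (y : mor M (atgt S)) : ~ through (amor S) y -> retract G M.
Proof.
move=> y0; have [t ytp] := duflo_simple duflo y0.
have [u [v id_S]] := duflo_epiP duflo.
(* p factors through y t, so that v y t is the identity modulo the kernel of p. *)
have pvt : through (amor S) (p \c (v \c y \c t) - p).
  apply: through_eq_trans ytp; rewrite -[y in X in _ - X]cmp1m id_S cmpDl cmpDl.
  rewrite -!cmpA opprD addrCA subrr addr0 -[- _]add0r.
  by apply: throughB; [exact: through0 | exact: through_self].
have [[w [wvt _]] | [w [wvt vtw]]] := indecomposable_local (v \c y \c t) (@splitC i i) indG (@endoC i i G).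
  by exists t, (w \c v \c y); rewrite -!cmpA [v \c _]cmpA.
case: (duflo_nonzero duflo); have := throughBC pvt.
rewrite -[X in X - _]cmpm1 -cmpBr => /(through_cmp w).
by rewrite -cmpA vtw cmpm1.
Qed.

Section Whiskered.
Variables (j : C) (X : C i j).

(** Maps M -> X S and M -> X N are compared through the adjunction: X preserves the
    monomorphism S -> N. *)
Lemma socle_mono (M : C i j) (y : mor M (X ** atgt S)) :
  through (lwhisker X (amor N)) (lwhisker X s \c y) -> through (lwhisker X (amor S)) y.
Proof.
have [adj] := dual_adj X.
move/(through_flat adj); rewrite flat_cmpl => th; apply/(through_flat adj).
exact: duflo_monoS th.
Qed.

Lemma not_kills_support : ~ kills X (amor S) -> exists M, retract G (st dual X ** M).
Proof.
have [adj] := dual_adj X.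
move=> X0; exists (X ** atgt S); apply: (@simple_support _ (flat adj (idm _))) => th.
by apply: X0; apply/(through_flat adj).
Qed.

(** The generator of X N as a quotient of P_X. *)
Definition quotient_generator : mor X (X ** atgt N) := lwhisker X q \c eqhom (esym (c11r X)).

Lemma quotient_generatorP M (y : mor M (X ** atgt N)) :
  exists h, through (lwhisker X (amor N)) (y - quotient_generator \c h).
Proof.
have [u [v id_N]] := duflo_epiQ duflo.
exists (eqhom (c11r X) \c lwhisker X v \c y).
rewrite /quotient_generator -!cmpA [eqhom _ \c (eqhom _ \c _)]cmpA eqhom_trans eqhom_refl cmp1m.
rewrite -[X0 in X0 - _]cmp1m -[X in X \c y - _]lwhisker_id id_N lwhiskerD.
rewrite !lwhisker_cmp cmpDl -!cmpA addrK; exact: through_self.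
Qed.

Hypothesis killX : kills X tau.

(** If X annihilates N / S then X S = X N, which is a quotient of P_X. *)
Lemma socle_generator :
  exists x : mor X (X ** atgt S),
    through (lwhisker X (amor N)) (lwhisker X s \c x - quotient_generator) /\
    forall M (y : mor M (X ** atgt S)), exists h, through (lwhisker X (amor S)) (y - x \c h).
Proof.
have [a [b tauE]] := duflo_coker duflo.
have [w wE] := kills_through quotient_generator killX.
exists (lwhisker X b \c w).
have gen : through (lwhisker X (amor N)) (lwhisker X s \c (lwhisker X b \c w) - quotient_generator).
  apply: throughBC; rewrite wE /tau tauE lwhiskerD !lwhisker_cmp.
  by rewrite cmpDl -!cmpA addrK; exact: through_self.
split=> // M y; have [h yh] := quotient_generatorP (lwhisker X s \c y).
exists h; apply: socle_mono; rewrite cmpBr.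
apply: through_eq_trans yh _; rewrite cmpA -cmpBl; apply: through_cmp; exact: throughBC.
Qed.

Lemma socle_support : ~ kills X (amor S) -> retract G (st dual X ** X).
Proof.
move=> X0; have [x [_ genx]] := socle_generator; have [adj] := dual_adj X.
apply: (@simple_support _ (flat adj x)) => /through_flat x0; case: X0.
have [h xh] := genx _ (idm _); apply/(through_congr xh); exact: through_cmp.
Qed.

End Whiskered.

(** If G annihilated S it would annihilate N, and N would have no elements at G' G. By
    naturality of g and the triangle identity, every g : G -> 1 factors through the
    counit G' G -> 1; so N would have no elements at G, although S is contained in N. *)
Lemma not_kills_duflo : kills G tau -> ~ kills G (amor S).
Proof.
move=> killG killS; have [adj] := dual_adj G.
have killN : kills G (amor N).
  have [a [b tauE]] := duflo_coker duflo; have [w wE] := killG.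
  have [c sc] := duflo_square duflo.
  have [d dE] := killS.
  rewrite /kills wE /tau tauE lwhiskerD !lwhisker_cmp cmpDl -!cmpA.
  apply: throughD; first exact: through_self.
  rewrite -[lwhisker G b]cmp1m dE -!cmpA (cmpA (lwhisker G _) (lwhisker G (amor S))).
  rewrite -lwhisker_cmp sc lwhisker_cmp -!cmpA.
  exact: through_self.
have killz M (z : mor (st dual G ** M) (atgt N)) : through (amor N) z.
  by rewrite -[z](sharpK adj); apply/through_flat; exact: kills_through.
have [u [v id_N]] := duflo_epiQ duflo.
pose g := v \c (s \c p).
pose eps := counit2 adj (t1 i).
have [h gE] : exists h, g = eps \c h.
  have : Arrow g = Arrow (eps \c (eqhom (c11l _) \c rwhisker g _ \c unit2 adj (G ** t1 i))).
    have -> : Arrow g = Arrow (rwhisker g (t1 i)) by rewrite -arrow_hc1r.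
    rewrite -[rwhisker g _]cmpm1 -(unit2K adj) cmpA whisker_exchange -cmpA.
    apply: arrow_cmp; first exact: arrow_hc1l.
    by rewrite -cmpA arrow_eqhoml.
  case/arrow_ends=> e [e']; rewrite eqhom_refl cmp1m -cmpA => ->.
  by eexists.
case: (duflo_nonzero duflo); apply: (duflo_monoS duflo).
have : through (amor N) (q \c g) by rewrite gE cmpA; exact: through_cmp.
move=> qg; rewrite -[_ \c _]cmp1m id_N cmpDl -!cmpA; apply: throughD => //.
exact: through_self.
Qed.

Lemma st_retract j l (A X : C j l) : retract A X -> retract (st dual A) (st dual X).
Proof.
by case=> a [b ba]; exists (st2 dual b), (st2 dual a); rewrite -st2_cmp ba st2_id.
Qed.

Lemma st_comp_retract h j l (Y : C j l) (X : C h j) :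
  retract (st dual (Y ** X)) (st dual X ** st dual Y).
Proof. by exists (stc dual Y X), (stcV dual Y X); exact: stcK. Qed.

Lemma st_st_retract j l (X : C j l) : retract (st dual (st dual X)) X.
Proof. by have [v [vu uv]] := sti_iso dual X; exists v, (sti dual X). Qed.

Hypothesis killG : kills G tau.

Lemma quotient_generator_natural (j : C) (X Y : C i j) (f : mor X Y) :
  rwhisker f (atgt N) \c quotient_generator X = quotient_generator Y \c f.
Proof.
rewrite /quotient_generator cmpA whisker_exchange -!cmpA; congr (_ \c _).
exact/esym/(eqhom_swap (hc1r f)).
Qed.

(** G is a summand of G' G, so that G' is a summand of G' G; hence G' annihilates
    N / S, and G' does not annihilate S since G is the simple top of P_G. *)
Lemma duflo_retract_dual : exists H : C i i, retract G (H ** st dual G).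
Proof.
have rG := socle_support killG (not_kills_duflo killG).
have rG' : retract (st dual G) (st dual G ** G).
  apply: retract_trans (st_retract rG) (retract_trans (st_comp_retract _ _) _).
  exact/retract_lwhisker/st_st_retract.
exists (st dual (st dual G)); apply: socle_support.
  exact: kills_retract rG' (kills_comp _ killG).
have [adj] := dual_adj (st dual G) => killS; case: (duflo_nonzero duflo).
have [v [vu uv]] := sti_iso dual G.
pose z : mor (st dual (st dual G) ** t1 i) (atgt S) := p \c v \c eqhom (c11r _).
have : through (amor S) z by rewrite -[z](sharpK adj); apply/through_flat; exact: kills_through.
move/(through_cmp (eqhom (esym (c11r _)) \c sti dual G)).
rewrite /z -!cmpA [eqhom _ \c (eqhom _ \c _)]cmpA eqhom_trans eqhom_refl cmp1m vu.
by rewrite cmpm1.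
Qed.

(** If X S is not zero then G is a summand of some X' M. Dually G' is a summand of
    M' X, and G is a summand of some H G'. *)
Lemma not_kills_le (j : C) (X : C i j) :
  ~ kills X (amor S) -> exists H : C j i, retract G (H ** X).
Proof.
case/not_kills_support=> M rG; have [H rH] := duflo_retract_dual.
exists (H ** st dual M); rewrite -c1A; apply: retract_trans rH (retract_lwhisker _ _).
apply: retract_trans (st_retract rG) (retract_trans (st_comp_retract _ _) _).
exact/retract_lwhisker/st_st_retract.
Qed.

Lemma cancel_through (j : C) (A B M : C i j) (r : mor A B) (y : mor M B) (e : mor M M) :
  through r (y \c (idm M - e)) -> is_iso (idm M - e) -> through r y.
Proof.
by move=> ye [w [_ ew]]; rewrite -[y]cmpm1 -ew cmpA; exact: through_cmp.
Qed.

Lemma kills_generated (j : C) (X : C i j) (x : mor X (X ** atgt S)) :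
  (forall M (y : mor M (X ** atgt S)), exists h, through (lwhisker X (amor S)) (y - x \c h)) ->
  through (lwhisker X (amor S)) x -> kills X (amor S).
Proof.
move=> genx x0; have [h xh] := genx _ (idm _).
by apply/(through_congr xh); exact: through_cmp.
Qed.

Section Ideals.
Variable R : rep_ideal (principal i).

(** A map g : G -> 1 that hits the socle of N gives a split epimorphism G g : G G -> G,
    because the image of G g in G N = G S is everything and P_G is local. *)
Lemma duflo_in_ideal (g : mor G (t1 i)) : R i G (t1 i) g ->
  through (amor N) (q \c g - s \c p) -> R i G G (idm G).
Proof.
move=> Rg qg; have [x [gen genx]] := socle_generator killG.
have [u [v id_S]] := duflo_epiP duflo; have [c sc] := duflo_square duflo.
(* x = G p t modulo the relations of S, so that G g t reaches the generator of G N. *)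
pose t := lwhisker G v \c x.
pose e := eqhom (c11r G) \c (lwhisker G g \c t).
have qe : quotient_generator G \c e = lwhisker G (q \c g) \c t.
  rewrite /quotient_generator /e -!cmpA [eqhom _ \c (eqhom _ \c _)]cmpA eqhom_trans.
  by rewrite eqhom_refl cmp1m cmpA -lwhisker_cmp.
have sx : through (lwhisker G (amor N)) (lwhisker G s \c x - lwhisker G (s \c p) \c t).
  rewrite -[x in X in X - _]cmp1m -lwhisker_id id_S lwhiskerD !lwhisker_cmp cmpDl cmpDr.
  rewrite /t !cmpA addrK -lwhisker_cmp sc lwhisker_cmp -!cmpA; exact: through_self.
have qGe : through (lwhisker G (amor N)) (quotient_generator G \c (idm G - e)).
  rewrite cmpBr cmpm1 qe; apply: through_eq_trans (throughBC gen) _.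
  apply: through_eq_trans sx _; rewrite -cmpBl -lwhiskerB; apply: through_cmp.
  exact/lwhisker_through/throughBC.
have [[w [we _]] | iso_e] := indecomposable_local e (@splitC i i) indG (@endoC i i G).
  rewrite -we; do 2 apply: cideal_l; apply: cideal_r.
  exact: (@rideal_act _ _ _ R i i G).
case: (not_kills_duflo killG); apply: (kills_generated genx); apply: socle_mono.
by apply/(through_congr gen); exact: cancel_through qGe iso_e.
Qed.

Lemma ideal_vanishes (j : C) (X Y : C i j) (f : mor X Y) : kills X tau -> kills Y tau ->
  R j X Y f -> ~ R i G G (idm G) -> through (lwhisker Y (amor S)) (rwhisker f (atgt S)).
Proof.
move=> killX killY Rf RG; have [x [gen genx]] := socle_generator killX.
have [adj] := dual_adj Y.
pose y := rwhisker f (atgt S) \c x.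
have [y0 | y0] := EM (through (lwhisker Y (amor S)) y).
  have [h [m xh]] := genx _ (idm _).
  rewrite -[rwhisker f _]cmpm1 -[idm _](subrK (x \c h)) cmpDr xh cmpA whisker_exchange.
  apply: throughD; first by rewrite -cmpA; exact: through_self.
  by rewrite cmpA; exact: through_cmp.
(* The transpose of y is a nonzero element of S at Y' X. *)
have fy0 : ~ through (amor S) (flat adj y) by move/(through_flat adj).
have [t yt] := duflo_simple duflo fy0; case: RG.
apply: (@duflo_in_ideal (flat adj (eqhom (esym (c11r Y)) \c f) \c t)).
  apply/cideal_r/cideal_l; apply: (@rideal_act _ _ _ R j i (st dual Y)); exact: cideal_l.
apply: (@through_eq_trans _ _ _ _ _ _ _ (s \c (flat adj y \c t))).
  rewrite (cmpA q _ t) (cmpA s _ t) -!flat_cmpl -cmpBl; apply: through_cmp; rewrite -flatB.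
  apply/through_flat; rewrite [lwhisker Y q \c _]cmpA -/(quotient_generator Y).
  rewrite -quotient_generator_natural /y cmpA -whisker_exchange -cmpA -cmpBr.
  have [m ->] := throughBC gen.
  by rewrite cmpA whisker_exchange -cmpA; exact: through_self.
have [m ytm] := yt; have [c sc] := duflo_square duflo.
by rewrite -cmpBr ytm cmpA sc -cmpA; exact: through_self.
Qed.

End Ideals.

Lemma socle_full (j : C) (X Y : C i j) (phi : mor (X ** atgt S) (Y ** atgt S)) :
  kills X tau -> kills Y tau ->
  through (lwhisker Y (amor S)) (phi \c lwhisker X (amor S)) ->
  exists f : mor X Y, through (lwhisker Y (amor S)) (phi - rwhisker f (atgt S)).
Proof.
move=> killX killY phiS; have [x [gen genx]] := socle_generator killX.
have [y [geny gen'y]] := socle_generator killY.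
have [f phix] := gen'y _ (phi \c x); exists f.
have fx : through (lwhisker Y (amor S)) (rwhisker f (atgt S) \c x - y \c f).
  apply: socle_mono; rewrite cmpBr !cmpA -whisker_exchange.
  apply: (@through_eq_trans _ _ _ _ _ _ _ (quotient_generator Y \c f)).
    rewrite -quotient_generator_natural -cmpA -cmpBr; have [m ->] := gen.
    by rewrite cmpA whisker_exchange -cmpA; exact: through_self.
  by rewrite -cmpBl; apply: through_cmp; exact: throughBC.
have agree : through (lwhisker Y (amor S)) ((phi - rwhisker f (atgt S)) \c x).
  by rewrite cmpBl; apply: through_eq_trans phix (throughBC fx).
have [h [m xh]] := genx _ (idm _).
rewrite -[phi - _]cmpm1 -[idm _](subrK (x \c h)) cmpDr; apply: throughD; last first.
  by rewrite cmpA; exact: through_cmp.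
rewrite xh cmpBl cmpA; apply: throughB; first exact: through_cmp.
by rewrite cmpA whisker_exchange -cmpA; exact: through_self.
Qed.

End Duflo.

(** * Full functors and quotient categories *)

Section FullFunctors.
Variables (k : fieldType) (D E : lincat k) (F : functor D E).
Hypothesis F_surj : forall Y : E, exists X, F X = Y.
Hypothesis F_full : forall (X Y : D) (g : mor (F X) (F Y)), exists f : mor X Y, fmor F f = g.

(** Idempotents lift along a full functor: the Fitting idempotent of a lift is again
    a lift. *)
Lemma full_functor_additive :
  fully_additive D -> (forall X : D, endo_finite X) -> fully_additive E.
Proof.
move=> [[[Z zZ] bip] splitD] finD; split; first split.
- by exists (F Z); exact: functor_zero.
- move=> A B; have [A' <-] := F_surj A; have [B' <-] := F_surj B.
  by have [X bX] := bip A' B'; exists (F X); exact: functor_biproduct.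
- move=> Y; have [X <-] := F_surj Y => phi phi_idem.
  have [f fE] := F_full phi.
  have [e [z [n [ee fz _ nil]]]] := fitting_idempotent (f : endo X) (finD X).
  have powE m : fmor F ((f : endo X) ^+ m.+1) = phi.
    elim: m => [|m IH]; first by rewrite expr1.
    by rewrite exprS [fmor F _]fmorM IH fE.
  have phi_e : phi \c fmor F e = phi.
    have F1e : fmor F (1 - e : endo X) = idm (F X) - fmor F e.
      exact: etrans (linB (fmor_lin F) (idm X) e) (congr1 (fun u => u - _) (fmor1 F X)).
    have := etrans (esym (fmorM F _ _)) (etrans (congr1 (fmor F) nil) (lin0 (fmor_lin F))).
    rewrite powE F1e cmpBr cmpm1 => /eqP; rewrite subr_eq0 => /eqP phiE.
    exact: esym phiE.
  have eE : fmor F e = phi.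
    have eE : fmor F e = phi \c fmor F z by rewrite -fE -fmorM -[in LHS]fz.
    by rewrite -[RHS]phi_e eE cmpA phi_idem.
  have [W [i [p [pi ip]]]] := splitD X e ee.
  by exists (F W), (fmor F i), (fmor F p); rewrite -!fmorM pi ip fmor1 eE.
Qed.

End FullFunctors.

Section Preimages.
Variables (k : fieldType) (D E : lincat k) (F : functor D E) (I : cat_ideal E).

Definition preimage_subspace (X Y : D) : subspace (mor X Y).
Proof.
refine (@Subspace k (mor X Y) (fun f => I (F X) (F Y) (fmor F f)) _ _).
- by rewrite (lin0 (fmor_lin F)); exact: subspace0.
- by move=> a f g If Ig; rewrite fmor_lin; exact: subspaceP.
Defined.

Definition preimage_ideal : cat_ideal D.
Proof.
refine (@CatIdeal k D preimage_subspace _ _).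
- by move=> X Y Z g f; rewrite /= fmorM; exact: cideal_l.
- by move=> X Y Z g f; rewrite /= fmorM; exact: cideal_r.
Defined.

End Preimages.

Section QuotientFunctor.
Variables (k : fieldType) (D : lincat k) (I : cat_ideal D).

Definition quot_functor : functor D (quotcat I).
Proof.
refine (@Functor k D (quotcat I) (fun X => X) (fun X Y f => quot_in I f) _ _ _).
- by move=> X Y; exact: quot_in_lin.
- by [].
- by move=> X Y Z g f; rewrite quot_cmpE.
Defined.

Lemma quot_functor_full (X Y : D) (g : mor (quot_functor X) (quot_functor Y)) :
  exists f, fmor quot_functor f = g.
Proof. by exists (quot_rep g); exact: quot_repK. Qed.

Lemma quot_functor_eq0 (X Y : D) (f : mor X Y) : fmor quot_functor f = 0 <-> I X Y f.
Proof.
rewrite -[X in _ <-> I _ _ X]subr0 -quot_in_eq.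
by rewrite -(lin0 (@quot_in_lin k D I X Y)).
Qed.

End QuotientFunctor.

Section Spans.
Variables (k : fieldType) (D : lincat k) (P : D -> Prop).

(** The ideal generated by the identities of the objects in P. *)
Inductive spans (X Y : D) : mor X Y -> Prop :=
| Spans0 : spans 0
| SpansS A (a : mor X A) (b : mor A Y) f : P A -> spans f -> spans (b \c a + f).

Lemma spans_cmp X Y X' Y' (f : mor X Y) (g : mor Y Y') (h : mor X' X) :
  spans f -> spans (g \c f \c h).
Proof.
elim=> [|A a b {}f PA _ IH]; first by rewrite cmp0r cmp0l; exact: Spans0.
by rewrite cmpDr cmpDl !cmpA -cmpA; exact: SpansS.
Qed.

Lemma spansD X Y (f g : mor X Y) : spans f -> spans g -> spans (f + g).
Proof.
move=> sf sg; elim: sf => [|A a b {}f PA _ IH]; first by rewrite add0r.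
by rewrite -addrA; exact: SpansS.
Qed.

Lemma add_closure_spans X : add_closure P X -> spans (idm X).
Proof.
case=> Y SY /summand_retract[i [p <-]]; rewrite -[p]cmpm1; apply: spans_cmp.
elim: SY {i p X} => [X /is_zeroP -> | A B X PA _ IH [iA [iB [pA [pB [_ _ _ _ <-]]]]]].
  exact: Spans0.
apply: spansD; first by rewrite -[_ \c _]addr0; apply: SpansS => //; exact: Spans0.
by rewrite -[iB]cmpm1; exact: spans_cmp.
Qed.

End Spans.

Lemma direct_sum_sub (k : fieldType) (D : lincat k) (S T : D -> Prop) (X : D) :
  direct_sum S X -> (forall A, S A -> retract A X -> T A) -> direct_sum T X.
Proof.
elim=> [{}X zX _ | A B {}X SA _ IH bX ST]; first exact: DirectSum0.
apply: (DirectSumS (A := A) (B := B)) => //; first by apply: ST => //; apply: summand_retract; exists B.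
apply: IH => A' SA' rA'; apply: ST => //; apply: retract_trans rA' _.
by apply: summand_retract; exists A; exact: is_biproduct_sym.
Qed.

(** * Maximal left ideals *)

Section ExtendRow.
Variables (k : fieldType) (A : twocat k) (i : A) (R : rep_ideal (principal i)).

(** R in the row of i, and zero in the other rows. Deciding i = h classically makes it
    possible to transport R along this equality. *)
Definition extend_row (h j : A) : cat_ideal (A h j) :=
  match pselect (i = h) with
  | left e => match e in _ = h return cat_ideal (A h j) with erefl => R j end
  | right _ => source_cat_ideal i h j
  end.

Lemma extend_rowE j : extend_row i j = R j.
Proof. by rewrite /extend_row; case: pselect => // e; rewrite (Prop_irrelevance e erefl). Qed.

Definition row_left_ideal : left_ideal A.
Proof.
refine (@LeftIdeal k A extend_row _).
move=> h j l F F' X X' b a; rewrite /extend_row; case: pselect => [e | ne].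
  case: _ / e X X' a => X X' a Ra.
  have -> : b \h a = rwhisker b X' \c lwhisker F a.
    by rewrite /lwhisker /rwhisker -hc_cmp cmp1m cmpm1.
  by apply: (@cideal_l _ _ (R l)); exact: (@rideal_act _ _ _ R j l F X X' a).
by case=> [e | ->]; [case: (ne (esym e)) | right]; exact: (lin0 (hc_linr b)).
Defined.

Lemma row_left_ideal_source : left_sub row_left_ideal (source_ideal i).
Proof.
move=> h j F G a; rewrite /= /extend_row; case: pselect => [e _ | ne //].
by left; exact: esym.
Qed.

End ExtendRow.

Section Maximality.
Variables (k : fieldType) (C : twocat k) (I : two_ideal C) (i : C).
Variable K : left_ideal (quot2 I).

Definition pulled_ideal : rep_ideal (@principal k C i).
Proof.
refine (@RepIdeal k C (principal i) (fun j => preimage_ideal (quot_functor (I i j)) (K i j)) _).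
move=> j l F X Y f Kf; rewrite /= /lwhisker (qhcE I).
exact: (@lideal_h _ _ K i j l F F X Y).
Defined.

Section Sum.
Variable R : rep_ideal (@principal k C i).

Definition sum_subspace j (X Y : qcat I i j) : subspace (mor X Y).
Proof.
refine (@Subspace k (mor X Y)
  (fun f => exists2 r, R j X Y r & K i j X Y (f - quot_in (I i j) r)) _ _).
- exists 0; first exact: subspace0.
  by rewrite (lin0 (@quot_in_lin _ _ (I i j) X Y)) subr0; exact: subspace0.
- move=> a f g [r Rr Kr] [t Rt Kt]; exists (a *: r + t); first exact: subspaceP.
  have -> : a *: f + g - quot_in (I i j) (a *: r + t) =
      a *: (f - quot_in (I i j) r) + (g - quot_in (I i j) t).
    by rewrite quot_in_lin scalerBr opprD addrACA.
  exact: subspaceP.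
Defined.

Definition sum_cat_ideal j : cat_ideal (quot2 I i j).
Proof.
refine (@CatIdeal k (quot2 I i j) (@sum_subspace j) _ _).
- move=> X Y Z g f [r Rr Kr]; exists (quot_rep g \c r); first exact: cideal_l.
  rewrite -qcmpE quot_repK -(@cmpBr k (qcat I i j)); exact: (@cideal_l _ _ (K i j)).
- move=> X Y Z g f [r Rr Kr]; exists (r \c quot_rep f); first exact: cideal_r.
  rewrite -qcmpE quot_repK -(@cmpBl k (qcat I i j)); exact: (@cideal_r _ _ (K i j)).
Defined.

Definition sum_ideal : rep_ideal (@principal k (quot2 I) i).
Proof.
refine (@RepIdeal k (quot2 I) (@principal k (quot2 I) i) sum_cat_ideal _).
move=> j l F X Y f [r Rr Kr]; exists (@lwhisker k C i j l F X Y r).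
  exact: (@rideal_act _ _ _ R j l F X Y).
have -> : quot_in (I i l) (@lwhisker k C i j l F X Y r) =
    @lwhisker k (quot2 I) i j l F X Y (quot_in (I i j) r) by exact: qhcE.
rewrite -(@lwhiskerB k (quot2 I)); exact: (@lideal_h _ _ K i j l F F X Y).
Defined.

End Sum.

Variable L : mor1 C -> Prop.
Hypothesis sourceL : forall F : mor1 C, L F -> msrc F = i.
Hypothesis maxK : maximal_left_ideal L i K.
Hypothesis localL : forall (j : C) (F : C i j) (x : mor F F), L (Mor1 F) ->
  is_iso x \/ is_iso (idm F - x).

Lemma pulled_ideal_avoids j (F : C i j) : L (Mor1 F) -> ~ pulled_ideal j F F (idm F).
Proof. by case: maxK => _ avK _ /avK. Qed.

(** By maximality K contains the sum of K and R: as endomorphism rings of the F in L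
    are local, the sum contains id_F only if one of the two does. *)
Lemma pulled_ideal_maximal (R : rep_ideal (@principal k C i)) :
  (forall (j : C) (F : C i j), L (Mor1 F) -> ~ R j F F (idm F)) ->
  forall (j : C) (X Y : C i j) (f : mor X Y), R j X Y f -> pulled_ideal j X Y f.
Proof.
move=> avR j X Y f Rf; have [srcK avK maxiK] := maxK.
have -> : pulled_ideal j X Y f = K i j X Y (quot_in (I i j) f) by [].
apply: (maxiK (row_left_ideal (sum_ideal R))).
- exact: row_left_ideal_source.
- move=> F LF; have eF := sourceL LF; move: LF; case: F eF => h l F /= eF.
  case: _ / (esym eF) F => F LF; rewrite extend_rowE => -[r Rr Kr].
  have [[w [wr _]] | [w [wr _]]] := localL r LF.
    by apply: avR LF _; rewrite -wr; exact: cideal_l.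
  apply: avK LF _; have := @cideal_l _ _ (K i l) F F F (quot_in (I i l) w) _ Kr.
  rewrite -[X in X - _]/(quot_in (I i l) (idm F)).
  by rewrite -(linB (@quot_in_lin _ _ (I i l) F F)) qcmpE wr.
- move=> h l X' Y' g Kg; have [e | ->] := srcK _ _ _ _ _ Kg; last exact: subspace0.
  case: _ / (esym e) X' Y' g Kg => X' Y' g Kg; rewrite /= extend_rowE.
  exists 0; first exact: subspace0.
  by rewrite (lin0 (@quot_in_lin _ _ (I i l) X' Y')) subr0.
- rewrite /= extend_rowE; exists f => //.
  by rewrite subrr; exact: subspace0.
Qed.

End Maximality.

(** * Left cells *)

Section LeftOrder.
Variables (k : fieldType) (C : twocat k).
Hypothesis splitC : forall j l : C, split_idempotents (C j l).

Lemma retract_leL (i j l : C) (F : C i j) (G : C i l) (H : C j l) :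
  retract G (H ** F) -> leL (Mor1 F) (Mor1 G).
Proof. by move=> rG; apply: LeL; exact: retract_summand rG. Qed.

Lemma leL_source (A B : mor1 C) : leL A B ->
  exists (e : msrc A = msrc B) (H : C (mtgt A) (mtgt B)),
    retract (m1 B) (H ** (match e in _ = h return C h (mtgt A) with erefl => m1 A end)).
Proof. by case=> i j l F G H sG; exists erefl, H; exact: summand_retract. Qed.

Lemma leL_retract (i j l : C) (F : C i j) (G : C i l) :
  leL (Mor1 F) (Mor1 G) -> exists H : C j l, retract G (H ** F).
Proof. by case/leL_source=> e [H]; rewrite (Prop_irrelevance e erefl); exists H. Qed.

Lemma leL_trans (A B D : mor1 C) : leL A B -> leL B D -> leL A D.
Proof.
case: A B D => [i j F] [i' j' F'] [h l G] AB BD.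
have [/= e _] := leL_source AB; have [/= e' _] := leL_source BD.
case: _ / e' G BD => G BD; case: _ / e F' AB G BD => F' /leL_retract[H rF'] G /leL_retract[H' rG].
by apply: (@retract_leL _ _ _ _ _ (H' ** H)); rewrite -c1A; apply: retract_trans rG (retract_lwhisker _ _).
Qed.

Variable L : mor1 C -> Prop.
Hypothesis cellL : left_cell L.

Lemma cell_indecomposable (i j : C) (F : C i j) : L (Mor1 F) -> indecomposable F.
Proof. by case: cellL => F0 _ LE /LE[]. Qed.

Lemma cell_retract (i j l : C) (F : C i j) (F' : C i l) :
  L (Mor1 F) -> L (Mor1 F') -> exists H : C j l, retract F' (H ** F).
Proof.
case: cellL => F0 _ LE /LE[_ _ FF0] /LE[_ F0F' _].
exact/leL_retract/(leL_trans FF0).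
Qed.

Lemma cell_mem (i j l : C) (F : C i j) (F' : C i l) (H : C j l) (H' : C l j) :
  L (Mor1 F) -> indecomposable F' -> retract F' (H ** F) -> retract F (H' ** F') ->
  L (Mor1 F').
Proof.
case: cellL => F0 _ LE /LE[_ F0F FF0] indF' /retract_leL FF' /retract_leL F'F.
by apply/LE; split=> //; [exact: leL_trans F0F FF' | exact: leL_trans F'F FF0].
Qed.

End LeftOrder.

(** * The objects of the two 2-representations *)

Section Objects.
Variables (k : fieldType) (C : twocat k).
Hypothesis addC : forall j l : C, fully_additive (C j l).
Hypothesis endoC : forall (j l : C) (F : C j l), endo_finite F.
Variable dual : anti_involution C.
Hypothesis dual_adj : forall (j l : C) (X : C j l), inhabited (adjoint_pair (st dual X) X).
Variables (L : mor1 C -> Prop) (cellL : left_cell L) (i : C).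
Hypothesis sourceL : forall F : mor1 C, L F -> msrc F = i.
Variables (I : two_ideal C) (K : left_ideal (quot2 I)).
Hypothesis maxK : maximal_left_ideal L i K.
Variables (G : C i i) (LG : L (Mor1 G)).
Variables (S N : arrow (C i i)) (duflo : duflo_data L G S N).

Let splitC (j l : C) : split_idempotents (C j l) := (addC j l).2.
Let indG : indecomposable G := cell_indecomposable cellL LG.
Let killG : kills G (dufloT duflo) := duflo_killT duflo LG.
Let localL (j : C) (F : C i j) (x : mor F F) (LF : L (Mor1 F)) :
  is_iso x \/ is_iso (idm F - x) :=
  indecomposable_local x (@splitC i j) (cell_indecomposable cellL LF) (@endoC i j F).
Notation KC := (pulled_ideal i K).

Lemma cell_not_kills (j : C) (F : C i j) : L (Mor1 F) -> ~ kills F (amor S).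
Proof.
move=> LF killF; have [H rG] := cell_retract splitC cellL LF LG.
apply: (not_kills_duflo dual_adj killG); apply: kills_retract rG _.
exact: kills_comp.
Qed.

Definition vanishing_subspace (j : C) (X Y : C i j) : subspace (mor X Y).
Proof.
refine (@Subspace k (mor X Y)
  (fun f => through (lwhisker Y (amor S)) (rwhisker f (atgt S))) _ _).
- rewrite (lin0 (@rwhisker_lin _ _ _ _ _ X Y (atgt S))); exact: through0.
- by move=> a f g tf tg; rewrite rwhisker_lin; exact: through_lin.
Defined.

Definition vanishing_cat_ideal (j : C) : cat_ideal (C i j).
Proof.
refine (@CatIdeal k (C i j) (@vanishing_subspace j) _ _).
- move=> X Y Z g f [m fE]; rewrite /= rwhisker_cmp fE cmpA whisker_exchange -cmpA.
  exact: through_self.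
- by move=> X Y Z g f tg; rewrite /= rwhisker_cmp; exact: through_cmp.
Defined.

Definition vanishing_ideal : rep_ideal (@principal k C i).
Proof.
refine (@RepIdeal k C (principal i) vanishing_cat_ideal _).
move=> j l F X Y f /(@lwhisker_through _ _ _ _ _ F).
apply: through_arrow; [exact: arrow_whisker_ll | exact: arrow_whisker_lr].
Defined.

(** No F in L annihilates S, for G is a summand of some H F; so maximality applies to
    the 2-morphisms vanishing on S. *)
Lemma vanishing_pulled (j : C) (X Y : C i j) (f : mor X Y) :
  through (lwhisker Y (amor S)) (rwhisker f (atgt S)) -> KC j X Y f.
Proof.
move=> fS; apply: (pulled_ideal_maximal sourceL maxK localL (R := vanishing_ideal)) => //.
move=> l F LF; rewrite /= rwhisker_id; exact: cell_not_kills.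
Qed.

Lemma duflo_not_pulled : ~ KC i G G (idm G).
Proof. exact: pulled_ideal_avoids maxK _ _ LG. Qed.

(** Otherwise G is a summand of some H X, and id_G factors through the identity of
    H X, which lies in K. *)
Lemma pulled_kills (j : C) (X : C i j) : KC j X X (idm X) -> kills X (amor S).
Proof.
move=> KX; apply: contrapT => /(not_kills_le splitC endoC dual_adj indG killG)[H [a [b ba]]].
apply: duflo_not_pulled; rewrite -ba -[b]cmpm1 -lwhisker_id.
by apply/cideal_r/cideal_l; exact: (@rideal_act _ _ _ KC j i H X X).
Qed.

(** Up to 1-morphisms that annihilate S, the objects of D_L are the sums of 1-morphisms
    in L, already before passing to the quotient. *)
Definition cell_or_killed (j : C) (X : C i j) : Prop := L (Mor1 X) \/ kills X (amor S).

(** X annihilates N / S, as F does. If it does not annihilate S, then G is a summand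
    of X' X, so that X lies below G in the left order, as well as above F. *)
Lemma cell_dichotomy (j l : C) (F : C i j) (H : C j l) (X : C i l) :
  L (Mor1 F) -> indecomposable X -> retract X (H ** F) -> cell_or_killed X.
Proof.
move=> LF indX rX; have [killX | killX] := EM (kills X (amor S)); first by right.
left; have killT : kills X (dufloT duflo).
  exact: kills_retract rX (kills_comp _ (duflo_killT duflo LF)).
have rG := socle_support splitC endoC dual_adj indG killT killX.
have [H' rF] := cell_retract splitC cellL LG LF.
apply: (cell_mem (H' := H' ** st dual X) splitC cellL LF indX rX).
by rewrite -c1A; apply: retract_trans rF (retract_lwhisker _ rG).
Qed.

Lemma comp_cell_or_killed (j l : C) (F : C i j) (H : C j l) :
  L (Mor1 F) -> direct_sum (@cell_or_killed l) (H ** F).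
Proof.
move=> LF; have dec := indecomposable_decomposition (addC i l).1 (@endoC i l (H ** F)).
by apply: (direct_sum_sub dec) => X indX; exact: cell_dichotomy.
Qed.

Notation Qcat j := (quotcat (@row_ideal k (quot2 I) i K j)).

Definition cell_projection (j : C) : functor (C i j) (Qcat j) :=
  comp_functor (quot_functor (@row_ideal k (quot2 I) i K j)) (quot_functor (I i j)).

Lemma cell_projection_full (j : C) (X Y : C i j)
  (g : mor (cell_projection j X) (cell_projection j Y)) :
  exists f, fmor (cell_projection j) f = g.
Proof.
have [g' <-] := quot_functor_full g; have [f <-] := quot_functor_full g'.
by exists f.
Qed.

Lemma cell_projection_eq0 (j : C) (X Y : C i j) (f : mor X Y) :
  fmor (cell_projection j) f = 0 <-> KC j X Y f.
Proof. exact: (quot_functor_eq0 (@row_ideal k (quot2 I) i K j)). Qed.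

Lemma quotient_fully_additive (j : C) : fully_additive (Qcat j).
Proof.
apply: (full_functor_additive (F := cell_projection j)) => //; first by move=> Y; exists Y.
exact: cell_projection_full.
Qed.

(** Removing the terms of phi one at a time: as the endomorphism ring of Y is local,
    either the removed term or the rest stays invertible up to a left factor. *)
Lemma spans_indecomposable (j : C) (Y : C i j)
    (localY : forall x : mor Y Y, is_iso x \/ is_iso (idm Y - x))
    (phi : mor (cell_projection j Y) (cell_projection j Y)) :
  spans (fun F : Qcat j => L (@Mor1 k C i j F)) phi ->
  forall f : mor Y Y, fmor (cell_projection j) f = phi -> (exists w : mor Y Y, is_iso (w \c f)) ->
  (exists2 F : C i j, L (Mor1 F) & retract Y F) \/ KC j Y Y (idm Y).
Proof.
elim=> [f /cell_projection_eq0 Kf [w [v [vwf _]]] | F a b {}phi LF _ IH f fE [w [v [vwf _]]]].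
  by right; rewrite -vwf; do 2 apply: cideal_l.
have [a' aE] := @cell_projection_full j Y F a.
have [b' bE] := @cell_projection_full j F Y b.
have [[u [ux _]] | iso1] := localY (v \c (w \c (b' \c a'))).
  by left; exists F => //; exists a', (u \c v \c w \c b'); rewrite -!cmpA.
apply: (IH (f - b' \c a')).
  by rewrite (linB (fmor_lin _)) fmorM fE aE bE addrC addKr.
by exists (v \c w); rewrite cmpBr -!cmpA vwf.
Qed.

(** The identity of an indecomposable summand Y of X becomes, in the quotient, a sum
    of maps through elements of L. So Y is a summand of an element of L or id_Y lies
    in K, and then Y annihilates S. *)
Lemma D_object_direct_sum (j : C) (X : C i j) :
  @D_object k C L I i K j X <-> direct_sum (@cell_or_killed j) X.
Proof.
have addQ := quotient_fully_additive j.
split=> [DX | ].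
  have dec := indecomposable_decomposition (addC i j).1 (@endoC i j X).
  apply: (direct_sum_sub dec).
  move=> Y indY rYX.
  have [[F LF rYF] | KY] : (exists2 F : C i j, L (Mor1 F) & retract Y F) \/ KC j Y Y (idm Y).
  - apply: (@spans_indecomposable j Y _ (fmor (cell_projection j) (idm Y)) _ (idm Y)) => //.
    + by move=> x; apply: (indecomposable_local x (@splitC i j) indY); exact: endoC.
    + case: rYX => a [b ba]; rewrite -ba fmorM -[fmor _ b]cmpm1.
      by apply: spans_cmp; exact: add_closure_spans.
    + by exists (idm Y), (idm Y); rewrite !cmp1m.
  - apply: (@cell_dichotomy j j F (t1 j)) => //; by rewrite c11l.
  - by right; exact: pulled_kills.
elim=> [{}X zX | A B {}X LA _ IH bX].
  apply: direct_sum_add_closure; first by case: addQ.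
  by apply: DirectSum0; exact: (functor_zero (cell_projection j)).
apply: (@add_closure_biproduct _ (Qcat j) _ A B X addQ _ IH (functor_biproduct (cell_projection j) bX)).
case: LA => [LA | killA]; first by apply: add_closure_mem; first by case: addQ.
apply: direct_sum_add_closure; first by case: addQ.
apply/DirectSum0/is_zeroP; rewrite -[LHS](fmor1 (cell_projection j) A).
by apply/cell_projection_eq0/vanishing_pulled; rewrite rwhisker_id.
Qed.

End Objects.

(** * Fully faithful functors and equivalences *)

Lemma direct_sum_rel (k : fieldType) (D : lincat k) (S : D -> Prop) (P : D -> D -> Prop) :
    (forall X Y, is_zero X -> P X Y) -> (forall X Y, is_zero Y -> P X Y) ->
    (forall A B X Y, is_biproduct A B X -> P A Y -> P B Y -> P X Y) ->
    (forall A B X Y, is_biproduct A B Y -> P X A -> P X B -> P X Y) ->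
    (forall X Y, S X -> S Y -> P X Y) ->
  forall X Y, direct_sum S X -> direct_sum S Y -> P X Y.
Proof.
move=> zl zr bl br PS X Y SX SY; elim: SX => [{}X /zl // | A B {}X SA _ IH bX].
apply: (bl _ _ _ _ bX _ IH) => {B X IH bX}.
by elim: SY => [{}Y /zr // | A' B {}Y SA' _ IH bY]; apply: (br _ _ _ _ bY _ IH); exact: PS.
Qed.

Section FullyFaithful.
Variables (k : fieldType) (D E : lincat k) (F : functor D E).

Definition full_on (X Y : D) : Prop := forall g : mor (F X) (F Y), exists f, fmor F f = g.

Lemma full_direct_sum (S : D -> Prop) X Y : (forall X Y, S X -> S Y -> full_on X Y) ->
  direct_sum S X -> direct_sum S Y -> full_on X Y.
Proof.
move=> PS SX SY; apply: (direct_sum_rel (P := full_on) _ _ _ _ PS SX SY) => {PS SX SY} {}X {}Y.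
- by move=> /(functor_zero F)[zX _] g; exists 0; exact: zX.
- by move=> /(functor_zero F)[_ zY] g; exists 0; exact: zY.
- move=> X' Y' [iA [iB [pA [pB [_ _ _ _ e]]]]] fA fB g.
  have [f fE] := fA (g \c fmor F iA); have [h hE] := fB (g \c fmor F iB).
  exists (f \c pA + h \c pB); rewrite (linD (fmor_lin F)) !fmorM fE hE -!cmpA -!fmorM.
  by rewrite -cmpDr -(linD (fmor_lin F)) e fmor1 cmpm1.
- move=> X' Y' [iA [iB [pA [pB [_ _ _ _ e]]]]] fA fB g.
  have [f fE] := fA (fmor F pA \c g); have [h hE] := fB (fmor F pB \c g).
  exists (iA \c f + iB \c h); rewrite (linD (fmor_lin F)) !fmorM fE hE !cmpA -!fmorM.
  by rewrite -cmpDl -(linD (fmor_lin F)) e fmor1 cmp1m.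
Qed.

Definition vanishes_on (I : cat_ideal D) (X Y : D) : Prop :=
  forall f : mor X Y, I X Y f -> fmor F f = 0.

Lemma vanishes_direct_sum (I : cat_ideal D) (S : D -> Prop) X Y :
  (forall X Y, S X -> S Y -> vanishes_on I X Y) ->
  direct_sum S X -> direct_sum S Y -> vanishes_on I X Y.
Proof.
move=> PS SX SY.
apply: (direct_sum_rel (P := vanishes_on I) _ _ _ _ PS SX SY) => {PS SX SY} {}X {}Y.
- by move=> /(functor_zero F)[zX _] f _; exact: zX.
- by move=> /(functor_zero F)[_ zY] f _; exact: zY.
- move=> X' Y' [iA [iB [pA [pB [_ _ _ _ e]]]]] fA fB f If.
  rewrite -[f]cmpm1 -e cmpDr !cmpA (linD (fmor_lin F)) (fmorM F _ pA) (fmorM F _ pB).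
  by rewrite (fA _ (cideal_r _ If)) (fB _ (cideal_r _ If)) !cmp0l addr0.
- move=> X' Y' [iA [iB [pA [pB [_ _ _ _ e]]]]] fA fB f If.
  rewrite -[f]cmp1m -e cmpDl -!cmpA (linD (fmor_lin F)) (fmorM F iA) (fmorM F iB).
  by rewrite (fA _ (cideal_l _ If)) (fB _ (cideal_l _ If)) !cmp0r addr0.
Qed.

Hypothesis F_full : forall X Y, full_on X Y.
Hypothesis F_faithful : forall X Y (f : mor X Y), fmor F f = 0 -> f = 0.

Lemma faithful_inj X Y (f g : mor X Y) : fmor F f = fmor F g -> f = g.
Proof.
move=> fg; apply/eqP; rewrite -subr_eq0; apply/eqP/F_faithful.
by rewrite (linB (fmor_lin F)) fg subrr.
Qed.

Lemma full_faithful_retract X Y : split_idempotents D -> retract Y (F X) ->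
  exists X', isom (F X') Y.
Proof.
move=> splitD [i [p pi]]; have [e eE] := F_full (i \c p).
have ee : e \c e = e.
  by apply: faithful_inj; rewrite fmorM eE cmpA -(cmpA i) pi cmpm1.
have [X' [a [b [ba ab]]]] := splitD _ _ ee.
exists X', (p \c fmor F a), (fmor F b \c i); split.
  by rewrite cmpA -(cmpA _ i p) -eE -ab fmorM cmpA -fmorM ba fmor1 cmp1m -fmorM ba fmor1.
by rewrite cmpA -(cmpA p) -fmorM ab eE cmpA pi cmp1m pi.
Qed.

Lemma full_faithful_add_closure (T : E -> Prop) : fully_additive D ->
  (forall Y, T Y -> exists X, isom (F X) Y) ->
  forall Y, add_closure T Y -> exists X, isom (F X) Y.
Proof.
move=> [[[Z zZ] bip] splitD] FT Y [W TW /summand_retract rYW].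
have [X isoX] : exists X, isom (F X) W.
  elim: TW => [X zX | A B X /FT[A' isoA] _ [B' isoB] bX].
    have zFZ := functor_zero F zZ; exists Z, 0, 0.
    by split; [exact: zFZ.1 | exact: zX.1].
  have [X' bX'] := bip A' B'; exists X'.
  by apply: is_biproduct_unique bX; exact: is_biproduct_isom2 (functor_biproduct F bX').
apply: (@full_faithful_retract X) => //.
exact: retract_trans rYW (isom_retract (isom_sym isoX)).
Qed.

Lemma full_faithful_equivalence : (forall Y, exists X, isom (F X) Y) -> is_equivalence F.
Proof.
move=> F_ess.
have [g gP] := choice F_ess.
pose u Y : mor (F (g Y)) Y := sval (cid (gP Y)).
have uP Y : exists v, v \c u Y = idm _ /\ u Y \c v = idm _ by exact: svalP (cid (gP Y)).
pose v Y : mor Y (F (g Y)) := sval (cid (uP Y)).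
have vP Y : v Y \c u Y = idm _ /\ u Y \c v Y = idm _ by exact: svalP (cid (uP Y)).
pose lift X Y (h : mor (F X) (F Y)) : mor X Y := sval (cid (F_full h)).
have liftK X Y (h : mor (F X) (F Y)) : fmor F (lift X Y h) = h := svalP (cid (F_full h)).
have vu Y : v Y \c u Y = idm _ := (vP Y).1.
have uv Y : u Y \c v Y = idm _ := (vP Y).2.
pose gmor Y Y' (h : mor Y Y') := lift (g Y) (g Y') (v Y' \c h \c u Y).
have gmorE Y Y' (h : mor Y Y') : fmor F (gmor Y Y' h) = v Y' \c h \c u Y by exact: liftK.
have gmor_lin Y Y' : linear (@gmor Y Y').
  move=> a h h'; apply: faithful_inj; rewrite fmor_lin !gmorE.
  by rewrite (cmp_linr (v Y')) (cmp_linl (u Y)).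
have gmor1 Y : gmor Y Y (idm Y) = idm (g Y).
  by apply: faithful_inj; rewrite gmorE fmor1 cmpm1.
have gmorM X Y Z (h : mor Y Z) (h' : mor X Y) : gmor _ _ (h \c h') = gmor _ _ h \c gmor _ _ h'.
  apply: faithful_inj; rewrite fmorM !gmorE !cmpA.
  by rewrite -(cmpA (v Z \c h) (u Y)) uv cmpm1.
exists (@Functor k E D g gmor gmor_lin gmor1 gmorM); split.
- exists (fun X => lift (g (F X)) X (u (F X))); split=> [X | X Y f].
    exists (lift X (g (F X)) (v (F X))).
    by split; apply: faithful_inj; rewrite fmorM !liftK fmor1 ?vu ?uv.
  by apply: faithful_inj; rewrite !fmorM !liftK !cmpA uv cmp1m.
- exists u; split=> [Y | X Y f]; first by exists (v Y); exact: vP.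
  by rewrite /= gmorE !cmpA uv cmp1m.
Qed.

End FullyFaithful.

(** * Reading off the Duflo data *)

Lemma simple_top_unique (k : fieldType) (D : lincat k) (P P' T T' : D)
    (p : mor P T) (p' : mor P' T') :
  isom P P' -> is_simple_top p -> is_simple_top p' -> isom T T'.
Proof.
case=> w [w' [w'w ww']] [epi_p simT topT] [epi_p' simT' topT'].
have [g gE] := topT _ (p' \c w) simT'; have [g' g'E] := topT' _ (p \c w') simT.
exists g, g'; split.
  by apply: epi_p; rewrite -cmpA -gE cmpA -g'E -cmpA w'w cmpm1 cmp1m.
by apply: epi_p'; rewrite -cmpA -g'E cmpA -gE -cmpA ww' cmpm1 cmp1m.
Qed.

Lemma fiat_left_adjoint (k : fieldType) (C : twocat k) (dual : anti_involution C) :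
  (forall (i j : C) (F : C i j), exists alpha beta, @adjunction k C i j F (st dual F) alpha beta) ->
  forall (j l : C) (X : C j l), inhabited (adjoint_pair (st dual X) X).
Proof.
move=> adjC j l X; have [alpha [beta adj]] := adjC l j (st dual X).
have [v [vu uv]] := sti_iso dual X.
exact/inhabits/(adjoint_pair_isom uv vu)/(adjunction_adjoint_pair adj).
Qed.

Section ReadDuflo.
Variables (k : fieldType) (C : twocat k) (L : mor1 C -> Prop) (i : C) (G : C i i).
Hypothesis addC : fully_additive (C i i).
Hypothesis finC : finitely_many_indecomposables (C i i).
Hypothesis homC : forall X Y : C i i, finite_dim (mor X Y).

(** The simple top S' through which G is defined and the given one S are simple tops of
    P_G, up to the choice of a zero object, hence isomorphic; composition with an
    isomorphism makes S the socle of N. *)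
Lemma duflo_involution_data (S : Pbar i i) :
  duflo_involution L G -> simple_top_of G S -> exists N, inhabited (duflo_data L G S N).
Proof.
case=> LG [Z zZ [N [q [[epi_q [S' [s' [topS' socS' [T [c [cokc killT]]]]]]] _]]]].
case=> Z1 zZ1 [p top_p]; case: topS' => Z2 zZ2 [p' top_p'].
have isoP : isom (proj_object Z1 G : Pbar i i) (proj_object Z2 G).
  have H : idm G \c (0 : mor Z1 G) = (0 : mor Z2 G) \c 0 by rewrite !cmp0r.
  have H' : idm G \c (0 : mor Z2 G) = (0 : mor Z1 G) \c 0 by rewrite !cmp0r.
  exists (@abm k (C i i) (proj_object Z1 G) (proj_object Z2 G) _ _ H).
  exists (@abm k (C i i) (proj_object Z2 G) (proj_object Z1 G) _ _ H').
  by split; apply: etrans (abm_cmp _ _) _; apply/abm_eq; rewrite cmp1m subrr; exact: through0.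
have [g [g' [g'g gg']]] := simple_top_unique isoP top_p top_p'.
have mono_s : is_mono (s' \c g).
  move=> W a b ab; rewrite -[a]cmp1m -[b]cmp1m -g'g -!cmpA; congr (_ \c _).
  by case: socS' => mono_s' _ _; apply: mono_s'; rewrite !cmpA.
have cok_s : is_cokernel (s' \c g) c.
  case: cokc => cs univ; split=> [|W f]; first by rewrite cmpA cs cmp0l.
  by rewrite cmpA => fsg; apply: univ; rewrite -[f \c s']cmpm1 -gg' cmpA fsg cmp0l.
exists N.
case: top_p => epi_p simS _.
move: (s' \c g) mono_s cok_s => s.
elim/abm_ind: p epi_p => p0 p1 Hp epi_p; elim/abm_ind: q epi_q => q0 q1 Hq epi_q.
elim/abm_ind: s => s0 s1 Hs mono_s cok_s.
have addD := addC.1.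
have [W [r [rE killr]]] := ab_cokernel_target addD cok_s.
have epi_p1 := ab_epi_target addD epi_p.
constructor; apply: (@DufloData _ _ _ _ _ S N p1 q1 s1 W r) => //.
- by rewrite Hs; exact: through_self.
- exact: ab_epi_target addD epi_q.
- by move=> M y; exact: (ab_mono_target mono_s).
- by move=> j F LF; exact: (killr _ (post_functor i F) (killT j F LF)).
- move=> M y y0; have [h yh] := simple_generator addC finC homC simS y0.
  exists (h \c p1); rewrite cmpA -[X in _ - X]cmp1m -cmpBl; exact: through_cmp.
- move=> pS; case: simS => nzS _; apply: nzS; apply/ab_is_zeroP.
  have [u [v ->]] := epi_p1; apply: throughD; first exact: through_self.
  exact: through_cmp.
Qed.

End ReadDuflo.

(** * The comparison 2-natural transformation *)

Section Evaluation.
Variables (k : fieldType) (C : twocat k) (i : C) (S : arrow (C i i)) (j : C).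

Definition evaluation : functor (C i j) (Pbar i j).
Proof.
refine (@Functor k (C i j) (Pbar i j) (fun X => ract (Pbar i) X (S : Pbar i i))
  (fun X Y f => rnat (Pbar i) f (S : Pbar i i)) _ _ _).
- by move=> X Y; exact: rnat_lin.
- by move=> X; exact: rnat_id.
- by move=> X Y Z g f; exact: rnat_cmp.
Defined.

Lemma evaluation_eq0 (X Y : C i j) (f : mor X Y) :
  fmor evaluation f = 0 <-> through (lwhisker Y (amor S)) (rwhisker f (atgt S)).
Proof. exact: (@abm_eq0 k (C i j) (evaluation X) (evaluation Y)). Qed.

Lemma evaluation_zero (X : C i j) : kills X (amor S) -> is_zero (evaluation X).
Proof. by move=> killX; apply/ab_is_zeroP. Qed.

End Evaluation.

Definition corestrict (k : fieldType) (D E : lincat k) (F : functor D E) (P : E -> Prop)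
  (PF : forall X, P (F X)) : functor D (fullsub P).
Proof.
refine (@Functor k D (fullsub P) (fun X => exist P (F X) (PF X)) (fun X Y f => fmor F f) _ _ _).
- by move=> X Y; exact: (fmor_lin F).
- by move=> X; exact: (fmor1 F).
- by move=> X Y Z g f; exact: (fmorM F).
Defined.

Section SubTransformation.
Variables (k : fieldType) (C : twocat k) (M N : tworep C).
Variables (P : forall i : C, M i -> Prop) (Q : forall i : C, N i -> Prop).
Hypotheses (PS : rep_stable P) (QS : rep_stable Q).
Variable F : forall j, functor (fullsub (@P j)) (N j).
Hypothesis QF : forall j X, Q (F j X).
Hypothesis act : forall (j l : C) (H : C j l) (X : fullsub (@P j)),
  F l (sub_act PS H X) = ract N H (F j X).
Hypothesis act_mor : forall (j l : C) (H : C j l) (X Y : fullsub (@P j)) (f : mor X Y),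
  eqhom (act H Y) \c fmor (F l) (fmor (sub_act PS H) f) =
  fmor (ract N H) (fmor (F j) f) \c eqhom (act H X).
Hypothesis act_nat : forall (j l : C) (H H' : C j l) (a : mor H H') (X : fullsub (@P j)),
  eqhom (act H' X) \c fmor (F l) (rnat (subrep PS) a X) = rnat N a (F j X) \c eqhom (act H X).

Definition sub_transformation : two_transformation (subrep PS) (subrep QS).
Proof.
refine (@TwoTransformation k C (subrep PS) (subrep QS) (fun j => corestrict (@QF j))
  (fun j l H X => fullsub_eq (act H X :
     sval (corestrict (@QF l) (ract (subrep PS) H X)) =
     sval (ract (subrep QS) H (corestrict (@QF j) X)))) _ _).
- by move=> j l H X Y f; rewrite !fullsub_eqhomE; exact: act_mor.
- by move=> j l H H' a X; rewrite !fullsub_eqhomE; exact: act_nat.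
Defined.

End SubTransformation.

Lemma pullrep_quotient_act (k : fieldType) (C : twocat k) (I : two_ideal C)
    (M : tworep (quot2 I)) (R : rep_ideal M) (j l : C) (F : C j l) (X Y : M j) (f : mor X Y) :
  @fmor k (qrcat R j) (qrcat R l) (@ract k C (pullrep (quotrep R)) j l F) X Y
    (quot_in (R j) f) =
  quot_in (R l) (fmor (@ract k (quot2 I) M j l F) f).
Proof. exact: qractE. Qed.

Lemma pullrep_principal_act (k : fieldType) (C : twocat k) (I : two_ideal C) (i : C)
    (R : rep_ideal (@principal k (quot2 I) i)) (j l : C) (F : C j l) (X Y : quot2 I i j)
    (f : mor X Y) :
  @fmor k (qrcat R j) (qrcat R l) (@ract k C (pullrep (quotrep R)) j l F) X Y
    (quot_in (R j) (f : @mor k (@principal k (quot2 I) i j) X Y)) =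
  quot_in (R l) (@lwhisker k (quot2 I) i j l F X Y f).
Proof. exact: pullrep_quotient_act. Qed.

Lemma pullrep_principal_nat (k : fieldType) (C : twocat k) (I : two_ideal C) (i : C)
    (R : rep_ideal (@principal k (quot2 I) i)) (j l : C) (F F' : C j l) (a : mor F F')
    (X : quot2 I i j) :
  @rnat k C (pullrep (quotrep R)) j l F F' a X =
  quot_in (R l) (@rwhisker k (quot2 I) i j l F F' (quot_in (I j l) a) X).
Proof. by []. Qed.

Section EvaluationAction.
Variables (k : fieldType) (C : twocat k) (i : C) (S : arrow (C i i)).

Lemma evaluation_act (j l : C) (F : C j l) (X : C i j) :
  evaluation S l (F ** X) = ract (Pbar i) F (evaluation S j X).
Proof. exact: esym (ractM _ _ _ _). Qed.

Lemma evaluation_mor (j l : C) (F : C j l) (X Y : C i j) (f : mor X Y) :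
  eqhom (evaluation_act F Y) \c fmor (evaluation S l) (lwhisker F f) =
  fmor (ract (Pbar i) F) (fmor (evaluation S j) f) \c eqhom (evaluation_act F X).
Proof.
rewrite (eqhom_irr (evaluation_act F X) (esym (ractM _ _ _ _))).
rewrite (eqhom_irr (evaluation_act F Y) (esym (ractM _ _ _ _))); apply: eqhom_swap.
have := @rnat_hc k C (Pbar i) i j l F F _ _ (idm F) f S.
by rewrite rnat_id cmp1m => ->.
Qed.

Lemma evaluation_nat (j l : C) (F F' : C j l) (a : mor F F') (X : C i j) :
  eqhom (evaluation_act F' X) \c fmor (evaluation S l) (rwhisker a X) =
  rnat (Pbar i) a (evaluation S j X) \c eqhom (evaluation_act F X).
Proof.
rewrite (eqhom_irr (evaluation_act F X) (esym (ractM _ _ _ _))).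
rewrite (eqhom_irr (evaluation_act F' X) (esym (ractM _ _ _ _))); apply: eqhom_swap.
have := @rnat_hc k C (Pbar i) i j l F F' _ _ a (idm X) S.
by rewrite rnat_id fmor1 cmpm1 => ->.
Qed.

End EvaluationAction.

(** A 2-representation M whose 2-morphisms are classes, under pr, of 2-morphisms
    between the underlying 1-morphisms of C. If on the objects satisfying P the
    classes are exactly those of equality after evaluation at S, evaluation at S is an
    equivalence from the part of M on these objects to the 2-representation generated
    by Q. *)
Section Comparison.
Variables (k : fieldType) (C : twocat k) (i : C) (S : arrow (C i i)) (Q : Pbar i i).
Variables (M : tworep C) (P : forall j : C, M j -> Prop) (PS : rep_stable P).
Variable und : forall j, M j -> C i j.
Variable pr : forall j (X Y : M j), mor (und X) (und Y) -> mor X Y.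
Arguments pr {j X Y} _.
Hypothesis pr_full : forall j (X Y : M j) (g : mor X Y), exists f, pr f = g.
Hypothesis pr_lin : forall j (X Y : M j), linear (@pr j X Y).
Hypothesis pr1 : forall j (X : M j), pr (idm (und X)) = idm X.
Hypothesis prM : forall j (X Y Z : M j) (g : mor (und Y) (und Z)) (f : mor (und X) (und Y)),
  pr (g \c f) = pr g \c pr f.
Hypothesis pr_eq0 : forall j (X Y : M j) (f : mor (und X) (und Y)), P X -> P Y ->
  pr f = 0 <-> fmor (evaluation S j) f = 0.
Hypothesis und_act : forall (j l : C) (F : C j l) (X : M j), F ** und X = und (ract M F X).
Hypothesis pr_act : forall (j l : C) (F : C j l) (X Y : M j) (f : mor (und X) (und Y)),
  fmor (ract M F) (pr f) = pr (eqhom (und_act F Y) \c lwhisker F f \c eqhom (esym (und_act F X))).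
Hypothesis pr_nat : forall (j l : C) (F F' : C j l) (a : mor F F') (X : M j),
  rnat M a X = pr (eqhom (und_act F' X) \c rwhisker a (und X) \c eqhom (esym (und_act F X))).
Hypothesis evaluation_fullP : forall j (X Y : M j), P X -> P Y ->
  full_on (evaluation S j) (und X) (und Y).
Hypothesis evaluation_cell : forall j (X : M j), P X -> cell_object Q (evaluation S j (und X)).
Hypothesis generated : forall j (F : C i j), exists2 X : M j, P X &
  isom (evaluation S j (und X)) (ract (Pbar i) F Q).
Hypothesis additiveP : forall j, fully_additive (fullsub (@P j)).

Definition lift (j : C) (X Y : M j) (g : mor X Y) : mor (und X) (und Y) :=
  sval (cid (pr_full g)).

Lemma liftK (j : C) (X Y : M j) (g : mor X Y) : pr (lift g) = g.
Proof. exact: svalP (cid (pr_full g)). Qed.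

Lemma evaluation_lift (j : C) (X Y : M j) (f : mor (und X) (und Y)) (g : mor X Y) :
  P X -> P Y -> pr f = g -> fmor (evaluation S j) (lift g) = fmor (evaluation S j) f.
Proof.
move=> PX PY fg; apply/eqP; rewrite -subr_eq0 -(linB (fmor_lin (evaluation S j))).
by apply/eqP/pr_eq0 => //; rewrite (linB (@pr_lin j X Y)) liftK fg subrr.
Qed.

Definition descent (j : C) : functor (fullsub (@P j)) (Pbar i j).
Proof.
refine (@Functor k (fullsub (@P j)) (Pbar i j) (fun X => evaluation S j (und (sval X)))
  (fun X Y f => fmor (evaluation S j) (lift f)) _ _ _).
- move=> X Y a f g; rewrite -fmor_lin; apply: evaluation_lift; [exact: svalP..|].
  by rewrite pr_lin !liftK.
- by move=> X; rewrite -fmor1; apply: evaluation_lift; [exact: svalP..|exact: pr1].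
- move=> X Y Z g f; rewrite -fmorM; apply: evaluation_lift; [exact: svalP..|].
  by rewrite prM !liftK.
Defined.

Lemma descentE (j : C) (X Y : fullsub (@P j)) (f : mor (und (sval X)) (und (sval Y)))
    (g : mor X Y) : pr f = g -> fmor (descent j) g = fmor (evaluation S j) f.
Proof. exact: evaluation_lift (svalP X) (svalP Y). Qed.

Lemma descent_full (j : C) (X Y : fullsub (@P j)) : full_on (descent j) X Y.
Proof.
move=> g; have [f <-] := evaluation_fullP (svalP X) (svalP Y) g.
by exists (pr f); exact: descentE.
Qed.

Lemma descent_faithful (j : C) (X Y : fullsub (@P j)) (f : mor X Y) :
  fmor (descent j) f = 0 -> f = 0.
Proof. by move/(pr_eq0 _ (svalP X) (svalP Y)); rewrite liftK. Qed.

Lemma descent_act (j l : C) (F : C j l) (X : fullsub (@P j)) :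
  descent l (sub_act PS F X) = ract (Pbar i) F (descent j X).
Proof. by rewrite /= -und_act; exact: evaluation_act. Qed.

Lemma eqhom_conjugate (D E : lincat k) (T : functor D E) (A B A' B' : D) (f : mor A B)
    (eA : A = A') (eB : B = B') (Y Z : E) (g : mor Y Z) (e : T A = Y) (e' : T B = Z)
    (d : T A' = Y) (d' : T B' = Z) :
  eqhom e' \c fmor T f = g \c eqhom e ->
  eqhom d' \c fmor T (eqhom eB \c f \c eqhom (esym eA)) = g \c eqhom d.
Proof.
case: _ / eA d => d; case: _ / eB d' => d'.
by rewrite /= cmp1m cmpm1 (eqhom_irr d' e') (eqhom_irr d e).
Qed.

Definition comparison : two_transformation (subrep PS) (subrep (@cell_object_stable k C i Q)).
Proof.
refine (@sub_transformation k C M (Pbar i) P (@cell_object k C i Q) PS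
  (@cell_object_stable k C i Q) descent (fun j X => evaluation_cell (svalP X)) descent_act _ _).
- move=> j l F X Y f.
  have prf : pr (eqhom (und_act F (sval Y)) \c lwhisker F (lift f) \c
      eqhom (esym (und_act F (sval X)))) = fmor (ract M F) f by rewrite -pr_act liftK.
  rewrite (@descentE l (sub_act PS F X) (sub_act PS F Y) _ _ prf).
  exact: (eqhom_conjugate (und_act F (sval X)) (und_act F (sval Y)) (descent_act F X)
    (descent_act F Y) (evaluation_mor S F (lift f))).
- move=> j l F F' a X.
  rewrite (@descentE l (sub_act PS F X) (sub_act PS F' X) _ _ (esym (pr_nat a (sval X)))).
  exact: (eqhom_conjugate (und_act F (sval X)) (und_act F' (sval X)) (descent_act F X)
    (descent_act F' X) (evaluation_nat S a (und (sval X)))).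
Defined.

Lemma comparison_equivalence (j : C) : is_equivalence (comparison j).
Proof.
apply: full_faithful_equivalence.
- exact: descent_full.
- exact: descent_faithful.
- case=> Y; apply: (full_faithful_add_closure (@descent_full j) (@descent_faithful j)) => //.
  by move=> Z [F ->]; have [X PX isoX] := generated F; exists (exist _ X PX).
Qed.

Lemma comparison_elementary_equivalent :
  elementary_equivalent (subrep PS) (subrep (@cell_object_stable k C i Q)).
Proof. by left; exists comparison; exact: comparison_equivalence. Qed.

End Comparison.

Section CellComparison.
Variables (k : fieldType) (C : twocat k).
Hypothesis addC : forall j l : C, fully_additive (C j l).
Hypothesis endoC : forall (j l : C) (F : C j l), endo_finite F.
Variable dual : anti_involution C.
Hypothesis dual_adj : forall (j l : C) (X : C j l), inhabited (adjoint_pair (st dual X) X).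
Variables (L : mor1 C -> Prop) (cellL : left_cell L) (i : C).
Hypothesis sourceL : forall F : mor1 C, L F -> msrc F = i.
Variables (I : two_ideal C) (K : left_ideal (quot2 I)).
Hypothesis maxK : maximal_left_ideal L i K.
Variables (G : C i i) (LG : L (Mor1 G)).
Variables (S N : arrow (C i i)) (duflo : duflo_data L G S N).

Let splitC (j l : C) : split_idempotents (C j l) := (addC j l).2.
Let indG : indecomposable G := cell_indecomposable cellL LG.
Let killG : kills G (dufloT duflo) := duflo_killT duflo LG.
Notation KC := (pulled_ideal i K).
Notation Qrep := (@principal_quotient k C I i K).
Notation Qcat j := (quotcat (@row_ideal k (quot2 I) i K j)).
Notation D_obj := (@D_object k C L I i K).
Let D_sum (j : C) (X : C i j) : D_obj X <-> direct_sum (cell_or_killed L S (j := j)) X :=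
  @D_object_direct_sum _ _ addC endoC dual dual_adj _ cellL _ sourceL _ _ maxK _ LG _ _ duflo j X.

Let comp_sum (j l : C) (F : C i j) (H : C j l) (LF : L (Mor1 F)) :
    direct_sum (cell_or_killed L S (j := l)) (H ** F) :=
  comp_cell_or_killed addC endoC dual_adj cellL LG duflo H LF.

Lemma D_object_stable : rep_stable (M := Qrep) D_obj.
Proof.
move=> j l F X /D_sum SX; apply/D_sum.
elim: SX => [{}X zX | A B {}X LA _ IH bX].
  exact/DirectSum0/(functor_zero (post_functor i F)).
apply: direct_sum_biproduct (addC i l).1 _ IH (functor_biproduct (post_functor i F) bX).
case: LA => [LA | killA]; first exact: comp_sum.
by apply: (direct_sum_mem (addC i l).1); right; exact: kills_comp.
Qed.

Lemma evaluation_full (j : C) (X Y : C i j) : D_obj X -> D_obj Y ->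
  full_on (evaluation S j) X Y.
Proof.
move=> /D_sum SX /D_sum SY; apply: full_direct_sum SX SY => {}X {}Y.
move=> [LX | killX]; last by have [zX _] := evaluation_zero killX => _ g; exists 0; exact: zX.
move=> [LY | killY]; last by have [_ zY] := evaluation_zero killY => g; exists 0; exact: zY.
move=> g; elim/abm_ind: g => b c H.
have [|f cf] := socle_full dual_adj (duflo_killT duflo LX) (duflo_killT duflo LY) (phi := c).
  by rewrite [_ \c _]H; exact: through_self.
exists f; apply/(@abm_eq k (C i j) (evaluation S j X) (evaluation S j Y)).
exact: throughBC.
Qed.

Lemma evaluation_vanishes (j : C) (X Y : C i j) : D_obj X -> D_obj Y ->
  vanishes_on (evaluation S j) (KC j) X Y.
Proof.
move=> /D_sum SX /D_sum SY; apply: vanishes_direct_sum SX SY => {}X {}Y.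
move=> [LX | killX]; last by have [zX _] := evaluation_zero killX => _ f _; exact: zX.
move=> [LY | killY]; last by have [_ zY] := evaluation_zero killY => f _; exact: zY.
move=> f Kf; apply/evaluation_eq0.
have KG := duflo_not_pulled maxK LG.
by apply: (@ideal_vanishes _ _ _ _ _ _ _ duflo splitC endoC dual dual_adj indG killG KC) => //;
  exact: duflo_killT.
Qed.

Lemma evaluation_faithful (j : C) (X Y : C i j) (f : mor X Y) :
  fmor (evaluation S j) f = 0 -> KC j X Y f.
Proof.
by move/evaluation_eq0; apply: (vanishing_pulled addC endoC dual_adj cellL sourceL maxK LG duflo).
Qed.

Lemma evaluation_pulled (j : C) (X Y : C i j) (f : mor X Y) : D_obj X -> D_obj Y ->
  fmor (cell_projection i K j) f = 0 <-> fmor (evaluation S j) f = 0.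
Proof.
move=> DX DY; split=> [/cell_projection_eq0 Kf | /evaluation_faithful Kf].
  exact: (evaluation_vanishes DX DY).
exact/cell_projection_eq0.
Qed.

Lemma cell_projection_act (j l : C) (F : C j l) (X Y : C i j) (f : mor X Y) :
  fmor (ract Qrep F) (fmor (cell_projection i K j) f) =
  fmor (cell_projection i K l) (lwhisker F f).
Proof.
have whisker : @lwhisker k (quot2 I) i j l F X Y (quot_in (I i j) f) =
    quot_in (I i l) (lwhisker F f) by exact/esym/qhcE.
refine (eq_trans (@pullrep_principal_act k C I i (@row_ideal k (quot2 I) i K) j l F X Y
  (quot_in (I i j) f)) _).
by rewrite whisker.
Qed.

Let Q : Pbar i i := ract (Pbar i) G (S : Pbar i i).

Lemma Pbar_fully_additive (j : C) : fully_additive (Pbar i j).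
Proof. by apply: ab_fully_additive; case: (addC i j). Qed.

Lemma D_fully_additive (j : C) : fully_additive (fullsub (@D_object k C L I i K j)).
Proof. exact/fullsub_additive/quotient_fully_additive. Qed.

(** Every F in L is a summand of some H G, so that F S is a summand of H Q. *)
Lemma evaluation_cell_object (j : C) (X : C i j) : D_obj X -> cell_object Q (evaluation S j X).
Proof.
have addP := Pbar_fully_additive j.
move=> /D_sum; elim=> [{}X zX | A B {}X LA _ IH bX].
  apply: (direct_sum_add_closure addP.1).
  exact/DirectSum0/(functor_zero (evaluation S j)).
apply: (add_closure_biproduct addP _ IH (functor_biproduct (evaluation S j) bX)).
case: LA => [LA | /evaluation_zero zA]; last first.
  by apply: (direct_sum_add_closure addP.1); exact: DirectSum0.
have [H [a [b ba]]] := cell_retract splitC cellL LG LA.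
apply: (@add_closure_retract _ _ _ _ (evaluation S j (H ** G)) addP).
  by exists (fmor (evaluation S j) a), (fmor (evaluation S j) b); rewrite -fmorM ba fmor1.
apply: (add_closure_mem addP.1).
by exists H; rewrite /Q ractM.
Qed.

(** H Q = (H G) S, and H G is an object of D_L. *)
Lemma evaluation_generated (j : C) (H : C i j) :
  exists2 X : C i j, D_obj X & isom (evaluation S j X) (ract (Pbar i) H Q).
Proof.
exists (H ** G); first by apply/D_sum; exact: comp_sum.
exact/eqhom_isom/esym/ractM.
Qed.

Definition rep_projection (j : C) (X Y : Qrep j) (f : @mor k (C i j) X Y) : mor X Y :=
  fmor (cell_projection i K j) f.

Lemma rep_projection_full (j : C) (X Y : Qrep j) (g : mor X Y) : exists f, rep_projection f = g.
Proof. exact: (@cell_projection_full k C i I K j X Y g). Qed.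

Lemma rep_projection_lin (j : C) (X Y : Qrep j) : linear (@rep_projection j X Y).
Proof. exact: (@fmor_lin k _ _ (cell_projection i K j) X Y). Qed.

Lemma rep_projection1 (j : C) (X : Qrep j) : rep_projection (@idm k (C i j) X) = idm X.
Proof. exact: (fmor1 (cell_projection i K j) X). Qed.

Lemma rep_projectionM (j : C) (X Y Z : Qrep j) (g : @mor k (C i j) Y Z) (f : @mor k (C i j) X Y) :
  rep_projection (g \c f) = rep_projection g \c rep_projection f.
Proof. exact: (fmorM (cell_projection i K j) g f). Qed.

Lemma rep_projection_act (j l : C) (F : C j l) (X Y : Qrep j) (f : @mor k (C i j) X Y) :
  fmor (ract Qrep F) (rep_projection f) = rep_projection (lwhisker F f).
Proof. exact: cell_projection_act. Qed.

Lemma rep_projection_nat (j l : C) (F F' : C j l) (a : mor F F') (X : Qrep j) :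
  rnat Qrep a X = rep_projection (rwhisker a X).
Proof.
have whisker : @rwhisker k (quot2 I) i j l F F' (quot_in (I j l) a) X =
    quot_in (I i l) (rwhisker a X) by exact/esym/qhcE.
refine (eq_trans (@pullrep_principal_nat k C I i (@row_ideal k (quot2 I) i K) j l F F' a X) _).
by rewrite whisker.
Qed.

Lemma elementary_equivalence :
  elementary_equivalent (subrep D_object_stable) (cell_tworep G (S : Pbar i i)).
Proof.
apply: (@comparison_elementary_equivalent k C i S Q Qrep D_obj D_object_stable
  (fun j X => X) rep_projection rep_projection_full rep_projection_lin rep_projection1
  rep_projectionM (fun j X Y f DX DY => evaluation_pulled f DX DY) (fun j l F X => erefl)).
- by move=> j l F X Y f; rewrite /= cmp1m cmpm1; exact: rep_projection_act.
- by move=> j l F F' a X; rewrite /= cmp1m cmpm1; exact: rep_projection_nat.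
- by move=> j X Y; exact: evaluation_full.
- by move=> j X; exact: evaluation_cell_object.
- exact: evaluation_generated.
- exact: D_fully_additive.
Qed.

End CellComparison.

Theorem proposition22 (k : fieldType) (C : twocat k) (fiatC : fiat C)
    (J L : mor1 C -> Prop) (cellJ : two_sided_cell J) (cellL : left_cell L)
    (LJ : forall F : mor1 C, L F -> J F)
    (I : two_ideal C) (simpleI : J_simple I J)
    (i : C) (sourceL : forall F : mor1 C, L F -> msrc F = i)
    (K : left_ideal (quot2 I)) (maxK : maximal_left_ideal L i K)
    (G : C i i) (dufloG : duflo_involution L G)
    (S : Pbar i i) (topS : simple_top_of G S) :
  exists stableD : rep_stable (@D_object k C L I i K),
    let D_L := subrep stableD in
    let C_L := cell_tworep G S in
    [/\ additive_tworep D_L, additive_tworep C_L & elementary_equivalent D_L C_L].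
Proof.
case: fiatC => _ addC finC homC _ [dual adjC].
have endoC (j l : C) (F : C j l) : endo_finite F by exact/finite_dim_endo/homC.
have dual_adj := fiat_left_adjoint adjC.
have [N [duflo]] := duflo_involution_data (addC i i) (@finC i i) (@homC i i) dufloG topS.
have [LG _] := dufloG.
exists (D_object_stable addC endoC dual_adj cellL sourceL maxK LG duflo).
split=> [j | j |].
- exact: D_fully_additive.
- exact/fullsub_additive/Pbar_fully_additive.
- exact: elementary_equivalence.
Qed.
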